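(* Let $(G;X)$ be a regular polar space with quotient space $Q$, and $H$ be the isotropy of a regular section of the quotient map $X\to Q$. The fundamental group of $X$ is a central extension of the kernel of the morphism $\hat{\pi}_0(H)\rightarrow \pi_0(G)$ by a quotient of $\pi_1(G)$ by a $\pi_0(G)$-submodule $\theta_{\mathrm{uni}}$. In particular, there is an exact sequence $$0 \longrightarrow \theta_{\mathrm{uni}} \longrightarrow \pi_1(G) \longrightarrow \pi_1(X) \longrightarrow \hat{\pi}_0(H)\longrightarrow \pi_0(G) \longrightarrow 1.$$
   Context: Polar spaces. A polar space is a couple $(G;X)$ of a Lie group $G$ acting continuously and faithfully on a Hausdorff, connected, locally path-connected, semi-locally simply connected space $X$ such that: (1) $Q:=X/G$ is simply connected; (2) the quotient map $X\to Q$ admits a continuous section $x$; (3) the map $\phi_x:G\times Q\to X$, $(g;q)\mapsto g\cdot x(q)$, is a quotient map. The isotropy of $x$ is $H=\{(g;q)\in G\times Q\mid g\cdot x(q)=x(q)\}$, a subgroup over $Q$ of $G_Q:=G\times Q$, with fibres $H_q$. For $y\in G\times Q$, $\|y\|$ denotes its image in $Q$. Regularity. The section $x$ is regular if for every $q\in Q$ there are an open neighbourhood $U$ of $x(q)$ and a deformation retraction $h:[0;1]\times\phi_x^{-1}(U)\to\phi_x^{-1}(U)$ of $\phi_x^{-1}(U)$ onto $H_q\times\{q\}$ such that (1) $h_t(\phi_x^{-1}(U)\cap H)\subset\phi_x^{-1}(U)\cap H$ for all $t$; (2) if $y,z\in\phi_x^{-1}(U)$ lie over the same point of $Q$, the paths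 $t\mapsto\|h_t(y)\|$ and $t\mapsto\|h_t(z)\|$ coincide. A polar space is regular if it admits a regular section. The group $\hat\pi_0(H)$. Let $m:H\times_QH\to H$ be the fibrewise multiplication. For $c_1,c_2\in\pi_0(H)$ let $c_1\cdot c_2$ be the set of connected components of $H$ meeting $m(c_1\times_Qc_2)$. Then $\hat\pi_0(H)$ is the group with presentation $\langle\pi_0(H)\mid c_1c_2c_3^{-1},\ c_3\in c_1\cdot c_2\rangle$. The morphism $\hat\pi_0(H)\to\pi_0(G)$ is induced by the inclusion $H\subset G\times Q$ followed by the projection to $G$. $\pi_1(G)$ is the fundamental group of $G$ at the identity; $\pi_0(G)$ acts on it by conjugation. *)

(* Defs.v *)
From HB Require Import structures.
From mathcomp Require Import all_boot all_order all_algebra.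
From mathcomp Require Import all_classical all_reals all_analysis.
From mathcomp Require Import homotopy ring lra.
Set Implicit Arguments.
Unset Strict Implicit.
Unset Printing Implicit Defensive.
Import Order.TTheory GRing.Theory Num.Theory.
Import numFieldNormedType.Exports.
Local Open Scope classical_set_scope.
Local Open Scope quotient_scope.
Local Open Scope group_scope.

Section Subgroup.
Variables (G : groupType) (S : groupClosed G).

Definition subgroup := {x : G | x \in S}.

HB.instance Definition _ := SubChoice.on subgroup.

Let subgroup_closed : group_closed S.
Proof. by split; [exact: gpred1 | move=> x y; exact: gpredF]. Qed.

HB.instance Definition _ :=
  SubChoice_isSubGroup.Build G (fun x => x \in S) subgroup subgroup_closed.

End Subgroup.

Section Kernel.
Variables (G K : groupType) (f : UMagmaMorphism.type G K).

Definition ker_pred : {pred G} := [pred x | f x == 1].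

Let kerM : mulg_closed ker_pred.
Proof. by move=> x y /eqP fx /eqP fy; rewrite inE gmulfM fx fy mulg1. Qed.

Let ker1 : 1 \in ker_pred.
Proof. by rewrite inE gmulf1. Qed.

Let kerV : invg_closed ker_pred.
Proof. by move=> x /eqP fx; rewrite inE gmulfV fx invg1. Qed.

HB.instance Definition _ := isMulClosed.Build G ker_pred kerM.
HB.instance Definition _ := isMul1Closed.Build G ker_pred ker1.
HB.instance Definition _ := isInvClosed.Build G ker_pred kerV.

Definition ker_group : groupType := subgroup ker_pred.

End Kernel.

HB.mixin Record isNormalClosed (G : groupType) (S : {pred G}) := {
  gpredJn : forall x y, x \in S -> x ^ y \in S
}.

#[short(type="normalClosed")]
HB.structure Definition NormalClosed (G : groupType) :=
  {S of isNormalClosed G S & GroupClosed G S}.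

Section QuotientGroup.
Variables (G : groupType) (N : normalClosed G).

Definition coset_rel : rel G := fun x y => x^-1 * y \in N.

Let coset_refl : reflexive coset_rel.
Proof. by move=> x; rewrite /coset_rel mulVg gpred1. Qed.

Let coset_sym : symmetric coset_rel.
Proof. by move=> x y; rewrite /coset_rel -gpredV invgM invgK. Qed.

Let coset_trans : transitive coset_rel.
Proof.
move=> y x z xy yz; rewrite /coset_rel.
by rewrite -[z](mulVKg y) mulgA gpredM.
Qed.

Canonical coset_equiv := EquivRel coset_rel coset_refl coset_sym coset_trans.

Definition quotient_group := {eq_quot coset_equiv}.
HB.instance Definition _ := Choice.on quotient_group.
HB.instance Definition _ := EqQuotient.on quotient_group.

Definition quotient_proj (x : G) : quotient_group := \pi_{eq_quot coset_equiv} x.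

Let projP x y : coset_rel x y -> quotient_proj x = quotient_proj y.
Proof. by move=> xy; apply/(@eqmodP _ coset_equiv). Qed.

Let repr_projK (a : quotient_group) : quotient_proj (repr a) = a.
Proof. exact: (@reprK _ {eq_quot coset_equiv}). Qed.

Let repr_proj x : coset_rel (repr (quotient_proj x)) x.
Proof. by apply/(@eqmodP _ coset_equiv); exact: repr_projK. Qed.

Let qone := quotient_proj 1.
Let qmul (a b : quotient_group) := quotient_proj (repr a * repr b).
Let qinv (a : quotient_group) := quotient_proj (repr a)^-1.

Let qmulE x y : qmul (quotient_proj x) (quotient_proj y) = quotient_proj (x * y).
Proof.
apply: projP; have xr := repr_proj x; have yr := repr_proj y.
rewrite /coset_rel invgM -mulgA (mulgA _ x) -[y in X in _ * X](mulVKg (repr (quotient_proj y))).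
by rewrite mulgA mulgA -(mulgA _ _ (repr _)) gpredM// gpredJn.
Qed.

Let qinvE x : qinv (quotient_proj x) = quotient_proj x^-1.
Proof.
apply: projP; have xr := repr_proj x; rewrite /coset_rel invgK.
by have := gpredJn _ x^-1 xr; rewrite /conjg invgK mulgK -gpredV invgM invgK.
Qed.

Let quotP (a : quotient_group) : exists x, a = quotient_proj x.
Proof. by exists (repr a). Qed.

Let qmulA : associative qmul.
Proof.
by move=> a b c; have [[[x ->] [y ->]] [z ->]] := (quotP a, quotP b, quotP c);
  rewrite !qmulE mulgA.
Qed.
Let qmul1 : left_id qone qmul.
Proof. by move=> a; have [x ->] := quotP a; rewrite qmulE mul1g. Qed.
Let q1mul : right_id qone qmul.
Proof. by move=> a; have [x ->] := quotP a; rewrite qmulE mulg1. Qed.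
Let qmulV : left_inverse qone qinv qmul.
Proof. by move=> a; have [x ->] := quotP a; rewrite qinvE qmulE mulVg. Qed.
Let qVmul : right_inverse qone qinv qmul.
Proof. by move=> a; have [x ->] := quotP a; rewrite qinvE qmulE mulgV. Qed.

HB.instance Definition _ :=
  isGroup.Build quotient_group qmulA qmul1 q1mul qmulV qVmul.

Let quotient_projM : {morph quotient_proj : x y / x * y}.
Proof. by move=> x y; rewrite -qmulE. Qed.
HB.instance Definition _ := isUMagmaMorphism.Build G quotient_group
  quotient_proj (erefl, quotient_projM).

End QuotientGroup.

(* [(c, false)] stands for the generator [c] and [(c, true)] for its formal
   inverse. *)
Notation word T := (seq (T * bool)).

Section PresentedGroup.
Variables (T : choiceType) (rels : set (word T)).
Implicit Types u v w : word T.

Inductive word_eq : word T -> word T -> Prop :=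
| word_refl u : word_eq u u
| word_sym u v : word_eq u v -> word_eq v u
| word_trans u v w : word_eq u v -> word_eq v w -> word_eq u w
| word_cancel u c e v : word_eq (u ++ (c, e) :: (c, ~~ e) :: v) (u ++ v)
| word_relator u r v : rels r -> word_eq (u ++ r ++ v) (u ++ v).

Definition word_rel : rel (word T) := fun u v => `[< word_eq u v >].

Let word_rel_refl : reflexive word_rel.
Proof. by move=> u; apply/asboolP; exact: word_refl. Qed.
Let word_rel_sym : symmetric word_rel.
Proof. by move=> u v; apply/asboolP/asboolP; exact: word_sym. Qed.
Let word_rel_trans : transitive word_rel.
Proof.
by move=> v u w /asboolP uv /asboolP vw; apply/asboolP; exact: word_trans vw.
Qed.

Canonical word_equiv :=
  EquivRel word_rel word_rel_refl word_rel_sym word_rel_trans.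

Definition presented_group := {eq_quot word_equiv}.
HB.instance Definition _ := Choice.on presented_group.
HB.instance Definition _ := EqQuotient.on presented_group.

Definition word_class u : presented_group := \pi_{eq_quot word_equiv} u.

Lemma word_classP u v : word_class u = word_class v <-> word_eq u v.
Proof.
split=> [/(@eqmodP _ word_equiv)/asboolP//|uv].
by apply/(@eqmodP _ word_equiv)/asboolP.
Qed.

Let repr_classK (a : presented_group) : word_class (repr a) = a.
Proof. exact: (@reprK _ {eq_quot word_equiv}). Qed.

Let repr_class u : word_eq (repr (word_class u)) u.
Proof. by apply/word_classP; exact: repr_classK. Qed.

Let word_eq_ctx a b u v : word_eq u v -> word_eq (a ++ u ++ b) (a ++ v ++ b).
Proof.
elim=> {u v}.
- by move=> u; exact: word_refl.
- by move=> u v _; exact: word_sym.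
- by move=> u v w _ + _; exact: word_trans.
- by move=> u c e v; rewrite -!catA /= !(catA a); exact: word_cancel.
- by move=> u r v rr; rewrite -!catA /= !(catA a); exact: word_relator.
Qed.

Let word_eq_cat u u' v v' :
  word_eq u u' -> word_eq v v' -> word_eq (u ++ v) (u' ++ v').
Proof.
move=> uu' vv'; apply: (@word_trans _ (u' ++ v)).
  exact: (word_eq_ctx [::] v uu').
by have := word_eq_ctx u' [::] vv'; rewrite !cats0.
Qed.

Definition word_inv u : word T := rev [seq (c.1, ~~ c.2) | c <- u].

Let word_invK : involutive word_inv.
Proof.
move=> u; rewrite /word_inv map_rev revK -map_comp -[RHS]map_id.
by apply: eq_map => -[c e] /=; rewrite negbK.
Qed.

Let word_inv_cat u v : word_inv (u ++ v) = word_inv v ++ word_inv u.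
Proof. by rewrite /word_inv map_cat rev_cat. Qed.

Let word_mulV u : word_eq (u ++ word_inv u) [::].
Proof.
elim: u => [|[c e] u IH]; first exact: word_refl.
rewrite -cat1s word_inv_cat -catA (catA u).
apply: word_trans (word_eq_ctx [:: (c, e)] (word_inv [:: (c, e)]) IH) _.
exact: (word_cancel [::]).
Qed.

Let word_Vmul u : word_eq (word_inv u ++ u) [::].
Proof. by have := word_mulV (word_inv u); rewrite word_invK. Qed.

Let word_eq_inv u v : word_eq u v -> word_eq (word_inv u) (word_inv v).
Proof.
move=> uv; apply: (@word_trans _ (word_inv u ++ (v ++ word_inv v))).
  apply: word_sym; rewrite -[X in word_eq _ X]cats0.
  by apply: word_eq_cat (word_mulV v); exact: word_refl.
rewrite catA -[X in word_eq _ X]cat0s; apply: word_eq_cat (word_refl _).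
apply: word_trans (word_Vmul u); apply: word_eq_cat (word_sym uv).
exact: word_refl.
Qed.

Let pone := word_class [::].
Let pmul (a b : presented_group) := word_class (repr a ++ repr b).
Let pinv (a : presented_group) := word_class (word_inv (repr a)).

Let pmulE u v : pmul (word_class u) (word_class v) = word_class (u ++ v).
Proof. by apply/word_classP/word_eq_cat; exact: repr_class. Qed.

Let pinvE u : pinv (word_class u) = word_class (word_inv u).
Proof. by apply/word_classP/word_eq_inv/repr_class. Qed.

Let presP (a : presented_group) : exists u, a = word_class u.
Proof. by exists (repr a). Qed.

Let pmulA : associative pmul.
Proof.
by move=> a b c; have [[[x ->] [y ->]] [z ->]] := (presP a, presP b, presP c);
  rewrite !pmulE catA.
Qed.
Let pmul1 : left_id pone pmul.
Proof. by move=> a; have [x ->] := presP a; rewrite pmulE. Qed.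
Let p1mul : right_id pone pmul.
Proof. by move=> a; have [x ->] := presP a; rewrite pmulE cats0. Qed.
Let pmulV : left_inverse pone pinv pmul.
Proof.
by move=> a; have [x ->] := presP a; rewrite pinvE pmulE; apply/word_classP.
Qed.
Let pVmul : right_inverse pone pinv pmul.
Proof.
by move=> a; have [x ->] := presP a; rewrite pinvE pmulE; apply/word_classP.
Qed.

HB.instance Definition _ :=
  isGroup.Build presented_group pmulA pmul1 p1mul pmulV pVmul.

Lemma word_class_cat u v : word_class (u ++ v) = word_class u * word_class v.
Proof. by rewrite -pmulE. Qed.

Lemma word_class_nil : word_class [::] = 1.
Proof. by []. Qed.

Section Eval.
Variables (K : groupType) (f : T -> K).

Definition word_eval u : K :=
  \prod_(c <- u) (if c.2 then (f c.1)^-1 else f c.1).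

Lemma word_eval_cat u v : word_eval (u ++ v) = word_eval u * word_eval v.
Proof. by rewrite /word_eval big_cat. Qed.

Lemma word_eval_eq u v :
  (forall r, rels r -> word_eval r = 1) -> word_eq u v ->
  word_eval u = word_eval v.
Proof.
move=> fr; elim=> {u v} // [u v w _ -> _ //|u c e v|u r v rr].
  rewrite !word_eval_cat; congr (_ * _); rewrite /word_eval !big_cons /=.
  by case: e => /=; rewrite ?mulKg ?mulVKg.
by rewrite !word_eval_cat (fr _ rr) mul1g.
Qed.

(* The morphism extending [f]; it is one as soon as [f] kills the relators. *)
Definition presented_lift (a : presented_group) : K := word_eval (repr a).

Lemma presented_lift_morphism :
  (forall r, rels r -> word_eval r = 1) -> monoid.monoid_morphism presented_lift.
Proof.
move=> fr; have liftE u : presented_lift (word_class u) = word_eval u.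
  exact: word_eval_eq (repr_class u).
split=> [|a b]; first by rewrite -word_class_nil liftE /word_eval big_nil.
have [[u ->] [v ->]] := (presP a, presP b).
by rewrite -word_class_cat !liftE word_eval_cat.
Qed.

End Eval.

End PresentedGroup.

Section Exactness.
Variables A B C : groupType.

Definition exact_at (f : A -> B) (g : B -> C) :=
  forall b, g b = 1 <-> exists a, f a = b.

Definition surjective (g : B -> C) := forall c, exists b, g b = c.

(* [1 -> A -> B -> C -> 1] exhibits [B] as a central extension of [C] by [A]. *)
Definition central_extension
    (i : UMagmaMorphism.type A B) (p : UMagmaMorphism.type B C) :=
  [/\ injective i, exact_at i p, surjective p & forall a b, commute (i a) b].

End Exactness.


Section ContinuityFacts.
Context {S T U : topologicalType}.

Lemma continuous_cmp (g : T -> U) (f : S -> T) :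
  continuous f -> continuous g -> continuous (g \o f).
Proof. by move=> cf cg s; apply: continuous_comp; [exact: cf | exact: cg]. Qed.

Lemma continuous_pair (f : S -> T) (g : S -> U) :
  continuous f -> continuous g -> continuous (fun s => (f s, g s)).
Proof. by move=> cf cg s; apply: cvg_pair; [exact: cf | exact: cg]. Qed.

Lemma continuous_fst : continuous (@fst S T).
Proof. by move=> s; exact: cvg_fst. Qed.

Lemma continuous_snd : continuous (@snd S T).
Proof. by move=> s; exact: cvg_snd. Qed.

End ContinuityFacts.

Section RealContinuity.
Context {R : realType} {S : topologicalType}.
Implicit Types f g : S -> R.

Lemma real_continuousD f g : continuous f -> continuous g ->
  continuous (fun s => f s + g s)%R.
Proof. by move=> cf cg s; apply: (@cvgD _ R^o); [exact: cf | exact: cg]. Qed.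

Lemma real_continuousB f g : continuous f -> continuous g ->
  continuous (fun s => f s - g s)%R.
Proof. by move=> cf cg s; apply: (@cvgB _ R^o); [exact: cf | exact: cg]. Qed.

Lemma real_continuousM f g : continuous f -> continuous g ->
  continuous (fun s => f s * g s)%R.
Proof. by move=> cf cg s; apply: cvgM; [exact: cf | exact: cg]. Qed.

Lemma real_continuous_min f g : continuous f -> continuous g ->
  continuous (fun s => Num.min (f s) (g s)).
Proof. by move=> cf cg s; apply: continuous_min; [exact: cf | exact: cg]. Qed.

Lemma real_continuous_max f g : continuous f -> continuous g ->
  continuous (fun s => Num.max (f s) (g s)).
Proof. by move=> cf cg s; apply: continuous_max; [exact: cf | exact: cg]. Qed.

Lemma real_continuous_cst (c : R) : continuous (fun _ : S => c).
Proof. exact: cst_continuous. Qed.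

End RealContinuity.

Lemma continuous_paste (R : realType) (S T : topologicalType) (p : S -> R)
    (f g : S -> T) (c : R) :
  continuous p -> continuous f -> continuous g ->
  (forall s, p s = c -> f s = g s) ->
  continuous (fun s => if (p s <= c)%R then f s else g s).
Proof.
move=> cp cf cg fg; apply/continuous_subspace_setT.
pose A := [set s | (p s <= c)%R]; pose B := [set s | (c <= p s)%R].
have -> : [set: S] = A `|` B.
  by apply/seteqP; split=> // s _; case: (leP (p s) c) => [|/ltW]; [left|right].
have clA : closed A by move/continuous_closedP: cp => /(_ _ (@closed_le _ c)).
have clB : closed B by move/continuous_closedP: cp => /(_ _ (@closed_ge _ c)).
apply: withinU_continuous => //.
- apply: (@subspace_eq_continuous _ A _ f); last exact: continuous_subspaceT.
  by move=> s /set_mem psc; rewrite /from_subspace /= (psc : (p s <= c)%R).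
- apply: (@subspace_eq_continuous _ B _ g); last exact: continuous_subspaceT.
  move=> s /set_mem cps; rewrite /from_subspace /=; case: ifPn => // psc; rewrite fg//.
  by apply/eqP; rewrite eq_le psc cps.
Qed.

Section UnitInterval.
Variable R : realType.

Definition unit_itv : Type := set_type `[0%R, 1%R : R]%classic.

HB.instance Definition _ := Topological.on unit_itv.

Definition itv_val (t : unit_itv) : R := val t.

Lemma itv_val_continuous : continuous itv_val.
Proof. exact: initial_continuous. Qed.

Lemma itv_valP t : (0 <= itv_val t <= 1)%R.
Proof. by have := set_mem (valP t); rewrite /= in_itv. Qed.

Let clamp (t : R) : R := Num.max 0%R (Num.min 1%R t).

Let clampP t : clamp t \in `[0%R, 1%R : R]%classic.
Proof.
by rewrite inE /= in_itv /= /clamp le_max lexx ge_max ler01 ge_min lexx.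
Qed.

Definition to_itv (t : R) : unit_itv := exist _ (clamp t) (clampP t).

Lemma to_itvE (t : R) : (0 <= t <= 1)%R -> itv_val (to_itv t) = t.
Proof. by case/andP=> t0 t1; rewrite /itv_val /= /clamp min_r// max_r. Qed.

Lemma itv_valK : cancel itv_val to_itv.
Proof. by move=> t; apply: val_inj; exact: to_itvE (itv_valP t). Qed.

Lemma to_itv_continuous : continuous to_itv.
Proof.
apply: continuous_comp_initial => t; apply: continuous_max.
  exact: cst_continuous.
by apply: continuous_min; [exact: cst_continuous | exact].
Qed.

Let itv01 : to_itv 0%R != to_itv 1%R.
Proof.
apply/eqP => /(congr1 itv_val); rewrite !to_itvE ?lexx ?ler01//.
by move/eqP; rewrite eq_sym oner_eq0.
Qed.

HB.instance Definition _ := isBiPointed.Build unit_itv itv01.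

Lemma itv_val0 : itv_val zero = 0%R.
Proof. by rewrite to_itvE// lexx ler01. Qed.

Lemma itv_val1 : itv_val one = 1%R.
Proof. by rewrite to_itvE// lexx ler01. Qed.

Lemma to_itv0 : to_itv 0%R = zero. Proof. by []. Qed.
Lemma to_itv1 : to_itv 1%R = one. Proof. by []. Qed.

Lemma to_itv_ge1 t : (1 <= t)%R -> to_itv t = one.
Proof.
by move=> t1; apply: val_inj; rewrite /= /clamp !min_l.
Qed.

Lemma to_itv_le0 t : (t <= 0)%R -> to_itv t = zero.
Proof.
move=> t0; apply: val_inj; rewrite /= /clamp (min_r (le_trans t0 ler01)).
by rewrite (min_r ler01) !max_l.
Qed.

End UnitInterval.

Notation path_in R x y := {path (unit_itv R) from x to y}.
Notation loop R b := {path (unit_itv R) from b to b}.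

Section Homotopy.
Variables (R : realType) (T : topologicalType).
Implicit Types x y : T.
Local Notation I := (unit_itv R).

(* The first coordinate of [h] is the parameter of the homotopy. *)
Definition path_homotopic x y (f g : path_in R x y) :=
  exists h : I * I -> T,
    [/\ continuous h,
        forall t, h (zero, t) = f t,
        forall t, h (one, t) = g t &
        forall s, h (s, zero) = x /\ h (s, one) = y].

Definition path_connected (A : set T) := forall x y, A x -> A y ->
  exists f : path_in R x y, range f `<=` A.

Definition locally_path_connected := forall x (U : set T), nbhs x U ->
  exists V, [/\ open V, V x, V `<=` U & path_connected V].

Definition simply_connected :=
  path_connected [set: T] /\
  forall b (f : loop R b), path_homotopic f (cst b).

Definition semilocally_simply_connected := forall x, exists2 U, nbhs x U &
  forall f : loop R x, range f `<=` U -> path_homotopic f (cst x).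

Lemma path_homotopic_reparam (k : R -> T) (phi0 phi1 : I -> R) x y
    (f g : path_in R x y) :
  continuous k -> continuous phi0 -> continuous phi1 ->
  phi0 zero = phi1 zero -> phi0 one = phi1 one ->
  f =1 k \o phi0 -> g =1 k \o phi1 -> path_homotopic f g.
Proof.
move=> ck c0 c1 e0 e1 fk gk.
pose phi (u : I * I) : R :=
  ((1 - itv_val u.1) * phi0 u.2 + itv_val u.1 * phi1 u.2)%R.
have cphi : continuous phi.
  have cs : continuous (fun u : I * I => itv_val u.1).
    exact: continuous_cmp continuous_fst (@itv_val_continuous R).
  have ct phi' : continuous phi' -> continuous (fun u : I * I => phi' u.2 : R).
    by move=> c; exact: continuous_cmp continuous_snd c.
  apply: real_continuousD; apply: real_continuousM; [|exact: ct|exact: cs|exact: ct].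
  by apply: real_continuousB; [exact: real_continuous_cst | exact: cs].
exists (k \o phi); split => [|t|t|s] /=.
- exact: continuous_cmp.
- by rewrite fk /phi /= itv_val0; congr k; ring.
- by rewrite gk /phi /= itv_val1; congr k; ring.
- rewrite /phi /= e0 e1; split.
    by rewrite -[RHS](path_zero (s := g)) gk /=; congr k; ring.
  by rewrite -[RHS](path_one (s := g)) gk /=; congr k; ring.
Qed.

Lemma path_homotopic_refl x y (f : path_in R x y) : path_homotopic f f.
Proof.
exists (f \o snd); split=> //= [|s]; last by rewrite path_zero path_one.
exact: continuous_cmp continuous_snd (@cts_fun _ _ f).
Qed.

Lemma path_homotopic_sym x y (f g : path_in R x y) :
  path_homotopic f g -> path_homotopic g f.
Proof.
move=> [h [ch h0 h1 hxy]].
pose r (s : I) : I := to_itv (1 - itv_val s)%R.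
have cr : continuous r.
  apply: continuous_cmp (@to_itv_continuous R); apply: real_continuousB.
    exact: real_continuous_cst.
  exact: itv_val_continuous.
exists (fun u => h (r u.1, u.2)); split=> [|t|t|s] //=.
- apply: (continuous_cmp (g := h) _ ch); apply: continuous_pair; last exact: continuous_snd.
  exact: continuous_cmp continuous_fst cr.
- by rewrite /r itv_val0 subr0 h1.
- by rewrite /r itv_val1 subrr h0.
Qed.

Definition itv_half1 (t : I) : I := to_itv (2 * itv_val t)%R.
Definition itv_half2 (t : I) : I := to_itv (2 * itv_val t - 1)%R.

Let dbl_continuous : continuous (fun t : I => (2 * itv_val t)%R : R).
Proof.
by apply: real_continuousM; [exact: real_continuous_cst|
  exact: itv_val_continuous].
Qed.

Let half1_continuous : continuous itv_half1.
Proof. exact: continuous_cmp dbl_continuous (@to_itv_continuous R). Qed.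

Let half2_continuous : continuous itv_half2.
Proof.
apply: continuous_cmp (@to_itv_continuous R); apply: real_continuousB.
  exact: dbl_continuous.
exact: real_continuous_cst.
Qed.

Let half_mid (t : I) :
  itv_val t = (2^-1)%R -> itv_half1 t = one /\ itv_half2 t = zero.
Proof.
move=> th; rewrite /itv_half1 /itv_half2 th.
by split; [rewrite to_itv_ge1//; lra | rewrite to_itv_le0//; lra].
Qed.

Lemma path_homotopic_trans x y (f g h : path_in R x y) :
  path_homotopic f g -> path_homotopic g h -> path_homotopic f h.
Proof.
move=> [k [ck k0 k1 kxy]] [l [cl l0 l1 lxy]].
exists (fun u : I * I => if (itv_val u.1 <= 2^-1)%R then k (itv_half1 u.1, u.2)
                         else l (itv_half2 u.1, u.2)).
have pairc (phi : I -> I) :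
    continuous phi -> continuous (fun u : I * I => (phi u.1, u.2)).
  move=> cphi; apply: continuous_pair; last exact: continuous_snd.
  exact: continuous_cmp continuous_fst cphi.
split=> [|t|t|s] /=.
- apply: (continuous_paste (p := fun u : I * I => itv_val u.1)).
  + exact: continuous_cmp continuous_fst (@itv_val_continuous R).
  + exact: continuous_cmp (pairc _ half1_continuous) ck.
  + exact: continuous_cmp (pairc _ half2_continuous) cl.
  + by move=> [s t] /= /half_mid[-> ->]; rewrite k1 l0.
- rewrite itv_val0 ifT; last by lra.
  by rewrite /itv_half1 itv_val0 mulr0 k0.
- rewrite itv_val1 ifF; last by apply/negbTE; rewrite -ltNge; lra.
  by rewrite /itv_half2 itv_val1 to_itv_ge1 ?l1//; lra.
- by case: ifP => _; [have [-> ->] := kxy (itv_half1 s) |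
    have [-> ->] := lxy (itv_half2 s)].
Qed.

Section Concatenation.
Variables x y z : T.

Definition concat_fun (f : path_in R x y) (g : path_in R y z) (t : I) : T :=
  if (itv_val t <= 2^-1)%R then f (itv_half1 t) else g (itv_half2 t).

Variables (f : path_in R x y) (g : path_in R y z).

Let concat_continuous : continuous (concat_fun f g).
Proof.
apply: (continuous_paste (@itv_val_continuous R)).
- exact: continuous_cmp half1_continuous (@cts_fun _ _ f).
- exact: continuous_cmp half2_continuous (@cts_fun _ _ g).
- by move=> t /half_mid[-> ->]; rewrite path_one path_zero.
Qed.

Let concat_zero : concat_fun f g zero = x.
Proof.
rewrite /concat_fun itv_val0 ifT; last by lra.
by rewrite /itv_half1 itv_val0 mulr0 to_itv0 path_zero.
Qed.

Let concat_one : concat_fun f g one = z.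
Proof.
rewrite /concat_fun itv_val1 ifF; last by apply/negbTE; rewrite -ltNge; lra.
by rewrite /itv_half2 itv_val1 to_itv_ge1 ?path_one//; lra.
Qed.

Definition concat : path_in R x z :=
  mk_path concat_continuous concat_zero concat_one.

Lemma concatE t : concat t = concat_fun f g t.
Proof. by []. Qed.

End Concatenation.

Section Reversal.
Variables (x y : T) (f : path_in R x y).

Definition reverse_fun (t : I) : T := f (to_itv (1 - itv_val t)%R).

Let reverse_continuous : continuous reverse_fun.
Proof.
apply: continuous_cmp (@cts_fun _ _ f).
apply: continuous_cmp (@to_itv_continuous R); apply: real_continuousB.
  exact: real_continuous_cst.
exact: itv_val_continuous.
Qed.

Let reverse_zero : reverse_fun zero = y.
Proof. by rewrite /reverse_fun itv_val0 subr0 path_one. Qed.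

Let reverse_one : reverse_fun one = x.
Proof. by rewrite /reverse_fun itv_val1 subrr path_zero. Qed.

Definition reverse : path_in R y x :=
  mk_path reverse_continuous reverse_zero reverse_one.

End Reversal.

Lemma concat_homotopic x y z (f f' : path_in R x y) (g g' : path_in R y z) :
  path_homotopic f f' -> path_homotopic g g' ->
  path_homotopic (concat f g) (concat f' g').
Proof.
move=> [k [ck k0 k1 kxy]] [l [cl l0 l1 lxy]].
exists (fun u : I * I => if (itv_val u.2 <= 2^-1)%R then k (u.1, itv_half1 u.2)
                         else l (u.1, itv_half2 u.2)).
have pairc (phi : I -> I) :
    continuous phi -> continuous (fun u : I * I => (u.1, phi u.2)).
  move=> cphi; apply: continuous_pair; first exact: continuous_fst.
  exact: continuous_cmp continuous_snd cphi.
split=> [|t|t|s] /=.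
- apply: (continuous_paste (p := fun u : I * I => itv_val u.2)).
  + exact: continuous_cmp continuous_snd (@itv_val_continuous R).
  + exact: continuous_cmp (pairc _ half1_continuous) ck.
  + exact: continuous_cmp (pairc _ half2_continuous) cl.
  + by move=> [s t] /= /half_mid[-> ->]; rewrite (kxy s).2 (lxy s).1.
- by rewrite concatE /concat_fun k0 l0.
- by rewrite concatE /concat_fun k1 l1.
- split.
    rewrite itv_val0 ifT; last by lra.
    by rewrite /itv_half1 itv_val0 mulr0 (kxy s).1.
  rewrite itv_val1 ifF; last by apply/negbTE; rewrite -ltNge; lra.
  by rewrite /itv_half2 itv_val1 to_itv_ge1 ?(lxy s).2//; lra.
Qed.

Lemma reverse_homotopic x y (f f' : path_in R x y) :
  path_homotopic f f' -> path_homotopic (reverse f) (reverse f').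
Proof.
move=> [k [ck k0 k1 kxy]].
exists (fun u : I * I => k (u.1, to_itv (1 - itv_val u.2)%R)).
split=> [|t|t|s] /=.
- apply: (continuous_cmp (g := k) _ ck); apply: continuous_pair.
    exact: continuous_fst.
  apply: continuous_cmp (@to_itv_continuous R); apply: real_continuousB.
    exact: real_continuous_cst.
  exact: (continuous_cmp continuous_snd (@itv_val_continuous R)).
- by rewrite k0.
- by rewrite k1.
- rewrite itv_val0 subr0 itv_val1 subrr; split; first exact: (kxy s).2.
  exact: (kxy s).1.
Qed.

Let path_extend x y (f : path_in R x y) : continuous (f \o @to_itv R).
Proof. exact: continuous_cmp (@to_itv_continuous R) (@cts_fun _ _ f). Qed.

Let extendE x y (f : path_in R x y) : f =1 (f \o @to_itv R) \o @itv_val R.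
Proof. by move=> t /=; rewrite itv_valK. Qed.

Lemma concat_cst_l x y (f : path_in R x y) :
  path_homotopic (concat (cst x : path_in R x x) f) f.
Proof.
apply: (path_homotopic_reparam (k := f \o @to_itv R)
  (phi0 := fun t => (Num.max 0 (2 * itv_val t - 1))%R) (phi1 := @itv_val R)).
- exact: path_extend.
- apply: real_continuous_max; first exact: real_continuous_cst.
  by apply: real_continuousB; [exact: dbl_continuous | exact: real_continuous_cst].
- exact: itv_val_continuous.
- by rewrite itv_val0 max_l//; lra.
- by rewrite itv_val1 max_r//; lra.
- move=> t; rewrite concatE /concat_fun /=; case: leP => th.
    by rewrite max_l ?to_itv0 ?path_zero//; lra.
  by rewrite max_r//; lra.
- exact: extendE.
Qed.

Lemma concat_cst_r x y (f : path_in R x y) :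
  path_homotopic (concat f (cst y : path_in R y y)) f.
Proof.
apply: (path_homotopic_reparam (k := f \o @to_itv R)
  (phi0 := fun t => (Num.min 1 (2 * itv_val t))%R) (phi1 := @itv_val R)).
- exact: path_extend.
- apply: real_continuous_min; first exact: real_continuous_cst.
  exact: dbl_continuous.
- exact: itv_val_continuous.
- by rewrite itv_val0 min_r//; lra.
- by rewrite itv_val1 min_l//; lra.
- move=> t; rewrite concatE /concat_fun /=; case: leP => th.
    by rewrite min_r//; lra.
  by rewrite min_l ?to_itv1 ?path_one//; lra.
- exact: extendE.
Qed.

Lemma concat_reverse x y (f : path_in R x y) :
  path_homotopic (concat f (reverse f)) (cst x).
Proof.
apply: (path_homotopic_reparam (k := f \o @to_itv R)
  (phi0 := fun t => (Num.min (2 * itv_val t) (2 - 2 * itv_val t))%R)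
  (phi1 := fun=> 0%R)).
- exact: path_extend.
- apply: real_continuous_min; first exact: dbl_continuous.
  by apply: real_continuousB; [exact: real_continuous_cst | exact: dbl_continuous].
- exact: real_continuous_cst.
- by rewrite itv_val0 min_l//; lra.
- by rewrite itv_val1 min_r//; lra.
- move=> t; rewrite concatE /concat_fun /=; have /andP[t0 t1] := itv_valP t.
  case: leP => th; first by rewrite min_l//; lra.
  rewrite min_r; last by lra.
  rewrite /reverse /= /mk_path /reverse_fun /itv_half2 to_itvE; last by lra.
  by congr (f (to_itv _)); ring.
- by move=> t; rewrite /= to_itv0 path_zero.
Qed.

Lemma reverse_reverse x y (f : path_in R x y) : reverse (reverse f) =1 f.
Proof.
move=> t; rewrite /reverse /= /mk_path /reverse_fun /= /mk_path /reverse_fun.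
have /andP[t0 t1] := itv_valP t; rewrite to_itvE; last by lra.
by rewrite -[RHS]/(f t) -[t in RHS]itv_valK; congr (f (to_itv _)); ring.
Qed.

Lemma reverse_concat x y (f : path_in R x y) :
  path_homotopic (concat (reverse f) f) (cst y).
Proof.
have := concat_reverse (reverse f); congr path_homotopic.
by congr concat; apply/path_eqP; exact: reverse_reverse.
Qed.

Lemma concatA x y z w (f : path_in R x y) (g : path_in R y z)
    (h : path_in R z w) :
  path_homotopic (concat f (concat g h)) (concat (concat f g) h).
Proof.
pose k (t : R) : T := if (t <= 1)%R then f (to_itv t) else
  if (t <= 2)%R then g (to_itv (t - 1)%R) else h (to_itv (t - 2)%R).
have subc (a : R) : continuous (fun t : R => t - a : R)%R.
  by apply: real_continuousB => [t|]; [exact: cvg_id | exact: real_continuous_cst].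
have ck : continuous k.
  apply: (continuous_paste (p := id)) => [t||| t /= ->].
  - exact: cvg_id.
  - exact: path_extend.
  - apply: (continuous_paste (p := id)) => [t||| t /= ->].
    + exact: cvg_id.
    + exact: (continuous_cmp (subc 1%R) (@path_extend _ _ g)).
    + exact: (continuous_cmp (subc 2%R) (@path_extend _ _ h)).
    + by rewrite subrr to_itv0 path_zero to_itv_ge1 ?path_one//; lra.
  - by rewrite ifT ?subrr ?to_itv0 ?to_itv1 ?path_zero ?path_one//; lra.
apply: (path_homotopic_reparam (k := k)
  (phi0 := fun t => (Num.max (2 * itv_val t) (2 * (2 * itv_val t) - 1))%R)
  (phi1 := fun t => (Num.min (2 * (2 * itv_val t)) (2 * itv_val t + 1))%R)).
- exact: ck.
- apply: real_continuous_max; first exact: dbl_continuous.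
  apply: real_continuousB; last exact: real_continuous_cst.
  by apply: real_continuousM; [exact: real_continuous_cst | exact: dbl_continuous].
- apply: real_continuous_min.
    by apply: real_continuousM; [exact: real_continuous_cst | exact: dbl_continuous].
  by apply: real_continuousD; [exact: dbl_continuous | exact: real_continuous_cst].
- by rewrite itv_val0 max_l ?min_l//; lra.
- by rewrite itv_val1 max_r ?min_r//; lra.
- move=> t; have /andP[t0 t1] := itv_valP t.
  rewrite concatE /concat_fun /= /k; case: leP => th.
    by rewrite max_l ?ifT//; lra.
  rewrite max_r; last by lra.
  rewrite ifF; last by apply/negbTE; rewrite -ltNge; lra.
  rewrite concatE /concat_fun {1}/itv_half2 to_itvE; last by lra.
  case: leP => th'.
    rewrite ifT; last by lra.
    by rewrite /itv_half1 /itv_half2 to_itvE; [congr (g (to_itv _)); ring | lra].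
  rewrite ifF; last by apply/negbTE; rewrite -ltNge; lra.
  by rewrite /itv_half2 to_itvE; [congr (h (to_itv _)); ring | lra].
- move=> t; have /andP[t0 t1] := itv_valP t.
  rewrite concatE /concat_fun /= /k; case: leP => th.
    rewrite min_l; last by lra.
    rewrite concatE /concat_fun {1}/itv_half1 to_itvE; last by lra.
    case: leP => th'.
      rewrite ifT; last by lra.
      by rewrite /itv_half1 to_itvE; [congr (f (to_itv _)); ring | lra].
    rewrite ifF; last by apply/negbTE; rewrite -ltNge; lra.
    rewrite ifT; last by lra.
    by rewrite /itv_half1 /itv_half2 to_itvE; [congr (g (to_itv _)); ring | lra].
  rewrite min_r; last by lra.
  rewrite ifF; last by apply/negbTE; rewrite -ltNge; lra.
  rewrite ifF; last by apply/negbTE; rewrite -ltNge; lra.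
  by rewrite /itv_half2; congr (h (to_itv _)); ring.
Qed.

Section FundamentalGroup.
Variable b : T.

Definition loop_rel : rel (loop R b) := fun f g => `[< path_homotopic f g >].

Let loop_rel_refl : reflexive loop_rel.
Proof. by move=> f; apply/asboolP; exact: path_homotopic_refl. Qed.
Let loop_rel_sym : symmetric loop_rel.
Proof. by move=> f g; apply/asboolP/asboolP; exact: path_homotopic_sym. Qed.
Let loop_rel_trans : transitive loop_rel.
Proof.
move=> g f h /asboolP fg /asboolP gh; apply/asboolP.
exact: path_homotopic_trans gh.
Qed.

Canonical loop_equiv :=
  EquivRel loop_rel loop_rel_refl loop_rel_sym loop_rel_trans.

Definition pi1 := {eq_quot loop_equiv}.
HB.instance Definition _ := Choice.on pi1.
HB.instance Definition _ := EqQuotient.on pi1.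

Definition loop_class (f : loop R b) : pi1 := \pi_{eq_quot loop_equiv} f.

Lemma loop_classP f g : loop_class f = loop_class g <-> path_homotopic f g.
Proof.
split=> [/(@eqmodP _ loop_equiv)/asboolP//|fg].
by apply/(@eqmodP _ loop_equiv)/asboolP.
Qed.

Lemma loop_reprK (a : pi1) : loop_class (repr a) = a.
Proof. exact: (@reprK _ {eq_quot loop_equiv}). Qed.

Lemma repr_loop_class f : path_homotopic (repr (loop_class f)) f.
Proof. by apply/loop_classP; exact: loop_reprK. Qed.

Let one1 := loop_class (cst b).
Let mul1 (u v : pi1) := loop_class (concat (repr u) (repr v)).
Let inv1 (u : pi1) := loop_class (reverse (repr u)).

Let mul1E f g : mul1 (loop_class f) (loop_class g) = loop_class (concat f g).
Proof. by apply/loop_classP/concat_homotopic; exact: repr_loop_class. Qed.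

Let inv1E f : inv1 (loop_class f) = loop_class (reverse f).
Proof. by apply/loop_classP/reverse_homotopic; exact: repr_loop_class. Qed.

Lemma pi1P (u : pi1) : exists f, u = loop_class f.
Proof. by exists (repr u); rewrite loop_reprK. Qed.

Let mul1A : associative mul1.
Proof.
move=> u v w; have [[[f ->] [g ->]] [h ->]] := (pi1P u, pi1P v, pi1P w).
by rewrite !mul1E; apply/loop_classP; exact: concatA.
Qed.
Let mul11 : left_id one1 mul1.
Proof.
move=> u; have [f ->] := pi1P u.
by rewrite mul1E; apply/loop_classP; exact: concat_cst_l.
Qed.
Let mul1_1 : right_id one1 mul1.
Proof.
move=> u; have [f ->] := pi1P u.
by rewrite mul1E; apply/loop_classP; exact: concat_cst_r.
Qed.
Let mulV1 : left_inverse one1 inv1 mul1.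
Proof.
move=> u; have [f ->] := pi1P u.
by rewrite inv1E mul1E; apply/loop_classP; exact: reverse_concat.
Qed.
Let mul1V : right_inverse one1 inv1 mul1.
Proof.
move=> u; have [f ->] := pi1P u.
by rewrite inv1E mul1E; apply/loop_classP; exact: concat_reverse.
Qed.

HB.instance Definition _ := isGroup.Build pi1 mul1A mul11 mul1_1 mulV1 mul1V.

Lemma loop_class_concat f g :
  loop_class (concat f g) = loop_class f * loop_class g.
Proof. by rewrite -mul1E. Qed.

Lemma loop_class_cst : loop_class (cst b) = 1.
Proof. by []. Qed.

End FundamentalGroup.

End Homotopy.

Arguments path_homotopic {R T x y} f g.
Arguments loop_class {R T b} f.

HB.mixin Record isTopologicalGroup G of Group G & Topological G := {
  mulg_continuous : continuous (fun p : G * G => p.1 * p.2);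
  invg_continuous : continuous (fun g : G => g^-1)
}.

#[short(type="topologicalGroupType")]
HB.structure Definition TopologicalGroup :=
  {G of isTopologicalGroup G & Group G & Topological G}.

(* [f] is C^oo on the open set [A]: all its iterated directional derivatives
   are (Frechet) differentiable at every point of [A]. *)
Definition smooth_on (R : realType) (V W : normedModType R) (A : set V)
    (f : V -> W) :=
  forall (vs : seq V) x, A x ->
    differentiable (foldr (fun v (g : V -> W) => 'D_v g) f vs) x.

Record chart (R : realType) (T : topologicalType) (n : nat) := Chart {
  chart_dom : set T;
  chart_fun :> T -> 'rV[R]_n;
  chart_inv : 'rV[R]_n -> T;
  chart_dom_open : open chart_dom;
  chart_codom_open : open (chart_fun @` chart_dom);
  chartK : {in chart_dom, cancel chart_fun chart_inv};
  chart_continuous : {within chart_dom, continuous chart_fun};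
  chart_inv_continuous :
    {within chart_fun @` chart_dom, continuous chart_inv}
}.

(* A smooth structure is given by an atlas, which need not be maximal; second
   countability is not part of the definition. *)
HB.mixin Record isLieGroup (R : realType) G of TopologicalGroup G := {
  lie_hausdorff : hausdorff_space G;
  lie_dim : nat;
  lie_atlas : set (chart R G lie_dim);
  lie_atlas_cover : forall g : G, exists2 c, lie_atlas c & chart_dom c g;
  lie_atlas_smooth : forall c d, lie_atlas c -> lie_atlas d ->
    smooth_on (c @` (chart_dom c `&` chart_dom d)) (d \o chart_inv c);
  lie_mul_smooth : forall c d e, lie_atlas c -> lie_atlas d -> lie_atlas e ->
    smooth_on
      [set u : 'rV[R]_lie_dim * 'rV[R]_lie_dim |
        [/\ (c @` chart_dom c) u.1, (d @` chart_dom d) u.2 &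
            chart_dom e (chart_inv c u.1 * chart_inv d u.2)]]
      (fun u => e (chart_inv c u.1 * chart_inv d u.2));
  lie_inv_smooth : forall c d, lie_atlas c -> lie_atlas d ->
    smooth_on
      [set u | (c @` chart_dom c) u /\ chart_dom d (chart_inv c u)^-1]
      (fun u => d (chart_inv c u)^-1)
}.

#[short(type="lieGroupType")]
HB.structure Definition LieGroup (R : realType) :=
  {G of isLieGroup R G & TopologicalGroup G}.

Section Components.
Context {T : topologicalType} (A : set T).

Definition pi0 := set_type (connected_component A @` A).
HB.instance Definition _ := Choice.on pi0.

Definition pi0_set (c : pi0) : set T := sval c.

Lemma pi0_set_inj : injective pi0_set.
Proof. by move=> c d /val_inj. Qed.

Lemma pi0_class_subproof p : A p ->
  connected_component A p \in connected_component A @` A.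
Proof. by move=> Ap; rewrite inE; exists p. Qed.

Definition pi0_class p (Ap : A p) : pi0 :=
  @exist _ (fun C => C \in connected_component A @` A) _ (pi0_class_subproof Ap).

Definition pi0_repr (c : pi0) : T := projT1 (cid2 (set_mem (svalP c))).

Lemma pi0_reprP c : A (pi0_repr c).
Proof. by rewrite /pi0_repr; case: cid2. Qed.

Lemma pi0_reprE c : connected_component A (pi0_repr c) = pi0_set c.
Proof. by rewrite /pi0_repr; case: cid2. Qed.

Lemma pi0_repr_mem c : pi0_set c (pi0_repr c).
Proof. by rewrite -pi0_reprE; apply/connected_component_refl/pi0_reprP. Qed.

Lemma pi0_memP c p : pi0_set c p -> A p /\ connected_component A p = pi0_set c.
Proof.
rewrite -pi0_reprE => pc; split; first exact: connected_component_sub pc.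
by rewrite (same_connected_component pc).
Qed.

End Components.

Arguments pi0 {T} A.

Lemma mul_continuous_fun (G : topologicalGroupType) (S : topologicalType) (f g : S -> G) :
  continuous f -> continuous g -> continuous (fun s => f s * g s).
Proof.
move=> cf cg.
exact: continuous_cmp (continuous_pair cf cg) (@mulg_continuous G).
Qed.

Section Pi0Group.
Variable G : topologicalGroupType.
Implicit Types g h : G.

Definition pi0G := pi0 [set: G].
HB.instance Definition _ := Choice.on pi0G.

Definition pi0G_class g : pi0G := @pi0_class _ [set: G] g I.

Lemma pi0G_classP g h :
  pi0G_class g = pi0G_class h <-> connected_component [set: G] g h.
Proof.
split=> [/(congr1 (@pi0_set _ _)) /= ->|gh]; first exact: connected_component_refl.
by apply/pi0_set_inj; exact: same_connected_component.
Qed.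

Lemma pi0G_repr_class g : connected_component [set: G] g (pi0_repr (pi0G_class g)).
Proof. by apply/pi0G_classP/pi0_set_inj; rewrite /= pi0_reprE. Qed.

Lemma pi0G_reprK (c : pi0G) : pi0G_class (pi0_repr c) = c.
Proof. by apply/pi0_set_inj; rewrite /= pi0_reprE. Qed.

Lemma image_component (T : topologicalType) (f : T -> G) (A : set T) p q :
  continuous f -> connected_component A p q ->
  connected_component [set: G] (f p) (f q).
Proof.
move=> cf [B [Bp _ cB Bq]]; exists (f @` B); last by exists q.
split=> //.
by apply: connected_continuous_connected => //; exact: continuous_subspaceT.
Qed.

Lemma mulg_component g g' h h' :
  connected_component [set: G] g g' -> connected_component [set: G] h h' ->
  connected_component [set: G] (g * h) (g' * h').
Proof.
move=> gg' hh'; have idc : continuous (@id G) by move=> x; exact: cvg_id.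
apply: (@connected_component_trans _ _ (g' * h)).
  apply: (image_component (f := fun x => x * h) _ gg').
  exact: (mul_continuous_fun idc (@cst_continuous G G h)).
apply: (image_component (f := fun x => g' * x) _ hh').
exact: (mul_continuous_fun (@cst_continuous G G g') idc).
Qed.

Let one0 := pi0G_class 1.
Let mul0 (c d : pi0G) := pi0G_class (pi0_repr c * pi0_repr d).
Let inv0 (c : pi0G) := pi0G_class (pi0_repr c)^-1.

Let mul0E g h : mul0 (pi0G_class g) (pi0G_class h) = pi0G_class (g * h).
Proof.
by apply/esym/pi0G_classP/mulg_component; exact: pi0G_repr_class.
Qed.

Let inv0E g : inv0 (pi0G_class g) = pi0G_class g^-1.
Proof.
apply/esym/pi0G_classP; apply: (image_component (f := fun x => x^-1)).
  exact: invg_continuous.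
exact: pi0G_repr_class.
Qed.

Let pi0GP (c : pi0G) : exists g, c = pi0G_class g.
Proof. by exists (pi0_repr c); rewrite pi0G_reprK. Qed.

Let mul0A : associative mul0.
Proof.
move=> a b c; have [[[x ->] [y ->]] [z ->]] := (pi0GP a, pi0GP b, pi0GP c).
by rewrite !mul0E mulgA.
Qed.
Let mul01 : left_id one0 mul0.
Proof. by move=> a; have [x ->] := pi0GP a; rewrite mul0E mul1g. Qed.
Let mul10 : right_id one0 mul0.
Proof. by move=> a; have [x ->] := pi0GP a; rewrite mul0E mulg1. Qed.
Let mulV0 : left_inverse one0 inv0 mul0.
Proof. by move=> a; have [x ->] := pi0GP a; rewrite inv0E mul0E mulVg. Qed.
Let mul0V : right_inverse one0 inv0 mul0.
Proof. by move=> a; have [x ->] := pi0GP a; rewrite inv0E mul0E mulgV. Qed.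

HB.instance Definition _ := isGroup.Build pi0G mul0A mul01 mul10 mulV0 mul0V.

Lemma pi0G_classM g h : pi0G_class (g * h) = pi0G_class g * pi0G_class h.
Proof. by rewrite -mul0E. Qed.

Lemma pi0G_class1 : pi0G_class 1 = 1.
Proof. by []. Qed.

End Pi0Group.

Section Pi1Group.
Variables (R : realType) (G : topologicalGroupType).
Local Notation loop1 := (loop R (1 : G)).

Section Conjugation.
Variable g : G.

Let conj_fun (x : G) := g * x * g^-1.

Let conj_continuous : continuous conj_fun.
Proof.
apply: mul_continuous_fun; last exact: cst_continuous.
by apply: mul_continuous_fun; [exact: cst_continuous | move=> x; exact: cvg_id].
Qed.

Section Loop.
Variable f : loop1.

Let conj_loop_continuous : continuous (conj_fun \o f).
Proof. exact: continuous_cmp (@cts_fun _ _ f) conj_continuous. Qed.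

Let conj_loop_zero : (conj_fun \o f) zero = 1.
Proof. by rewrite /conj_fun /= path_zero mulg1 mulgV. Qed.

Let conj_loop_one : (conj_fun \o f) one = 1.
Proof. by rewrite /conj_fun /= path_one mulg1 mulgV. Qed.

Definition conj_loop : loop1 :=
  mk_path conj_loop_continuous conj_loop_zero conj_loop_one.

End Loop.

Lemma conj_loop_homotopic f f' :
  path_homotopic f f' -> path_homotopic (conj_loop f) (conj_loop f').
Proof.
move=> [k [ck k0 k1 kxy]]; exists (conj_fun \o k); split=> [|t|t|s] /=.
- exact: continuous_cmp ck conj_continuous.
- by rewrite k0.
- by rewrite k1.
- by rewrite /conj_fun (kxy s).1 (kxy s).2 mulg1 mulgV.
Qed.

Definition conj_pi1 (u : pi1 R (1 : G)) : pi1 R (1 : G) :=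
  loop_class (conj_loop (repr u)).

Lemma conj_pi1E f : conj_pi1 (loop_class f) = loop_class (conj_loop f).
Proof. by apply/loop_classP/conj_loop_homotopic/repr_loop_class. Qed.

End Conjugation.

Lemma pi1G_mulgC (u v : pi1 R (1 : G)) : u * v = v * u.
Proof.
have [[f ->] [g ->]] := (pi1P u, pi1P v); rewrite -!loop_class_concat.
apply/loop_classP.
pose I := unit_itv R.
pose a (s t : I) : I := to_itv ((1 - itv_val s) * Num.min 1 (2 * itv_val t)
   + itv_val s * Num.max 0 (2 * itv_val t - 1))%R.
pose b (s t : I) : I := to_itv ((1 - itv_val s) * Num.max 0 (2 * itv_val t - 1)
   + itv_val s * Num.min 1 (2 * itv_val t))%R.
have cs : continuous (fun u : I * I => itv_val u.1 : R).
  exact: continuous_cmp continuous_fst (@itv_val_continuous R).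
have ct : continuous (fun u : I * I => 2 * itv_val u.2 : R)%R.
  apply: real_continuousM; first exact: real_continuous_cst.
  exact: continuous_cmp continuous_snd (@itv_val_continuous R).
have cmin : continuous (fun u : I * I => Num.min 1 (2 * itv_val u.2) : R)%R.
  by apply: real_continuous_min => //; exact: real_continuous_cst.
have cmax : continuous (fun u : I * I => Num.max 0 (2 * itv_val u.2 - 1) : R)%R.
  apply: real_continuous_max; first exact: real_continuous_cst.
  by apply: real_continuousB => //; exact: real_continuous_cst.
have c1s : continuous (fun u : I * I => 1 - itv_val u.1 : R)%R.
  by apply: real_continuousB => //; exact: real_continuous_cst.
exists (fun u => f (a u.1 u.2) * g (b u.1 u.2)); split.
- apply: mul_continuous_fun.
    apply: continuous_cmp (@cts_fun _ _ f); apply: continuous_cmp (@to_itv_continuous R).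
    by apply: real_continuousD; exact: real_continuousM.
  apply: continuous_cmp (@cts_fun _ _ g); apply: continuous_cmp (@to_itv_continuous R).
  by apply: real_continuousD; exact: real_continuousM.
- move=> t; have /andP[t0 t1] := itv_valP t.
  rewrite /= /a /b itv_val0 subr0 !mul1r !mul0r !addr0 concatE /concat_fun.
  case: leP => th.
    rewrite min_r; last by lra.
    by rewrite max_l ?to_itv0 ?path_zero ?mulg1//; lra.
  rewrite min_l; last by lra.
  by rewrite max_r ?to_itv1 ?path_one ?mul1g//; lra.
- move=> t; have /andP[t0 t1] := itv_valP t.
  rewrite /= /a /b itv_val1 subrr !mul1r !mul0r !add0r concatE /concat_fun.
  case: leP => th.
    rewrite min_r; last by lra.
    by rewrite max_l ?to_itv0 ?path_zero ?mul1g//; lra.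
  rewrite min_l; last by lra.
  by rewrite max_r ?to_itv1 ?path_one ?mulg1//; lra.
- move=> s; rewrite /= /a /b itv_val0 itv_val1 !mulr0 !mulr1.
  rewrite min_r; last by lra.
  rewrite max_l; last by lra.
  rewrite min_l; last by lra.
  rewrite max_r; last by lra.
  rewrite !mulr0 addr0 to_itv0 !path_zero mulg1; split=> //.
  have -> : (2 - 1)%R = 1%R :> R by ring.
  by rewrite !mulr1 subrK to_itv1 !path_one mulg1.
Qed.

(* As [pi_1(G)] is abelian ([pi1G_mulgC]), a submodule is a subgroup stable under
   the action of [pi_0(G)]; a component acts by conjugation by any of its
   elements. *)
Record pi0_submodule := Pi0Submodule {
  pi0_submodule_pred :> {pred pi1 R (1 : G)};
  pi0_submodule_group : group_closed pi0_submodule_pred;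
  pi0_submodule_stable : forall g u,
    u \in pi0_submodule_pred -> conj_pi1 g u \in pi0_submodule_pred
}.

Section Submodule.
Variable theta : pi0_submodule.

Let thetaM : mulg_closed theta.
Proof. exact: (group_closedM (pi0_submodule_group theta)). Qed.
Let thetaV : invg_closed theta.
Proof. exact: (group_closedV (pi0_submodule_group theta)). Qed.
Let theta1 : 1 \in (theta : {pred _}).
Proof. exact: (pi0_submodule_group theta).1. Qed.
Let thetaJ x y : x \in (theta : {pred _}) -> x ^ y \in (theta : {pred _}).
Proof. by move=> ?; rewrite /conjg (pi1G_mulgC x) mulKg. Qed.

HB.instance Definition _ := isMulClosed.Build _ (pi0_submodule_pred theta) thetaM.
HB.instance Definition _ := isMul1Closed.Build _ (pi0_submodule_pred theta) theta1.
HB.instance Definition _ := isInvClosed.Build _ (pi0_submodule_pred theta) thetaV.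
HB.instance Definition _ := isNormalClosed.Build _ (pi0_submodule_pred theta) thetaJ.

End Submodule.

End Pi1Group.

Record continuous_action (G : topologicalGroupType) (X : topologicalType) :=
  ContinuousAction {
    action_fun :> G -> X -> X;
    action1 : forall p, action_fun 1 p = p;
    actionM : forall g h p, action_fun (g * h) p = action_fun g (action_fun h p);
    action_continuous : continuous (fun u : G * X => action_fun u.1 u.2)
  }.

Definition faithful_action (G : topologicalGroupType) (X : topologicalType)
    (a : continuous_action G X) :=
  forall g, (forall p, a g p = p) -> g = 1.

Section OrbitSpace.
Variables (G : topologicalGroupType) (X : topologicalType).
Variable a : continuous_action G X.

Definition orbit_rel : rel X := fun p q => `[< exists g, a g p = q >].

Let orbit_refl : reflexive orbit_rel.
Proof. by move=> p; apply/asboolP; exists 1; exact: action1. Qed.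

Let orbit_symP p q : orbit_rel p q -> orbit_rel q p.
Proof.
move=> /asboolP[g <-]; apply/asboolP; exists g^-1.
by rewrite -actionM mulVg action1.
Qed.

Let orbit_sym : symmetric orbit_rel.
Proof. by move=> p q; apply/idP/idP; exact: orbit_symP. Qed.

Let orbit_trans : transitive orbit_rel.
Proof.
move=> q p r /asboolP[g <-] /asboolP[h <-]; apply/asboolP.
by exists (h * g); rewrite actionM.
Qed.

Canonical orbit_equiv := EquivRel orbit_rel orbit_refl orbit_sym orbit_trans.

Definition orbit_space : topologicalType :=
  quotient_topology {eq_quot orbit_equiv}.

Definition orbit_proj (p : X) : orbit_space := \pi_{eq_quot orbit_equiv} p.

Definition orbit_map (x : orbit_space -> X) (y : G * orbit_space) : X :=
  a y.1 (x y.2).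

Definition isotropy (x : orbit_space -> X) : set (G * orbit_space) :=
  [set y | orbit_map x y = x y.2].

End OrbitSpace.

Definition quotient_map (S T : topologicalType) (f : S -> T) :=
  (forall t, exists s, f s = t) /\ forall U, open U <-> open (f @^-1` U).

(* Strong deformation retraction: [A] is fixed at all times. *)
Definition deformation_retraction (R : realType) (T : topologicalType)
    (A : set T) (h : unit_itv R * T -> T) :=
  [/\ continuous h,
      forall y, h (zero, y) = y,
      forall y, A (h (one, y)) &
      forall t y, A y -> h (t, y) = y].

Section Polar.
Variables (R : realType) (G : lieGroupType R) (X : topologicalType).
Variable a : continuous_action G X.
Local Notation Q := (orbit_space a).

Definition polar_section (x : Q -> X) :=
  [/\ continuous x, cancel x (@orbit_proj G X a) & quotient_map (orbit_map x)].

Record polar_space : Prop := PolarSpace {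
  polar_hausdorff : hausdorff_space X;
  polar_connected : connected [set: X];
  polar_locally_path_connected : locally_path_connected R X;
  polar_semilocally_simply_connected : semilocally_simply_connected R X;
  polar_faithful : faithful_action a;
  polar_simply_connected : simply_connected R Q;
  polar_has_section : exists x, polar_section x
}.

Definition regular_section (x : Q -> X) :=
  polar_section x /\
  forall q, exists U : set X, [/\ open U, U (x q) &
    exists h : unit_itv R * set_type (orbit_map x @^-1` U) ->
               set_type (orbit_map x @^-1` U),
      [/\ deformation_retraction
            [set y | isotropy x (set_val y) /\ (set_val y).2 = q] h,
          forall t y, isotropy x (set_val y) -> isotropy x (set_val (h (t, y))) &
          forall y z, (set_val y).2 = (set_val z).2 ->
            forall t, (set_val (h (t, y))).2 = (set_val (h (t, z))).2]].

End Polar.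

Section IsotropyComponents.
Variables (R : realType) (G : lieGroupType R) (X : topologicalType).
Variables (a : continuous_action G X) (x : orbit_space a -> X).
Local Notation H := (isotropy x).

(* [pi0_mul c1 c2 c3] is [c3 \in c1 . c2]: the component [c3] meets the image of
   the fibre product of [c1] and [c2] under the fibrewise multiplication. *)
Definition pi0_mul (c1 c2 c3 : pi0 H) :=
  exists g h q, [/\ pi0_set c1 (g, q), pi0_set c2 (h, q) &
                    pi0_set c3 (g * h, q)].

Definition pi0_relators : set (word (pi0 H)) :=
  [set w | exists c1 c2 c3, pi0_mul c1 c2 c3 /\
    w = [:: (c1, false); (c2, false); (c3, true)]].

Definition pi0_hat := presented_group pi0_relators.
HB.instance Definition _ := Group.on pi0_hat.

Definition pi0_proj (c : pi0 H) : pi0G G := pi0G_class (pi0_repr c).1.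

Lemma pi0_projE c y : pi0_set c y -> pi0_proj c = pi0G_class y.1.
Proof.
rewrite -pi0_reprE => cy; apply/pi0G_classP.
by apply: (image_component (f := fst)) cy; exact: continuous_fst.
Qed.

Definition pi0_hat_proj : pi0_hat -> pi0G G := presented_lift pi0_proj.

Let pi0_hat_proj_morphism : monoid.monoid_morphism pi0_hat_proj.
Proof.
apply: presented_lift_morphism => _ [c1 [c2 [c3 [[g [h [q [c1g c2h c3gh]]]] ->]]]].
rewrite /word_eval !big_cons big_nil /= mulg1.
by rewrite (pi0_projE c1g) (pi0_projE c2h) (pi0_projE c3gh) pi0G_classM mulgA mulgV.
Qed.

HB.instance Definition _ :=
  isUMagmaMorphism.Build pi0_hat (pi0G G) pi0_hat_proj pi0_hat_proj_morphism.

End IsotropyComponents.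

Arguments pi0_hat_proj {R G X a} x _.

(* Main.v *)
Require Import Defs.
From HB Require Import structures.
From mathcomp Require Import all_boot all_order all_algebra.
From mathcomp Require Import all_classical all_reals all_analysis.
From mathcomp Require Import homotopy lra.
Set Implicit Arguments.
Unset Strict Implicit.
Unset Printing Implicit Defensive.
Import Order.TTheory GRing.Theory Num.Theory.
Import numFieldNormedType.Exports.
Local Open Scope classical_set_scope.
Local Open Scope quotient_scope.
Local Open Scope group_scope.

(** Let [phi : G * Q -> X] be the orbit map of the section [x], and let
    [(gb, qb)] be a point over the base point [b].  The proof compares
    [pi0_hat x] with a group [rhodes] built from paths.

    An element of [rhodes] is a pair of [g : G] and a path from [b] to [g b],
    with product [(g, f) (h, k) = (g h, f . g k)] as in the fundamental group of
    a transformation group of Rhodes, taken up to homotopy and up to moving [g]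
    along a path [u] of [G] while appending the path [u_t b].  Loops at [b] give
    a morphism from [pi_1(X, b)] to [rhodes] whose kernel is the image of
    [pi_1(G)] under [u |-> u_t b] ([rhodes_loop_eq1]).  Its image is the kernel
    of [(g, f) |-> [g]] into [pi_0(G)] ([rhodes_class_loop]), because an element
    of the component of [1] is joined to [1] by a path.  The image of [pi_1(G)] is
    central because [u_s f_t] is a torus ([orbit_pi1_central]), and the kernel
    [theta] of [pi_1(G) -> pi_1(X, b)] is stable under [pi_0(G)] because the base
    point of the orbit can be slid along a path of [X] ([orbit_pi1_conj]).  So
    everything follows once [rhodes] is isomorphic to [pi0_hat x] over
    [pi_0(G)], up to the conjugation by [gb] that carries the base point
    [x qb] to [b].

    In one direction, an element [(h, q)] of the isotropy gives the path that
    goes from [b] to [gb x(q)] in the slice [{gb} * Q] and then, from the same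
    point seen as [gb h x(q)], to [gb h gb^-1 b] in the slice [{gb h} * Q]
    ([component_class]).  As [Q] is simply connected, its class does not depend on
    the paths chosen in the slices.  This is multiplicative in each fibre and
    constant on the components of the isotropy, by regularity of the section and
    semi-local simple connectedness of [X] ([component_class_near]), so it defines
    a morphism [rhodes_of_pi0] on the presented group.  It is surjective because,
    locally in [X], every path is homotopic to a composite of images under [phi]
    of paths of [G * Q], the jumps between these being given by the isotropy
    ([reached_all]); here the point is that [phi] is a quotient map and that
    [G * Q] is locally path-connected.

    In the other direction, gluing [G * Q * pi0_hat x] along the isotropy gives
    a principal covering of [X] with group [pi0_hat x]; its local triviality is
    what regularity is for ([trivialises_section]).  Lifting paths to this
    covering defines [pi0_of_rhodes].  The lift of [phi \o c] is constant along
    the path [c] of [G * Q], and picks up the class of [(h, q)] when the point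
    [(g, q)] is replaced by [(g h, q)]; hence [pi0_of_rhodes] is a left inverse
    of [rhodes_of_pi0] ([rhodes_of_pi0K]), and the latter is an isomorphism. *)

(** * Paths *)

Section PathAlgebra.
Variable R : realType.
Local Notation I := (unit_itv R).

(** The end points of a path belong to its type; this changes them along
    equations while keeping the underlying function convertible. *)
Definition recast (T : topologicalType) (x y x' y' : T) (f : path_in R x y)
    (ex : x = x') (ey : y = y') : path_in R x' y' :=
  mk_path (@cts_fun _ _ f) (etrans (path_zero (s := f)) ex)
    (etrans (path_one (s := f)) ey).

Lemma path_homotopic_ext (T : topologicalType) (x y : T) (f g : path_in R x y) :
  f =1 g -> path_homotopic f g.
Proof. by move=> /path_eqP ->; exact: path_homotopic_refl. Qed.

Section Map.
Variables (S T : topologicalType) (F : S -> T) (cF : continuous F).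

Let push_path_zero x y (c : path_in R x y) : (F \o c) zero = F x.
Proof. by rewrite /= path_zero. Qed.

Let push_path_one x y (c : path_in R x y) : (F \o c) one = F y.
Proof. by rewrite /= path_one. Qed.

Definition push_path x y (c : path_in R x y) : path_in R (F x) (F y) :=
  mk_path (continuous_cmp (@cts_fun _ _ c) cF)
    (push_path_zero c) (push_path_one c).

Lemma push_path_homotopic x y (f g : path_in R x y) :
  path_homotopic f g -> path_homotopic (push_path f) (push_path g).
Proof.
move=> [k [ck k0 k1 kxy]]; exists (F \o k); split=> [|t|t|s] /=.
- exact: continuous_cmp ck cF.
- by rewrite k0.
- by rewrite k1.
- by rewrite (kxy s).1 (kxy s).2.
Qed.

Lemma push_path_concat x y z (f : path_in R x y) (g : path_in R y z) :
  push_path (concat f g) =1 concat (push_path f) (push_path g).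
Proof.
by move=> t; rewrite /= /mk_path /= /concat_fun; case: ifP.
Qed.

End Map.

(** The unit square is convex, so the diagonal is homotopic to the bottom edge
    followed by the right edge; this carries over to any map out of it. *)
Lemma diagonal_homotopic (T : topologicalType) (k : I * I -> T) (x y z : T)
    (f : path_in R x y) (g : path_in R y z) (d : path_in R x z) :
  continuous k -> (forall t, f t = k (t, zero)) -> (forall t, g t = k (one, t)) ->
  (forall t, d t = k (t, t)) -> path_homotopic d (concat f g).
Proof.
move=> ck fk gk dk.
pose a (u : I * I) : R :=
  ((1 - itv_val u.1) * itv_val u.2 + itv_val u.1 * Num.min 1 (2 * itv_val u.2))%R.
pose c (u : I * I) : R :=
  ((1 - itv_val u.1) * itv_val u.2
   + itv_val u.1 * Num.max 0 (2 * itv_val u.2 - 1))%R.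
have cs : continuous (fun u : I * I => itv_val u.1 : R).
  exact: continuous_cmp continuous_fst (@itv_val_continuous R).
have ct : continuous (fun u : I * I => itv_val u.2 : R).
  exact: continuous_cmp continuous_snd (@itv_val_continuous R).
have c2t : continuous (fun u : I * I => 2 * itv_val u.2 : R)%R.
  by apply: real_continuousM => //; exact: real_continuous_cst.
have c1s : continuous (fun u : I * I => (1 - itv_val u.1) * itv_val u.2 : R)%R.
  apply: real_continuousM => //; apply: real_continuousB => //.
  exact: real_continuous_cst.
have ca : continuous a.
  apply: real_continuousD => //; apply: real_continuousM => //.
  by apply: real_continuous_min => //; exact: real_continuous_cst.
have cc : continuous c.
  apply: real_continuousD => //; apply: real_continuousM => //.
  apply: real_continuous_max; first exact: real_continuous_cst.
  by apply: real_continuousB => //; exact: real_continuous_cst.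
exists (fun u => k (to_itv (a u), to_itv (c u))); split.
- apply: (continuous_cmp (g := k) _ ck); apply: continuous_pair.
    exact: continuous_cmp ca (@to_itv_continuous R).
  exact: continuous_cmp cc (@to_itv_continuous R).
- move=> t; rewrite dk /a /c /= itv_val0 subr0 !mul1r !mul0r !addr0.
  by rewrite itv_valK.
- move=> t; have /andP[t0 t1] := itv_valP t.
  rewrite /a /c /= itv_val1 subrr !mul1r !mul0r !add0r concatE /concat_fun.
  case: leP => th.
    rewrite min_r; last by lra.
    by rewrite max_l ?to_itv0 ?fk//; lra.
  rewrite min_l; last by lra.
  by rewrite max_r ?to_itv1 ?gk//; lra.
- move=> s; rewrite /a /c /= itv_val0 itv_val1 !mulr0 !mulr1.
  rewrite min_r; last by lra.
  rewrite max_l; last by lra.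
  rewrite min_l; last by lra.
  rewrite max_r; last by lra.
  rewrite !mulr0 addr0 to_itv0; split.
    by rewrite -[RHS](path_zero (s := d)) dk.
  rewrite -[RHS](path_one (s := d)) dk -to_itv1.
  by congr (k (to_itv _, to_itv _)); lra.
Qed.

Section Subpath.
Variables (T : topologicalType) (x y : T).

Let subpath_continuous (f : path_in R x y) (s t : R) :
  continuous (fun r : I => f (to_itv (s + itv_val r * (t - s))%R)).
Proof.
apply: (continuous_cmp _ (@cts_fun _ _ f)).
apply: (continuous_cmp _ (@to_itv_continuous R)).
apply: real_continuousD; first exact: real_continuous_cst.
apply: real_continuousM; first exact: itv_val_continuous.
exact: real_continuous_cst.
Qed.

Let subpath0 (f : path_in R x y) (s t : R) :
  f (to_itv (s + itv_val (zero : I) * (t - s))%R) = f (to_itv s).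
Proof. by rewrite itv_val0 mul0r addr0. Qed.

Let subpath1 (f : path_in R x y) (s t : R) :
  f (to_itv (s + itv_val (one : I) * (t - s))%R) = f (to_itv t).
Proof. by rewrite itv_val1 mul1r addrC subrK. Qed.

Definition subpath (f : path_in R x y) (s t : R) :
    path_in R (f (to_itv s)) (f (to_itv t)) :=
  mk_path (@subpath_continuous f s t) (subpath0 f s t) (subpath1 f s t).

(** Both sides are [f] composed with functions into the interval that have the
    same end points, hence are homotopic. *)
Lemma subpath_concat (f : path_in R x y) (r s t : R) :
  path_homotopic (concat (subpath f r s) (subpath f s t)) (subpath f r t).
Proof.
pose m1 (u : I) : R := (Num.min 1 (2 * itv_val u))%R.
pose m2 (u : I) : R := (Num.max 0 (2 * itv_val u - 1))%R.
have c2 : continuous (fun u : I => 2 * itv_val u : R)%R.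
  by apply: real_continuousM; [exact: real_continuous_cst | exact: itv_val_continuous].
apply: (path_homotopic_reparam (k := f \o @to_itv R)
  (phi0 := fun u => (r + m1 u * (s - r) + m2 u * (t - s))%R)
  (phi1 := fun u => (r + itv_val u * (t - r))%R)).
- exact: continuous_cmp (@to_itv_continuous R) (@cts_fun _ _ f).
- apply: real_continuousD.
    apply: real_continuousD; first exact: real_continuous_cst.
    apply: real_continuousM; last exact: real_continuous_cst.
    by apply: real_continuous_min => //; exact: real_continuous_cst.
  apply: real_continuousM; last exact: real_continuous_cst.
  apply: real_continuous_max; first exact: real_continuous_cst.
  by apply: real_continuousB => //; exact: real_continuous_cst.
- apply: real_continuousD; first exact: real_continuous_cst.
  by apply: real_continuousM; [exact: itv_val_continuous | exact: real_continuous_cst].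
- rewrite /m1 /m2 itv_val0 min_r; last by lra.
  by rewrite max_l; lra.
- rewrite /m1 /m2 itv_val1 min_l; last by lra.
  by rewrite max_r; lra.
- move=> u; have /andP[u0 u1] := itv_valP u.
  rewrite concatE /concat_fun /= /m1 /m2; case: leP => uh.
    rewrite min_r; last by lra.
    rewrite max_l; last by lra.
    rewrite /= /mk_path /itv_half1 to_itvE; last by lra.
    by rewrite mul0r addr0.
  rewrite min_l; last by lra.
  rewrite max_r; last by lra.
  rewrite /= /mk_path /itv_half2 to_itvE; last by lra.
  by congr (f (to_itv _)); lra.
- by [].
Qed.

End Subpath.

End PathAlgebra.

(** * The fundamental groupoid, read in the fundamental group *)

Section Arrow.
Variables (R : realType) (X : topologicalType) (b : X).
Variable e : forall p : X, path_in R b p.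
Local Notation hom := path_homotopic.

(** Closing up with chosen paths from [b] maps the fundamental groupoid to the
    group [pi_1(X, b)], faithfully on paths with given end points
    ([arrow_inj]).  Computations with composable paths become computations in a
    group, with no constraint on end points. *)
Definition arrow x y (f : path_in R x y) : pi1 R b :=
  loop_class (concat (concat (e x) f) (reverse (e y))).

Let homT := path_homotopic_trans.

Lemma arrow_homotopic x y (f g : path_in R x y) : hom f g -> arrow f = arrow g.
Proof.
move=> fg; apply/loop_classP/concat_homotopic; last exact: path_homotopic_refl.
by apply: concat_homotopic fg; exact: path_homotopic_refl.
Qed.

Lemma arrow_ext x y x' y' (f : path_in R x y) (g : path_in R x' y') :
  f =1 g -> arrow f = arrow g.
Proof.
move=> fg.
have ex : x = x' by rewrite -(path_zero (s := f)) fg path_zero.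
have ey : y = y' by rewrite -(path_one (s := f)) fg path_one.
subst x' y'; exact/arrow_homotopic/path_homotopic_ext.
Qed.

Let cancel_rev (x y z : X) (f : path_in R x y) (g : path_in R y z) :
  hom (concat (reverse f) (concat f g)) g.
Proof.
apply: homT (concatA _ _ _) _; apply: homT (concat_cst_l _).
by apply: concat_homotopic (path_homotopic_refl _); exact: reverse_concat.
Qed.

Let cancel_rev_r (x y z : X) (f : path_in R x y) (g : path_in R z y) :
  hom (concat (concat g (reverse f)) f) g.
Proof.
apply: homT (path_homotopic_sym (concatA _ _ _)) _.
apply: homT (concat_cst_r _).
by apply: concat_homotopic (path_homotopic_refl _) _; exact: reverse_concat.
Qed.

Lemma arrow_concat x y z (f : path_in R x y) (g : path_in R y z) :
  arrow (concat f g) = arrow f * arrow g.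
Proof.
rewrite -loop_class_concat; apply/loop_classP/path_homotopic_sym.
apply: homT (concatA _ _ _) _.
apply: concat_homotopic (path_homotopic_refl _).
apply: homT (concatA _ _ _) _.
apply: homT _ (path_homotopic_sym (concatA (e x) f g)).
by apply: concat_homotopic (path_homotopic_refl _); exact: cancel_rev_r.
Qed.

Lemma arrow_cst x : arrow (cst x : path_in R x x) = 1.
Proof.
apply/loop_classP; apply: homT (concat_reverse (e x)).
apply: concat_homotopic (path_homotopic_refl _); exact: concat_cst_r.
Qed.

Lemma arrow_const x y z (f : path_in R x y) : (forall t, f t = z) -> arrow f = 1.
Proof. by move=> fz; rewrite -(arrow_cst z); exact: arrow_ext. Qed.

Lemma arrow_reverse x y (f : path_in R x y) : arrow (reverse f) = (arrow f)^-1.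
Proof.
apply: (mulgI (arrow f)); rewrite mulgV -arrow_concat -(arrow_cst x).
exact/arrow_homotopic/concat_reverse.
Qed.

Lemma arrow_inj x y (f g : path_in R x y) : arrow f = arrow g -> hom f g.
Proof.
move=> /loop_classP fg.
have red (h : path_in R x y) :
    hom (concat (concat (reverse (e x))
      (concat (concat (e x) h) (reverse (e y)))) (e y)) h.
  apply: homT (path_homotopic_sym (concatA _ _ _)) _.
  apply: homT (cancel_rev (e x) h).
  apply: concat_homotopic (path_homotopic_refl _) _; exact: cancel_rev_r.
apply: homT (path_homotopic_sym (red f)) _; apply: homT (red g).
apply: concat_homotopic (path_homotopic_refl _).
exact: concat_homotopic (path_homotopic_refl _) _.
Qed.

Lemma arrow_diagonal (k : unit_itv R * unit_itv R -> X) (x y z y' x'' z'' : X)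
    (f : path_in R x y) (g : path_in R y' z) (d : path_in R x'' z'') :
  continuous k -> (forall t, f t = k (t, zero)) -> (forall t, g t = k (one, t)) ->
  (forall t, d t = k (t, t)) -> arrow d = arrow f * arrow g.
Proof.
move=> ck fk gk dk.
have yy : y' = y.
  by rewrite -(path_one (s := f)) -(path_zero (s := g)) fk gk.
have xx : x'' = x by rewrite -(path_zero (s := f)) -(path_zero (s := d)) fk dk.
have zz : z'' = z by rewrite -(path_one (s := g)) -(path_one (s := d)) gk dk.
subst y' x'' z''; rewrite -arrow_concat; apply: arrow_homotopic.
exact: diagonal_homotopic ck fk gk dk.
Qed.

(** Both ways round the square are homotopic to its diagonal. *)
Lemma arrow_square (k : unit_itv R * unit_itv R -> X) (x y z w x' y' z' w' : X)
    (f : path_in R x y) (g : path_in R y' z)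
    (f' : path_in R x' w) (g' : path_in R w' z') :
  continuous k -> (forall t, f t = k (t, zero)) -> (forall t, g t = k (one, t)) ->
  (forall t, f' t = k (zero, t)) -> (forall t, g' t = k (t, one)) ->
  arrow f * arrow g = arrow f' * arrow g'.
Proof.
move=> ck fk gk fk' gk'.
have cd : continuous (fun t => k (t, t)).
  apply: (continuous_cmp (g := k) _ ck).
  by apply: continuous_pair => t; exact: cvg_id.
pose d : path_in R (k (zero, zero)) (k (one, one)) := mk_path cd erefl erefl.
rewrite -(arrow_diagonal (d := d) ck fk gk)//.
have csw : continuous (fun u : unit_itv R * unit_itv R => k (u.2, u.1)).
  apply: (continuous_cmp (g := k) _ ck).
  by apply: continuous_pair; [exact: continuous_snd | exact: continuous_fst].
exact: (arrow_diagonal csw).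
Qed.

End Arrow.

(** * Connectedness and local path-connectedness *)

(** Being stable under products, this is easier to carry around than local
    path-connectedness, and it also makes the path
    components of an open set open. *)
Definition path_connected_im_kleinen (R : realType) (T : topologicalType) :=
  forall (x : T) (U : set T), nbhs x U ->
  exists2 V, nbhs x V & forall y, V y ->
    exists f : path_in R x y, range f `<=` U.

Lemma connected_locally_constant (T : topologicalType) (A B : set T) :
  connected A ->
  (forall x, A x -> B x -> nbhs x [set y | A y -> B y]) ->
  (forall x, A x -> ~ B x -> nbhs x [set y | A y -> ~ B y]) ->
  A `&` B !=set0 -> A `<=` B.
Proof.
move=> cA oB oCB AB0; have <- : A `&` B = A; last by move=> z [].
apply: cA => //.
- exists (interior [set y | A y -> B y]); first exact: open_interior.
  apply/seteqP; split=> x [Ax]; first by move=> Bx; split=> //; exact: oB.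
  by move=> /interior_subset/(_ Ax).
- exists (~` interior [set y | A y -> ~ B y]); first exact/open_closedC/open_interior.
  apply/seteqP; split=> x [Ax].
    by move=> Bx; split=> // /interior_subset/(_ Ax); exact.
  move=> nB; split=> //; apply: contrapT => nBx; apply: nB; exact: oCB.
Qed.

Lemma connected_sub_clopen (T : topologicalType) (A B : set T) :
  connected A -> open B -> open (~` B) -> A `&` B !=set0 -> A `<=` B.
Proof.
move=> cA oB oCB AB0; apply: connected_locally_constant => // x Ax Bx.
  have := open_nbhs_nbhs (conj oB Bx); apply: filterS => y By _; exact: By.
have := open_nbhs_nbhs (conj oCB Bx); apply: filterS => y By _; exact: By.
Qed.

Lemma set_type_nbhs (T : topologicalType) (A : set T) (y : set_type A)
    (N : set (set_type A)) : nbhs y N ->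
  exists2 B : set T, nbhs (set_val y) B & forall z, B (set_val z) -> N z.
Proof.
move=> yN; have : (exists2 M, open_nbhs y M & M `<=` N) by rewrite nbhsE in yN.
move=> [M [[B oB <-] By] BN]; exists B; last by move=> z Bz; exact: BN.
exact: (open_nbhs_nbhs (conj oB By)).
Qed.

Section Kleinen.
Variable R : realType.
Local Notation I := (unit_itv R).
Local Notation pcik := (path_connected_im_kleinen R).

Lemma locally_path_connected_pcik (T : topologicalType) :
  locally_path_connected R T -> pcik T.
Proof.
move=> lpc x U /lpc[V [oV Vx VU pV]]; exists V; first exact: open_nbhs_nbhs.
move=> y Vy; have [f fV] := pV _ _ Vx Vy; exists f.
exact: subset_trans fV VU.
Qed.

Lemma prod_pcik (S T : topologicalType) : pcik S -> pcik T -> pcik (S * T)%type.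
Proof.
move=> pS pT [s t] U [[A B] /= [sA tB] ABU].
have [A' sA' hA] := pS _ _ sA; have [B' tB' hB] := pT _ _ tB.
exists (A' `*` B'); first by exists (A', B').
move=> [s' t'] [/= As Bt]; have [f fA] := hA _ As; have [g gB] := hB _ Bt.
have c : continuous (fun u => (f u, g u)).
  by apply: continuous_pair; exact: cts_fun.
have c0 : (f zero, g zero) = (s, t) by rewrite !path_zero.
have c1 : (f one, g one) = (s', t') by rewrite !path_one.
exists (mk_path c c0 c1) => _ [u _ <-]; apply: ABU; split.
  by apply: fA; exists u.
by apply: gB; exists u.
Qed.

Lemma pcik_open (T : topologicalType) (U B : set T) : pcik T -> open U ->
  B `<=` U ->
  (forall x y (f : path_in R x y), range f `<=` U -> B x -> B y) -> open B.
Proof.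
move=> pT oU BU Bp; rewrite openE => x Bx.
have [V xV hV] := pT _ _ (open_nbhs_nbhs (conj oU (BU _ Bx))).
apply: filterS xV => y /hV[f fU]; exact: Bp fU Bx.
Qed.

Lemma path_range_reverse (T : topologicalType) (x y : T) (f : path_in R x y) :
  range (reverse f) `<=` range f.
Proof. by move=> _ [t _ <-]; eexists. Qed.

Lemma path_range_concat (T : topologicalType) (x y z : T) (f : path_in R x y)
    (g : path_in R y z) : range (concat f g) `<=` range f `|` range g.
Proof.
move=> _ [t _ <-]; rewrite concatE /concat_fun.
by case: ifP => _; [left|right]; eexists.
Qed.

Lemma path_ends (T : topologicalType) x y (f : path_in R x y)
    (P : T -> T -> Prop) : P (f zero) (f one) -> P x y.
Proof.
by move: (f zero) (f one) (path_zero (s := f)) (path_one (s := f)) => _ _ -> ->.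
Qed.

Lemma itv_segment_connected (s t : R) :
  connected [set u : I | (s <= itv_val u <= t)%R].
Proof.
have -> : [set u : I | (s <= itv_val u <= t)%R] =
    @to_itv R @` `[(Num.max 0 s)%R, (Num.min 1 t)%R].
  apply/seteqP; split=> [u /= /andP[su ut]|_ [r /= + <-]].
    have /andP[u0 u1] := itv_valP u.
    by exists (itv_val u); rewrite ?itv_valK //= in_itv /= ge_max le_min u0 u1 su.
  rewrite in_itv /= ge_max le_min => /andP[/andP[r0 sr] /andP[r1 rt]].
  by rewrite to_itvE ?r0// sr.
apply: connected_continuous_connected; first exact: segment_connected.
exact/continuous_subspaceT/to_itv_continuous.
Qed.

Lemma itv_connected : connected [set: I].
Proof.
have := @itv_segment_connected 0%R 1%R; congr connected.
by apply/seteqP; split=> // u _; exact: itv_valP.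
Qed.

Lemma itv_nbhs (r : R) (N : set I) : nbhs (to_itv r) N ->
  exists2 d : R, (0 < d)%R &
    forall u : I, (r - d < itv_val u)%R -> (itv_val u < r + d)%R -> N u.
Proof.
move=> /(@to_itv_continuous R r)/nbhs_ballP[d /= d0 dN]; exists d => // u ru ur.
rewrite -[u]itv_valK; apply: dN; rewrite -ball_normE /= distrC ltr_distl.
by rewrite ru ur.
Qed.

Lemma path_component (T : topologicalType) (A : set T) x y (f : path_in R x y) :
  range f `<=` A -> connected_component A x y.
Proof.
move=> fA; exists (range f); last by exists one; rewrite ?path_one.
split=> //; first by exists zero; rewrite ?path_zero.
apply: connected_continuous_connected; first exact: itv_connected.
exact/continuous_subspaceT/cts_fun.
Qed.

Lemma connected_joined (T : topologicalType) (A : set T) x y : pcik T ->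
  connected A -> A x -> A y -> exists f : path_in R x y, True.
Proof.
move=> pT cA Ax Ay; pose B := [set z | exists f : path_in R x z, True].
have oB (C : set T) : (forall z w (f : path_in R z w), C z -> C w) -> open C.
  move=> hC; apply: (pcik_open pT (@openT T)) => // z w f _; exact: hC f.
suff: A `<=` B by move/(_ _ Ay).
apply: connected_sub_clopen => //.
- by apply: oB => z w f [g _]; exists (concat g f).
- apply: oB => z w f nBz [g _]; apply: nBz; by exists (concat g (reverse f)).
- by exists x; split=> //; exists (cst x).
Qed.

(** The inverse of a chart carries the radii of a ball to paths of [G]. *)
Lemma lie_pcik (G : lieGroupType R) : pcik G.
Proof.
move=> g U gU; have [c _ cg] := lie_atlas_cover g.
pose n := @lie_dim R G; set v := c g; pose C := c @` chart_dom c.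
have oC : open C by exact: chart_codom_open.
have Cv : C v by exists g.
have ci : {in C, continuous (chart_inv c)}.
  rewrite -continuous_open_subspace//; exact: (@chart_inv_continuous _ _ _ c).
have cc : {in chart_dom c, continuous c}.
  rewrite -continuous_open_subspace; first exact: (@chart_continuous _ _ _ c).
  exact: chart_dom_open.
have ivg : chart_inv c v = g by apply: (chartK (c := c)); rewrite inE.
have /nbhs_ballP[r /= r0 rball] : nbhs v (C `&` chart_inv c @^-1` U).
  apply: filterI; first exact: open_nbhs_nbhs.
  by apply: (ci v _); [rewrite inE | rewrite ivg].
exists (chart_dom c `&` c @^-1` (ball v r)).
  apply: filterI; first exact: (open_nbhs_nbhs (conj (@chart_dom_open _ _ _ c) cg)).
  by apply: (cc g); [rewrite inE | exact: nbhsx_ballx].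
move=> y [cy vy].
pose l (t : I) : 'rV[R]_n := (v + itv_val t *: (c y - v))%R.
have lball t : ball v r (l t).
  move: vy; rewrite -!ball_normE /= => vy; rewrite /l opprD addrA subrr add0r.
  rewrite normrN normrZ; have /andP[t0 t1] := itv_valP t.
  apply: le_lt_trans vy; rewrite ger0_norm// distrC.
  by rewrite -[leRHS]mul1r ler_wpM2r.
have cl : continuous l.
  move=> t; apply: (@cvgD R 'rV[R]_n I (nbhs t) _ (cst v)
    (fun s => itv_val s *: (c y - v))%R); first exact: cvg_cst.
  exact: (@cvgZr_tmp R 'rV[R]_n I (nbhs t) _ (@itv_val R) _ _
    (@itv_val_continuous R t)).
have clt : continuous (chart_inv c \o l).
  move=> t; apply: continuous_comp; first exact: cl.
  by apply: ci; rewrite inE; have [] := rball _ (lball t).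
have l0 : (chart_inv c \o l) zero = g.
  by rewrite /= /l itv_val0 scale0r addr0.
have l1 : (chart_inv c \o l) one = y.
  rewrite /= /l itv_val1 scale1r addrC subrK.
  by apply: (chartK (c := c)); rewrite inE.
exists (mk_path clt l0 l1) => _ [t _ <-].
by have [] := rball _ (lball t).
Qed.

(** Cousin's principle, a substitute for Lebesgue numbers: the points up to which
    the property holds from [a] form a subset of [[a, b]] that is open and closed
    in it, hence everything. *)
Lemma interval_induction (P : R -> R -> Prop) (a b : R) : (a <= b)%R ->
  (forall s t u, a <= s -> s <= t -> t <= u -> u <= b ->
    P s t -> P t u -> P s u)%R ->
  (forall t, a <= t <= b -> exists2 d, 0 < d & forall s u,
    a <= s -> s <= u -> u <= b -> t - d < s -> u < t + d -> P s u)%R ->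
  P a b.
Proof.
move=> ab Padd Ploc; pose B := [set t | forall s, (a <= s <= t)%R -> P a s].
pose N (t d : R) := [set u : R | t - d < u < t + d]%R.
have nN (t d : R) : (0 < d)%R -> nbhs t (N t d).
  move=> d0; have -> : N t d = `](t - d)%R, (t + d)%R[%classic.
    by apply/seteqP; split=> u /=; rewrite in_itv.
  apply: open_nbhs_nbhs; split; first exact: itv_open.
  by rewrite /= in_itv /=; apply/andP; split; lra.
(* Within a small interval around [t], membership in [B] does not vary. *)
have loc t : (a <= t <= b)%R -> exists2 d : R, (0 < d)%R &
    forall s u, (a <= s <= b)%R -> (a <= u <= b)%R -> N t d s -> N t d u ->
    B s -> B u.
  move=> tab; have [d d0 hd] := Ploc _ tab; exists d => // s u.
  move=> /andP[as_ sb] /andP[au ub] /andP[ds sd] /andP[du ud] Bs r /andP[ar ru].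
  have [rs|sr] := leP r s; first by apply: Bs; rewrite ar rs.
  apply: (Padd a s r) => //; [exact: ltW|exact: le_trans ru ub|..].
    by apply: Bs; rewrite as_ lexx.
  by apply: hd => //; [exact: ltW|exact: le_trans ru ub|exact: le_lt_trans ud].
have inab t : `[a, b]%classic t -> (a <= t <= b)%R by rewrite /= in_itv.
have center t (d : R) : (0 < d)%R -> N t d t.
  by move=> d0; apply/andP; split; lra.
suff: `[a, b] `<=` B by move/(_ b); apply; rewrite /= ?in_itv/= ab lexx.
apply: connected_locally_constant; first exact: segment_connected.
- move=> t /inab tab Bt; have [d d0 hd] := loc _ tab.
  apply: filterS (nN t d d0) => u Nu /inab uab; apply: hd Bt => //; exact: center.
- move=> t /inab tab nBt; have [d d0 hd] := loc _ tab.
  apply: filterS (nN t d d0) => u Nu /inab uab Bu; apply: nBt.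
  by apply: hd Bu => //; exact: center.
- exists a; split; first by rewrite /= in_itv/= lexx ab.
  move=> s /andP[as_ sa]; have -> : s = a by apply/eqP; rewrite eq_le as_ sa.
  have aab : (a <= a <= b)%R by rewrite lexx.
  have [d d0 hd] := Ploc a aab.
  by apply: hd => //; lra.
Qed.

End Kleinen.

(** * The Rhodes group of an action *)

Section Action.
Variables (R : realType) (G : topologicalGroupType) (X : topologicalType).
Variable a : continuous_action G X.
Local Notation I := (unit_itv R).

Lemma action_continuous_fun (S : topologicalType) (u : S -> G) (v : S -> X) :
  continuous u -> continuous v -> continuous (fun s => a (u s) (v s)).
Proof.
move=> cu cv.
exact: (continuous_cmp (continuous_pair cu cv) (@action_continuous _ _ a)).
Qed.

Lemma action_map_continuous (g : G) : continuous (a g).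
Proof.
apply: action_continuous_fun => [|p]; [exact: cst_continuous | exact: cvg_id].
Qed.

Lemma orbit_map_continuous (p : X) : continuous (a^~ p).
Proof.
apply: action_continuous_fun => [g|]; [exact: cvg_id | exact: cst_continuous].
Qed.

Definition act_path g p q (f : path_in R p q) : path_in R (a g p) (a g q) :=
  push_path (@action_map_continuous g) f.

Definition orbit_path g h (u : path_in R g h) p : path_in R (a g p) (a h p) :=
  push_path (@orbit_map_continuous p) u.

Variables (b : X) (e : forall p, path_in R b p).
Local Notation "⟦ f ⟧" := (arrow e f) (format "⟦ f ⟧").

(** The two ways round the square [u_s f_t]. *)
Lemma arrow_slide g h (u : path_in R g h) p q (f : path_in R p q) :
  ⟦orbit_path u p⟧ * ⟦act_path h f⟧ = ⟦act_path g f⟧ * ⟦orbit_path u q⟧.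
Proof.
apply: (@arrow_square _ _ _ _ (fun s => a (u s.1) (f s.2))) => [|t|t|t|t].
- apply: action_continuous_fun.
    exact: continuous_cmp continuous_fst (@cts_fun _ _ u).
  exact: continuous_cmp continuous_snd (@cts_fun _ _ f).
- by rewrite /= path_zero.
- by rewrite /= path_one.
- by rewrite /= path_zero.
- by rewrite /= path_one.
Qed.

Lemma arrow_act_concat g p q r (f : path_in R p q) (k : path_in R q r) :
  ⟦act_path g (concat f k)⟧ = ⟦act_path g f⟧ * ⟦act_path g k⟧.
Proof. by rewrite -arrow_concat; apply: arrow_ext; exact: push_path_concat. Qed.

Lemma arrow_act_eq g p q (f k : path_in R p q) :
  ⟦f⟧ = ⟦k⟧ -> ⟦act_path g f⟧ = ⟦act_path g k⟧.
Proof. by move=> /arrow_inj fk; apply/arrow_homotopic/push_path_homotopic. Qed.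

Lemma arrow_act_reverse g p q (f : path_in R p q) :
  ⟦act_path g (reverse f)⟧ = ⟦act_path g f⟧^-1.
Proof. by rewrite -arrow_reverse; exact: arrow_ext. Qed.

Lemma arrow_orbit_concat g h k (u : path_in R g h) (v : path_in R h k) p :
  ⟦orbit_path (concat u v) p⟧ = ⟦orbit_path u p⟧ * ⟦orbit_path v p⟧.
Proof. by rewrite -arrow_concat; apply: arrow_ext; exact: push_path_concat. Qed.

Lemma arrow_orbit_reverse g h (u : path_in R g h) p :
  ⟦orbit_path (reverse u) p⟧ = ⟦orbit_path u p⟧^-1.
Proof. by rewrite -arrow_reverse; exact: arrow_ext. Qed.

Lemma arrow_orbit_cst g p : ⟦orbit_path (cst g : path_in R g g) p⟧ = 1.
Proof. exact: (@arrow_const _ _ _ e _ _ (a g p)). Qed.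

Lemma loop_class_arrow (f k : loop R b) :
  loop_class f = loop_class k <-> ⟦f⟧ = ⟦k⟧.
Proof.
by rewrite loop_classP; split; [exact: arrow_homotopic | exact: arrow_inj].
Qed.

Definition orbit_loop (u : loop R (1 : G)) : loop R b :=
  recast (orbit_path u b) (action1 a b) (action1 a b).

Definition orbit_pi1 (u : pi1 R (1 : G)) : pi1 R b :=
  loop_class (orbit_loop (repr u)).

Lemma arrow_orbit_loop u : ⟦orbit_loop u⟧ = ⟦orbit_path u b⟧.
Proof. exact: arrow_ext. Qed.

Lemma orbit_pi1E u : orbit_pi1 (loop_class u) = loop_class (orbit_loop u).
Proof.
apply/loop_class_arrow; rewrite !arrow_orbit_loop.
by apply/arrow_homotopic/push_path_homotopic/repr_loop_class.
Qed.

Lemma orbit_pi1M : {morph orbit_pi1 : u v / u * v}.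
Proof.
move=> u v; have [[f ->] [k ->]] := (pi1P u, pi1P v).
rewrite -loop_class_concat !orbit_pi1E -loop_class_concat.
apply/loop_class_arrow; rewrite arrow_concat !arrow_orbit_loop.
exact: arrow_orbit_concat.
Qed.

(** A loop [u] in [G] and a loop [f] in [X] span the torus [u_s f_t]. *)
Lemma orbit_pi1_central u v : commute (orbit_pi1 u) v.
Proof.
have [[f ->] [k ->]] := (pi1P u, pi1P v).
rewrite /commute orbit_pi1E -!loop_class_concat; apply/loop_class_arrow.
rewrite !arrow_concat arrow_orbit_loop.
have act1 : ⟦act_path 1 k⟧ = ⟦k⟧.
  by apply: arrow_ext => t; exact: action1.
by rewrite -act1 arrow_slide.
Qed.

Lemma orbit_pi1_eq1 (u : loop R (1 : G)) :
  orbit_pi1 (loop_class u) = 1 <-> ⟦orbit_path u b⟧ = 1.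
Proof.
rewrite orbit_pi1E -loop_class_cst loop_class_arrow arrow_orbit_loop.
by rewrite arrow_cst.
Qed.

(** Conjugating [u] by [g] moves the orbit loop to the base point [g^-1 b], and
    sliding it back along a path from there to [b] does not change its class up
    to conjugacy. *)
Lemma orbit_pi1_conj g u : orbit_pi1 u = 1 -> orbit_pi1 (conj_pi1 g u) = 1.
Proof.
have [f ->] := pi1P u; rewrite conj_pi1E !orbit_pi1_eq1 => fb1.
pose p := a g^-1 b.
have fp : ⟦orbit_path f p⟧ = 1.
  have := arrow_slide f (e p); rewrite fb1 mul1g => /esym.
  by rewrite -[RHS]mulg1; exact: mulgI.
have gp : a g (a 1 p) = b by rewrite -actionM mulg1 -actionM mulgV action1.
rewrite -(arrow_cst e b).
transitivity ⟦act_path g (orbit_path f p)⟧.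
  by apply: arrow_ext => t; rewrite /= /mk_path /= /mk_path /= !actionM.
rewrite -(arrow_cst e (a 1 p)) in fp.
rewrite (arrow_act_eq g fp) arrow_cst; exact: (@arrow_const _ _ _ e _ _ (a g (a 1 p))).
Qed.

(** An element of the Rhodes group is a group element [g] with a path from [b] to
    [g b]; here such pairs are moreover identified along paths in [G], so that
    only the component of [g] is remembered and the orbit loops die. *)
Definition twisted_path := {g : G & path_in R b (a g b)}.
HB.instance Definition _ := Choice.on twisted_path.

Definition Twisted g (f : path_in R b (a g b)) : twisted_path := existT _ g f.

Definition rhodes_rel : rel twisted_path := fun s t =>
  `[< exists u : path_in R (projT1 s) (projT1 t),
      ⟦projT2 s⟧ * ⟦orbit_path u b⟧ = ⟦projT2 t⟧ >].

Let rhodes_refl : reflexive rhodes_rel.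
Proof.
by move=> [g f]; apply/asboolP; exists (cst g); rewrite arrow_orbit_cst mulg1.
Qed.

Let rhodes_symP s t : rhodes_rel s t -> rhodes_rel t s.
Proof.
move=> /asboolP[u ust]; apply/asboolP; exists (reverse u).
by rewrite arrow_orbit_reverse -ust mulgK.
Qed.

Let rhodes_sym : symmetric rhodes_rel.
Proof. by move=> s t; apply/idP/idP; exact: rhodes_symP. Qed.

Let rhodes_trans : transitive rhodes_rel.
Proof.
move=> t s r /asboolP[u ust] /asboolP[v vtr]; apply/asboolP.
by exists (concat u v); rewrite arrow_orbit_concat mulgA ust.
Qed.

Canonical rhodes_equiv :=
  EquivRel rhodes_rel rhodes_refl rhodes_sym rhodes_trans.

Definition rhodes := {eq_quot rhodes_equiv}.
HB.instance Definition _ := Choice.on rhodes.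
HB.instance Definition _ := EqQuotient.on rhodes.

Definition rhodes_class g (f : path_in R b (a g b)) : rhodes :=
  \pi_{eq_quot rhodes_equiv} (Twisted f).

Lemma rhodes_classP g h (f : path_in R b (a g b)) (k : path_in R b (a h b)) :
  rhodes_class f = rhodes_class k <->
  exists u : path_in R g h, ⟦f⟧ * ⟦orbit_path u b⟧ = ⟦k⟧.
Proof.
split=> [/(@eqmodP _ rhodes_equiv)/asboolP//|ufk].
exact/(@eqmodP _ rhodes_equiv)/asboolP.
Qed.

Lemma rhodes_class_eq g h (f : path_in R b (a g b)) (k : path_in R b (a h b)) :
  g = h -> ⟦f⟧ = ⟦k⟧ -> rhodes_class f = rhodes_class k.
Proof.
move=> gh; subst h => fk; apply/rhodes_classP; exists (cst g).
by rewrite arrow_orbit_cst mulg1.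
Qed.

Lemma rhodesP (r : rhodes) : exists g (f : path_in R b (a g b)), r = rhodes_class f.
Proof.
exists (projT1 (repr r)), (projT2 (repr r)).
rewrite -[LHS](@reprK _ {eq_quot rhodes_equiv}) /rhodes_class; congr \pi.
by case: (repr r).
Qed.

Definition twisted_mul g h (f : path_in R b (a g b)) (k : path_in R b (a h b)) :
    path_in R b (a (g * h) b) :=
  concat f (recast (act_path g k) erefl (esym (actionM a g h b))).

Definition twisted_inv g (f : path_in R b (a g b)) : path_in R b (a g^-1 b) :=
  recast (act_path g^-1 (reverse f))
    (etrans (esym (actionM a g^-1 g b))
       (etrans (congr1 (a^~ b) (mulVg g)) (action1 a b)))
    erefl.

Lemma arrow_twisted_mul g h (f : path_in R b (a g b)) (k : path_in R b (a h b)) :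
  ⟦twisted_mul f k⟧ = ⟦f⟧ * ⟦act_path g k⟧.
Proof. by rewrite arrow_concat; congr (_ * _); exact: arrow_ext. Qed.

Lemma arrow_twisted_inv g (f : path_in R b (a g b)) :
  ⟦twisted_inv f⟧ = ⟦act_path g^-1 f⟧^-1.
Proof. by rewrite -arrow_act_reverse; exact: arrow_ext. Qed.

Let rone : rhodes :=
  rhodes_class (recast (cst b : loop R b) erefl (esym (action1 a b))).
Let rmul (r s : rhodes) : rhodes :=
  rhodes_class (twisted_mul (projT2 (repr r)) (projT2 (repr s))).
Let rinv (r : rhodes) : rhodes := rhodes_class (twisted_inv (projT2 (repr r))).

Lemma repr_rhodes g (f : path_in R b (a g b)) :
  exists u : path_in R (projT1 (repr (rhodes_class f))) g,
    ⟦projT2 (repr (rhodes_class f))⟧ * ⟦orbit_path u b⟧ = ⟦f⟧.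
Proof.
set r := repr _; apply/(@rhodes_classP _ _ (projT2 r) f).
rewrite -[RHS](@reprK _ {eq_quot rhodes_equiv}) /rhodes_class; congr \pi.
by rewrite -/(rhodes_class f) /r; case: (repr _).
Qed.

Let rmulE g h (f : path_in R b (a g b)) (k : path_in R b (a h b)) :
  rmul (rhodes_class f) (rhodes_class k) = rhodes_class (twisted_mul f k).
Proof.
rewrite /rmul; have [u uf] := repr_rhodes f; have [v vk] := repr_rhodes k.
move: (projT2 (repr (rhodes_class f))) u uf.
move: (projT1 (repr (rhodes_class f))) => g' f' u uf.
move: (projT2 (repr (rhodes_class k))) v vk.
move: (projT1 (repr (rhodes_class k))) => h' k' v vk.
have cuv : continuous (fun t => u t * v t).
  by apply: mul_continuous_fun; exact: cts_fun.
have uv0 : u zero * v zero = g' * h' by rewrite !path_zero.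
have uv1 : u one * v one = g * h by rewrite !path_one.
(* The path [u_t v_t b] is the diagonal of the square [u_s v_t b]; what is left
   over after splitting it comes from sliding [k'] along [u]. *)
apply/rhodes_classP; exists (mk_path cuv uv0 uv1).
rewrite !arrow_twisted_mul -uf -[RHS]mulgA -mulgA; congr (_ * _).
have -> : ⟦act_path g k⟧ = ⟦act_path g k'⟧ * ⟦act_path g (orbit_path v b)⟧.
  by rewrite -arrow_act_concat; apply: arrow_act_eq; rewrite arrow_concat.
rewrite mulgA arrow_slide -mulgA; congr (_ * _).
apply: (@arrow_diagonal _ _ _ _ (fun s => a (u s.1) (a (v s.2) b))) => [|t|t|t].
- apply: action_continuous_fun.
    exact: continuous_cmp continuous_fst (@cts_fun _ _ u).
  apply: (continuous_cmp (f := fun s : I * I => v s.2) _ (@orbit_map_continuous b)).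
  exact: continuous_cmp continuous_snd (@cts_fun _ _ v).
- by rewrite /= path_zero.
- by rewrite /= path_one.
- by rewrite /= /mk_path /= actionM.
Qed.

Let rinvE g (f : path_in R b (a g b)) :
  rinv (rhodes_class f) = rhodes_class (twisted_inv f).
Proof.
rewrite /rinv; have [u uf] := repr_rhodes f.
move: (projT2 (repr (rhodes_class f))) u uf.
move: (projT1 (repr (rhodes_class f))) => g' f' u uf.
have cu : continuous (fun t => (u t)^-1).
  exact: continuous_cmp (@cts_fun _ _ u) (@invg_continuous G).
have u0 : (u zero)^-1 = g'^-1 by rewrite path_zero.
have u1 : (u one)^-1 = g^-1 by rewrite path_one.
pose w : path_in R g'^-1 g^-1 := mk_path cu u0 u1.
apply/rhodes_classP; exists w; rewrite !arrow_twisted_inv.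
have -> : ⟦act_path g^-1 f⟧ =
    ⟦act_path g^-1 f'⟧ * ⟦act_path g^-1 (orbit_path u b)⟧.
  by rewrite -arrow_act_concat; apply: arrow_act_eq; rewrite arrow_concat.
have wu : ⟦orbit_path w (a g' b)⟧ * ⟦act_path g^-1 (orbit_path u b)⟧ = 1.
  rewrite -(@arrow_diagonal _ _ _ e (fun s => a (w s.1) (a (u s.2) b))
    _ _ _ _ _ _ _ _ (cst b : loop R b)) ?arrow_cst// => [|t|t|t].
  - apply: action_continuous_fun.
      exact: continuous_cmp continuous_fst (@cts_fun _ _ w).
    apply: (continuous_cmp (f := fun s : I * I => u s.2) _ (@orbit_map_continuous b)).
    exact: continuous_cmp continuous_snd (@cts_fun _ _ u).
  - by rewrite /= path_zero.
  - by rewrite /= path_one.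
  - by rewrite /= /mk_path -actionM mulVg action1.
have wf := arrow_slide w f'.
have -> : ⟦act_path g^-1 f'⟧ =
    ⟦orbit_path w b⟧^-1 * ⟦act_path g'^-1 f'⟧ * ⟦orbit_path w (a g' b)⟧.
  by rewrite -mulgA -wf mulKg.
by rewrite -(mulgA _ _ ⟦act_path g^-1 (orbit_path u b)⟧) wu mulg1 invgM invgK.
Qed.

Let rmulA : associative rmul.
Proof.
move=> r s t; have [g [f ->]] := rhodesP r; have [h [k ->]] := rhodesP s.
have [l [m ->]] := rhodesP t; rewrite !rmulE.
apply: rhodes_class_eq; first by rewrite mulgA.
rewrite !arrow_twisted_mul -mulgA; congr (_ * _).
have -> : ⟦act_path g (twisted_mul k m)⟧ =
    ⟦act_path g k⟧ * ⟦act_path g (act_path h m)⟧.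
  rewrite -arrow_act_concat; apply: arrow_ext => t'.
  by rewrite /= /mk_path /= /mk_path.
by congr (_ * _); apply: arrow_ext => t' /=; rewrite /mk_path /= actionM.
Qed.

Let rmul1 : left_id rone rmul.
Proof.
move=> r; have [g [f ->]] := rhodesP r; rewrite rmulE.
apply: rhodes_class_eq; first by rewrite mul1g.
rewrite arrow_twisted_mul (@arrow_const _ _ _ e _ _ b)// mul1g.
by apply: arrow_ext => t /=; rewrite /mk_path /= action1.
Qed.

Let r1mul : right_id rone rmul.
Proof.
move=> r; have [g [f ->]] := rhodesP r; rewrite rmulE.
apply: rhodes_class_eq; first by rewrite mulg1.
rewrite arrow_twisted_mul (@arrow_const _ _ _ e _ _ (a g b) (act_path g _))//.
exact: mulg1.
Qed.

Let rmulV : left_inverse rone rinv rmul.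
Proof.
move=> r; have [g [f ->]] := rhodesP r; rewrite rinvE rmulE.
apply: rhodes_class_eq; first by rewrite mulVg.
rewrite arrow_twisted_mul arrow_twisted_inv mulVg.
by rewrite (@arrow_const _ _ _ e _ _ b).
Qed.

Let rVmul : right_inverse rone rinv rmul.
Proof.
move=> r; have [g [f ->]] := rhodesP r; rewrite rinvE rmulE.
apply: rhodes_class_eq; first by rewrite mulgV.
rewrite arrow_twisted_mul.
have -> : ⟦act_path g (twisted_inv f)⟧ = ⟦reverse f⟧.
  apply: arrow_ext => t /=; rewrite /mk_path /= /mk_path /=.
  by rewrite -actionM mulgV action1.
by rewrite arrow_reverse mulgV (@arrow_const _ _ _ e _ _ b).
Qed.

HB.instance Definition _ := isGroup.Build rhodes rmulA rmul1 r1mul rmulV rVmul.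

Lemma rhodes_classM g h (f : path_in R b (a g b)) (k : path_in R b (a h b)) :
  rhodes_class (twisted_mul f k) = rhodes_class f * rhodes_class k.
Proof. by rewrite -rmulE. Qed.

Lemma rhodes_class1 :
  rhodes_class (recast (cst b : loop R b) erefl (esym (action1 a b))) = 1.
Proof. by []. Qed.

Definition rhodes_loop (f : loop R b) : rhodes :=
  rhodes_class (recast f erefl (esym (action1 a b))).

Lemma rhodes_loop_concat f k :
  rhodes_loop (concat f k) = rhodes_loop f * rhodes_loop k.
Proof.
rewrite -rhodes_classM; apply: rhodes_class_eq; first by rewrite mulg1.
rewrite arrow_twisted_mul.
have -> : ⟦recast (concat f k) erefl (esym (action1 a b))⟧ = ⟦concat f k⟧.
  exact: arrow_ext.
rewrite arrow_concat; congr (_ * _); apply: arrow_ext => t //=.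
by rewrite /mk_path /= action1.
Qed.

Lemma rhodes_loop_homotopic f k :
  path_homotopic f k -> rhodes_loop f = rhodes_loop k.
Proof.
move=> fk; apply: rhodes_class_eq => //.
transitivity ⟦f⟧; first exact: arrow_ext.
by rewrite (arrow_homotopic e fk); exact: arrow_ext.
Qed.

Lemma rhodes_loop_eq1 f :
  rhodes_loop f = 1 <-> exists u, orbit_pi1 u = loop_class f.
Proof.
rewrite -rhodes_class1; split=> [/esym/rhodes_classP[u uf]|[u]].
  exists (loop_class u); rewrite orbit_pi1E; apply/loop_class_arrow.
  rewrite arrow_orbit_loop -[LHS]mul1g -(arrow_cst e b).
  transitivity ⟦recast f erefl (esym (action1 a b))⟧; last exact: arrow_ext.
  by rewrite -uf; congr (_ * _); exact: arrow_ext.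
have [k ->] := pi1P u; rewrite orbit_pi1E => /loop_class_arrow kf.
apply/esym/rhodes_classP; exists k.
rewrite (@arrow_const _ _ _ e _ _ b)// mul1g -arrow_orbit_loop kf.
exact: arrow_ext.
Qed.

(** The end point [g b] is brought back to [b] along the orbit path of [u]. *)
Lemma rhodes_class_loop g (u : path_in R 1 g) (f : path_in R b (a g b)) :
  exists k, rhodes_loop k = rhodes_class f.
Proof.
pose k := recast (concat f (reverse (orbit_path u b))) erefl (action1 a b).
exists k; apply/rhodes_classP; exists u.
have -> : ⟦recast k erefl (esym (action1 a b))⟧ =
    ⟦concat f (reverse (orbit_path u b))⟧ by exact: arrow_ext.
by rewrite arrow_concat arrow_reverse mulgVK.
Qed.

Definition rhodes_proj (r : rhodes) : pi0G G := pi0G_class (projT1 (repr r)).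

Lemma rhodes_projE g (f : path_in R b (a g b)) :
  rhodes_proj (rhodes_class f) = pi0G_class g.
Proof.
have [u _] := repr_rhodes f; apply/pi0G_classP; exact: (path_component (f := u)).
Qed.

Lemma rhodes_projM : {morph rhodes_proj : r s / r * s}.
Proof.
move=> r s; have [g [f ->]] := rhodesP r; have [h [k ->]] := rhodesP s.
by rewrite -rhodes_classM !rhodes_projE pi0G_classM.
Qed.

End Action.

(** * The orbit space and the isotropy of a section *)

Section OrbitSpaceTopology.
Variables (R : realType) (G : topologicalGroupType) (X : topologicalType).
Variable a : continuous_action G X.
Local Notation Q := (orbit_space a).

Lemma orbit_proj_continuous : continuous (@orbit_proj G X a).
Proof. exact: (@pi_continuous X {eq_quot (orbit_equiv a)}). Qed.

Lemma orbit_projP p q : orbit_proj a p = orbit_proj a q <-> exists g, a g p = q.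
Proof.
split=> [/(@eqmodP _ (orbit_equiv a))/asboolP//|gpq].
exact/(@eqmodP _ (orbit_equiv a))/asboolP.
Qed.

Lemma orbit_proj_act g p : orbit_proj a (a g p) = orbit_proj a p.
Proof. by apply/esym/orbit_projP; exists g. Qed.

Lemma open_orbit_proj (U : set X) : open U -> open (orbit_proj a @` U).
Proof.
move=> oU; suff : open (orbit_proj a @^-1` (orbit_proj a @` U)) by [].
have -> : orbit_proj a @^-1` (orbit_proj a @` U) =
    \bigcup_(g in [set: G]) (a g @^-1` U).
  apply/seteqP; split=> [p [q Uq /esym/orbit_projP[g gpq]]|p [g _ /= Ugp]].
    by exists g => //=; rewrite gpq.
  by exists (a g p) => //; exact: orbit_proj_act.
apply: bigcup_open => g _; apply: open_comp oU => p _.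
exact: action_map_continuous.
Qed.

(** Paths of [X] project to [Q], and the projection is open. *)
Lemma orbit_space_pcik : path_connected_im_kleinen R X ->
  path_connected_im_kleinen R Q.
Proof.
move=> pX q U qU.
have [p pq] : exists p, orbit_proj a p = q.
  by exists (repr q); exact: (@reprK _ {eq_quot (orbit_equiv a)}).
have pU : nbhs p (orbit_proj a @^-1` U).
  by apply: (@orbit_proj_continuous p); rewrite pq.
have [V pV hV] := pX _ _ pU; exists (orbit_proj a @` V).
  rewrite -pq; exists (orbit_proj a @` interior V).
    split; first exact/open_orbit_proj/open_interior.
    by exists p => //; rewrite -nbhsE/=.
  by apply: image_subset; exact: interior_subset.
move=> _ [r Vr <-]; have [f fU] := hV _ Vr.
exists (recast (push_path orbit_proj_continuous f) pq erefl).
by move=> _ [t _ <-]; apply: (fU (f t)); exists t.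
Qed.

End OrbitSpaceTopology.

Section Isotropy.
Variables (R : realType) (G : lieGroupType R) (X : topologicalType).
Variables (a : continuous_action G X) (x : orbit_space a -> X).
Hypothesis section_x : polar_section x.
Local Notation Q := (orbit_space a).
Local Notation H := (isotropy x).
Local Notation phi := (orbit_map x).

Lemma section_continuous : continuous x. Proof. by case: section_x. Qed.
Lemma sectionK : cancel x (orbit_proj a). Proof. by case: section_x. Qed.

Lemma orbit_map_lift p : exists y, phi y = p.
Proof. by have [_ _ [+ _]] := section_x; apply. Qed.

Lemma orbit_map_open U : open (phi @^-1` U) <-> open U.
Proof. by have [_ _ [_ hU]] := section_x; split=> /hU. Qed.

Lemma phi_continuous : continuous phi.
Proof. by apply/continuousP => U /orbit_map_open. Qed.

Lemma phi_proj y : orbit_proj a (phi y) = y.2.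
Proof. by rewrite orbit_proj_act sectionK. Qed.

Lemma phi_fibre y z : phi y = phi z -> y.2 = z.2 /\ H (y.1^-1 * z.1, z.2).
Proof.
move=> yz; have qq : y.2 = z.2 by rewrite -!phi_proj yz.
split=> //; rewrite /isotropy /orbit_map /= actionM.
by rewrite -[a z.1 _]/(phi z) -yz /orbit_map -actionM mulVg action1 qq.
Qed.

Lemma phi_isotropy g h q : H (h, q) -> phi (g * h, q) = phi (g, q).
Proof. by rewrite /isotropy /orbit_map /= actionM => ->. Qed.

Lemma phi_act g h q : phi (g * h, q) = a g (phi (h, q)).
Proof. by rewrite /orbit_map /= actionM. Qed.

Lemma isotropy1 q : H (1, q).
Proof. exact: action1. Qed.

Lemma isotropyM g h q : H (g, q) -> H (h, q) -> H (g * h, q).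
Proof. by rewrite /isotropy /orbit_map /= actionM => gq ->. Qed.

Lemma isotropyV g q : H (g, q) -> H (g^-1, q).
Proof.
rewrite /isotropy /orbit_map /= => gq.
by rewrite -{1}gq -actionM mulVg action1.
Qed.

(** Being total, this applies to points that are only seen to lie in the isotropy
    through an equation. *)
Definition jump (y : G * Q) : pi0_hat x :=
  if pselect (H y) is left Hy then word_class _ [:: (pi0_class Hy, false)] else 1.

Lemma jump_class (c : pi0 H) y : pi0_set c y ->
  jump y = word_class _ [:: (c, false)].
Proof.
move=> /pi0_memP[Hy yc]; rewrite /jump; case: pselect => // Hy'.
by congr (word_class _ [:: (_, _)]); apply: pi0_set_inj.
Qed.

Lemma pi0_set_class y (Hy : H y) : pi0_set (pi0_class Hy) y.
Proof. exact: connected_component_refl. Qed.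

Lemma jump_component y z : connected_component H y z -> jump y = jump z.
Proof.
move=> yz; have Hy : H y by have [C [Cy CH _] _] := yz; exact: CH.
rewrite (jump_class (pi0_set_class Hy)); apply/esym/jump_class; exact: yz.
Qed.

Lemma jump_path y z (c : path_in R y z) : range c `<=` H -> jump y = jump z.
Proof. by move=> cH; exact: jump_component (path_component cH). Qed.

Lemma jumpM g h q : H (g, q) -> H (h, q) ->
  jump (g * h, q) = jump (g, q) * jump (h, q).
Proof.
move=> Hg Hh; have Hgh := isotropyM Hg Hh.
rewrite (jump_class (pi0_set_class Hg)) (jump_class (pi0_set_class Hh)).
rewrite (jump_class (pi0_set_class Hgh)) -word_class_cat.
apply/word_classP => /=.
set c1 := pi0_class Hg; set c2 := pi0_class Hh; set c3 := pi0_class Hgh.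
apply: word_sym.
have rel : pi0_relators (x := x) [:: (c1, false); (c2, false); (c3, true)].
  exists c1, c2, c3; split=> //; exists g, h, q.
  by split; exact: pi0_set_class.
apply: word_trans _ (word_relator [::] [:: (c3, false)] rel).
apply: word_sym.
exact: (word_cancel (@pi0_relators R G X a x) [:: (c1, false); (c2, false)]
  c3 true [::]).
Qed.

Lemma jump1 q : jump (1, q) = 1.
Proof.
have H1 := isotropy1 q.
by apply: (mulgI (jump (1, q))); rewrite -jumpM// !mulg1.
Qed.

(** * Local trivialisations of the principal covering *)

(** Identifying [(g * h, q, w * jump (h, q))] with [(g, q, w)] for [(h, q)] in the
    isotropy makes [G * Q * pi0_hat x] into a principal covering of [X], on
    which [pi0_hat x] acts on the left.  The function [f] is a section of it over
    [U], lifted to [G * Q].  Asking [f] to be constant along paths only, and not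
    to be locally constant, is easier to check and amounts to the same since
    [G * Q] is locally path-connected. *)
Definition trivialises (U : set X) (f : G * Q -> pi0_hat x) :=
  [/\ open U,
      forall y z (c : path_in R y z), range c `<=` phi @^-1` U -> f y = f z &
      forall g h q, U (phi (g, q)) -> H (h, q) ->
        f (g * h, q) = f (g, q) * jump (h, q)].

Lemma trivialises_mul U f w :
  trivialises U f -> trivialises U (fun y => w * f y).
Proof.
move=> [oU fc fH]; split=> // [y z c cU|g h q Ug Hh].
  by rewrite (fc _ _ c).
by rewrite fH// mulgA.
Qed.

Lemma trivialises_act U f g : trivialises U f ->
  trivialises (a g^-1 @^-1` U) (fun y => f (g^-1 * y.1, y.2)).
Proof.
move=> [oU fc fH]; split=> [|y z c cU|k h q /= Ugk Hh].
- by apply: open_comp oU => p _; exact: action_map_continuous.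
- have cg : continuous (fun y : G * Q => (g^-1 * y.1, y.2)).
    apply: continuous_pair continuous_snd.
    apply: mul_continuous_fun continuous_fst; exact: cst_continuous.
  apply: (fc _ _ (push_path cg c)) => _ [t _ <-] /=.
  rewrite /mk_path /= phi_act; apply: (cU (c t)).
  by exists t.
- by rewrite mulgA fH// phi_act.
Qed.

Hypothesis regular_x : regular_section x.
Hypothesis pcik_Q : path_connected_im_kleinen R Q.

Lemma total_pcik : path_connected_im_kleinen R (G * Q)%type.
Proof. exact: prod_pcik (@lie_pcik R G) pcik_Q. Qed.

(** Two trivialisations differ by a locally constant left factor: their ratio is
    invariant under the isotropy, hence descends to [X]. *)
Lemma trivialises_ratio U f U' f' p : trivialises U f -> trivialises U' f' ->
  U p -> U' p -> exists2 V, open_nbhs p V &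
  exists w, forall y, V (phi y) -> f y = w * f' y.
Proof.
move=> [oU fc fH] [oU' fc' fH'] Up U'p.
have [y0 y0p] := orbit_map_lift p.
pose w := f y0 * (f' y0)^-1.
have indep y z : U (phi y) -> U' (phi y) -> phi y = phi z ->
    f y * (f' y)^-1 = f z * (f' z)^-1.
  case: y z => [g q] [h r] Uy U'y yz; have [/= qr Hgh] := phi_fibre yz.
  subst r; rewrite -[h](mulVKg g) fH// fH'//.
  by rewrite invgM mulgA mulgK.
pose V := [set r | (U `&` U') r /\
  forall y, phi y = r -> f y * (f' y)^-1 = w].
exists V; last first.
  by exists w => y [_ /(_ _ erefl) <-]; rewrite mulgVK.
split; last first.
  by split=> // y yp; apply: indep; rewrite ?yp// y0p.
apply/orbit_map_open; apply: (pcik_open total_pcik (U := phi @^-1` (U `&` U'))).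
- by apply/orbit_map_open; exact: openI.
- by move=> y [].
- move=> y z c cU [_ Vy]; have Uz : (U `&` U') (phi z).
    by apply: cU; exists one; rewrite ?path_one.
  split=> // z' z'z; rewrite (indep z' z) ?z'z//; [|by case: Uz..].
  rewrite -(fc _ _ c) -?(fc' _ _ c) ?Vy// => u /cU; by case.
Qed.

(** A component of [phi @^-1` U] is labelled by the component of the isotropy
    group at [q] into which the deformation retraction carries it.  The labels
    are compatible with the isotropy: the tracks of [(g, q')] and [(h, q')] lie
    over the same path of [Q] and the second one stays in the isotropy, so that
    their product is a path in [phi @^-1` U].  The neighbourhood is shrunk so that
    [x] takes its values in it over its projection, for [(h, q')] to have a
    track. *)
Lemma trivialises_section q : exists U f, trivialises U f /\ U (x q).
Proof.
have [_ /(_ q)[U [oU Uxq [h [[ch h0 h1 hfix] hH hcoh]]]]] := regular_x.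
pose U' := U `&` [set p | U (x (orbit_proj a p))].
pose D := set_type (phi @^-1` U).
have DP (y : D) : U (phi (set_val y)) by have := set_mem (valP y).
pose inD y (Uy : U (phi y)) : D := exist _ y (mem_set Uy : y \in phi @^-1` U).
pose f y := if pselect (U (phi y)) is left Uy
  then jump (set_val (h (one, inD y Uy))) else 1.
have fE (y : D) : f (set_val y) = jump (set_val (h (one, y))).
  rewrite /f; case: pselect => [Uy|/(_ (DP y))//].
  by congr (jump (set_val (h (one, _)))); exact: val_inj.
have cval : continuous (set_val : D -> G * Q) by exact: initial_continuous.
have hfib (y : D) : H (set_val (h (one, y))) /\ (set_val (h (one, y))).2 = q.
  exact: h1.
have fpath y z (c : path_in R y z) : range c `<=` phi @^-1` U -> f y = f z.
  move=> cU; have cD t : c t \in phi @^-1` U by apply/mem_set/cU; exists t.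
  pose c' t : D := exist _ (c t) (cD t).
  have cc' : continuous c' by apply: continuous_comp_initial; exact: cts_fun.
  have Ef t : f (c t) = jump (set_val (h (one, c' t))) by rewrite -fE.
  apply: (@path_ends _ _ _ _ c (fun y z => f y = f z)); rewrite !Ef.
  have cF : continuous (fun t => set_val (h (one, c' t))).
    apply: (continuous_cmp (f := fun t => h (one, c' t)) _ cval).
    apply: (continuous_cmp (f := fun t => (one, c' t)) _ ch).
    by apply: continuous_pair cc'; exact: cst_continuous.
  apply: (jump_path (c := mk_path cF erefl erefl)) => _ [t _ <-].
  by have [] := hfib (c' t).
have oU' : open U'.
  apply: openI => //; apply: open_comp oU => p _.
  apply: continuous_comp; first exact: orbit_proj_continuous.
  exact: section_continuous.
exists U', f; split; last by split=> //=; rewrite sectionK.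
split=> // [y z c cU'|g k r [Ugr]]; first by apply: fpath => ? /cU' [].
rewrite /= phi_proj /= => Uxr Hk.
have Ukr : U (phi (k, r)) by rewrite Hk.
pose yg := inD (g, r) Ugr; pose yk := inD (k, r) Ukr.
pose dg t := set_val (h (t, yg)); pose dk t := set_val (h (t, yk)).
have dH t : H (dk t) by apply: hH; exact: Hk.
have d2 t : (dg t).2 = (dk t).2 by exact: hcoh.
have cd (y : D) : continuous (fun t => set_val (h (t, y))).
  apply: (continuous_cmp (f := fun t => h (t, y)) _ cval).
  apply: (continuous_cmp (f := fun t => (t, y)) _ ch).
  by apply: continuous_pair => [t|]; [exact: cvg_id | exact: cst_continuous].
pose d t := ((dg t).1 * (dk t).1, (dg t).2).
have cdd : continuous d.
  apply: continuous_pair; last exact: continuous_cmp (cd yg) continuous_snd.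
  apply: mul_continuous_fun; [exact: continuous_cmp (cd yg) continuous_fst|].
  exact: continuous_cmp (cd yk) continuous_fst.
have dE t : phi (d t) = phi (dg t).
  rewrite /d [dg t in RHS]surjective_pairing; apply: phi_isotropy.
  by rewrite d2 -surjective_pairing.
have dgE : dg zero = (g, r) by rewrite /dg h0.
have dkE : dk zero = (k, r) by rewrite /dk h0.
have d0 : d zero = (g * k, r) by rewrite /d dgE dkE.
rewrite (fpath _ _ (mk_path cdd d0 erefl)); last first.
  by move=> _ [t _ <-] /=; rewrite /mk_path dE; exact: DP.
have [Hg1 g1q] := hfib yg; have [Hk1 k1q] := hfib yk.
have Hd : H (d one).
  apply: isotropyM; first by rewrite -surjective_pairing.
  by rewrite d2 -surjective_pairing.
have Ud : U (phi (d one)) by rewrite dE; exact: DP.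
rewrite -[d one]/(set_val (inD _ Ud)) fE hfix //=.
rewrite jumpM; last first.
- by rewrite d2 -surjective_pairing.
- by rewrite -surjective_pairing.
rewrite -surjective_pairing; congr (_ * _).
  by rewrite -[(g, r)]/(set_val yg) fE.
rewrite d2 -surjective_pairing -dkE.
apply/esym/(jump_path (c := mk_path (cd yk) erefl erefl)) => _ [t _ <-].
exact: dH.
Qed.

Lemma trivialises_exists p : exists U f, trivialises U f /\ U p.
Proof.
have [[g q] gqp] := orbit_map_lift p; have [U [f [Uf Uxq]]] := trivialises_section q.
exists (a g^-1 @^-1` U), (fun y => f (g^-1 * y.1, y.2)).
split; first exact: trivialises_act.
by rewrite /= -gqp /orbit_map /= -actionM mulVg action1.
Qed.

End Isotropy.

(** * Monodromy *)

Section Monodromy.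
Variables (R : realType) (G : lieGroupType R) (X : topologicalType).
Variables (a : continuous_action G X) (x : orbit_space a -> X).
Hypothesis regular_x : regular_section x.
Local Notation Q := (orbit_space a).
Hypothesis pcik_Q : path_connected_im_kleinen R Q.
Local Notation I := (unit_itv R).
Local Notation H := (isotropy x).
Local Notation phi := (orbit_map x).
Let section_x : polar_section x := regular_x.1.

Section Flat.
Variables (Z : topologicalType) (sigma : Z -> X).
Hypothesis csigma : continuous sigma.

(** A flat [s] is a lift of [sigma] over [A] to the principal covering: [s z] is
    to be read on the fibre of [phi] over [sigma z] only. *)
Definition flat (A : set Z) (s : Z -> G * Q -> pi0_hat x) :=
  forall z, A z -> exists U f, [/\ trivialises U f, U (sigma z) &
    nbhs z [set z' | A z' -> forall y, phi y = sigma z' -> s z' y = f y]].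

Lemma flat_mul A s w : flat A s -> flat A (fun z y => w * s z y).
Proof.
move=> As z /As[U [f [Uf Uz Nz]]]; exists U, (fun y => w * f y); split=> //.
  exact: trivialises_mul.
by apply: filterS Nz => z' h Az' y yz'; rewrite h.
Qed.

Lemma flat_sub A B s : B `<=` A -> flat A s -> flat B s.
Proof.
move=> BA As z /BA/As[U [f [Uf Uz Nz]]]; exists U, f; split=> //.
by apply: filterS Nz => z' h /BA/h.
Qed.

Lemma flat_trivialises A U f : trivialises U f -> (forall z, A z -> U (sigma z)) ->
  flat A (fun=> f).
Proof.
move=> Uf AU z Az; exists U, f; split=> //; first exact: AU.
by apply: nearW => z' /=.
Qed.

Lemma flat_ratio A s s' z : flat A s -> flat A s' -> A z ->
  exists w, nbhs z [set z' | A z' ->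
    forall y, phi y = sigma z' -> s z' y = w * s' z' y].
Proof.
move=> As As' Az; have [U [f [Uf Uz Nz]]] := As _ Az.
have [U' [f' [Uf' U'z Nz']]] := As' _ Az.
have [V [oV Vz] [w ff']] := trivialises_ratio section_x pcik_Q Uf Uf' Uz U'z.
exists w; have NV : nbhs z (sigma @^-1` V).
  by apply: csigma; exact: open_nbhs_nbhs.
apply: filterS (filterI (filterI Nz Nz') NV) => z' [[h h'] Vz'] Az' y yz'.
by rewrite h// h'// ff'// yz'.
Qed.

(** The ratio of two lifts is a locally constant function on [A]. *)
Lemma flat_unique A s s' z0 y0 : connected A -> flat A s -> flat A s' ->
  A z0 -> phi y0 = sigma z0 -> s z0 y0 = s' z0 y0 ->
  forall z y, A z -> phi y = sigma z -> s z y = s' z y.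
Proof.
move=> cA As As' Az0 y0z0 e0 z y Az.
pose B := [set z | forall y, phi y = sigma z -> s z y = s' z y].
have loc z1 : A z1 -> nbhs z1 [set z' | A z' -> B z1 <-> B z'].
  move=> Az1; have [w Nw] := flat_ratio As As' Az1.
  have Bw z' : A z' -> (forall y, phi y = sigma z' -> s z' y = w * s' z' y) ->
      B z' <-> w = 1.
    move=> Az' h; split=> [Bz'|w1 y' y'z']; last by rewrite h// w1 mul1g.
    have [y' y'z'] := orbit_map_lift section_x (sigma z').
    by apply: (mulIg (s' z' y')); rewrite mul1g -h// Bz'.
  have e1 := Bw z1 Az1 (nbhs_singleton Nw Az1).
  apply: filterS (Nw) => z' hz' Az'; have e' := Bw z' Az' (hz' Az').
  by split=> [/e1/e'|/e'/e1].
suff: A `<=` B by move/(_ z Az y).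
apply: connected_locally_constant => //.
- by move=> z1 /loc lz Bz; apply: filterS lz => z' h /h[+ _]; apply.
- by move=> z1 /loc lz nB; apply: filterS lz => z' h /h[_ Bz] /Bz.
- exists z0; split=> // y' y'z0; have [w /nbhs_singleton h] := flat_ratio As As' Az0.
  have w1 : w = 1 by apply: (mulIg (s' z0 y0)); rewrite mul1g -h.
  by rewrite h// w1 mul1g.
Qed.

Lemma flat_glue A B s s' : closed A -> closed B -> connected (A `&` B) ->
  A `&` B !=set0 -> flat A s -> flat B s' -> exists s'', flat (A `|` B) s''.
Proof.
move=> clA clB cAB [z0 [Az0 Bz0]] As Bs'.
have [y0 y0z0] := orbit_map_lift section_x (sigma z0).
pose w := s z0 y0 * (s' z0 y0)^-1.
have Bws := flat_mul w Bs'.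
have agree z y : A z -> B z -> phi y = sigma z -> s z y = w * s' z y.
  move=> Az Bz; apply: (flat_unique (A := A `&` B) (s := s)
    (s' := fun z y => w * s' z y) (z0 := z0) (y0 := y0)) => //.
  - by apply: flat_sub As => ? [].
  - by apply: flat_sub Bws => ? [].
  - by rewrite mulgVK.
pose s2 z y := if pselect (A z) then s z y else w * s' z y.
have s2A z y : A z -> s2 z y = s z y by rewrite /s2; case: pselect.
have s2B z y : B z -> phi y = sigma z -> s2 z y = w * s' z y.
  by rewrite /s2; case: pselect => // ? ? ?; exact: agree.
exists s2 => z ABz.
have [Az|nAz] := pselect (A z); last first.
  have Bz : B z by case: ABz.
  have [U [f [Uf Uz Nz]]] := Bws _ Bz; exists U, f; split=> //.
  have nA : nbhs z (~` A) by apply: open_nbhs_nbhs; split=> //; exact: closed_openC.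
  apply: filterS (filterI Nz nA) => z' [h nAz'] [//|Bz'] y yz'.
  by rewrite s2B//; exact: h.
have [U [f [Uf Uz Nz]]] := As _ Az; exists U, f; split=> //.
have [Bz|nBz] := pselect (B z); last first.
  have nB : nbhs z (~` B) by apply: open_nbhs_nbhs; split=> //; exact: closed_openC.
  apply: filterS (filterI Nz nB) => z' [h nBz'] [Az'|//] y yz'.
  by rewrite s2A//; exact: h.
have [U' [f' [Uf' U'z Nz']]] := Bws _ Bz.
have [V [oV Vz] [v ff']] := trivialises_ratio section_x pcik_Q Uf Uf' Uz U'z.
have v1 : v = 1.
  have [y yz] := orbit_map_lift section_x (sigma z).
  apply: (mulIg (f' y)); rewrite mul1g -ff' ?yz//.
  rewrite -(nbhs_singleton Nz Az y yz) -(nbhs_singleton Nz' Bz y yz).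
  exact: agree.
have NV : nbhs z (sigma @^-1` V).
  by apply: csigma; exact: open_nbhs_nbhs.
apply: filterS (filterI (filterI Nz Nz') NV) => z' [[h h'] Vz'] ABz' y yz'.
have [Az'|nAz'] := pselect (A z'); first by rewrite s2A//; exact: h.
have Bz' : B z' by case: ABz'.
by rewrite s2B// ff' ?yz'// v1 mul1g; exact: h'.
Qed.

End Flat.

Lemma flat_comp (Z Z' : topologicalType) (sigma : Z -> X) (k : Z' -> Z) A A' s :
  continuous k -> (forall z, A' z -> A (k z)) -> flat sigma A s ->
  flat (sigma \o k) A' (s \o k).
Proof.
move=> ck AA' As z /AA'/As[U [f [Uf Uz Nz]]]; exists U, f; split=> //.
have Nkz : nbhs z (k @^-1` [set z' | A z' ->
    forall y, phi y = sigma z' -> s z' y = f y]) by exact: ck Nz.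
apply: filterS Nkz => z' h A'z'.
by apply: h; exact: AA'.
Qed.

Definition rectangle (r s t u : R) : set (I * I) :=
  [set v | (r <= itv_val v.1 <= s)%R /\ (t <= itv_val v.2 <= u)%R].

Lemma closed_rectangle r s t u : closed (rectangle r s t u).
Proof.
have c1 : continuous (fun v : I * I => itv_val v.1 : R).
  exact: continuous_cmp continuous_fst (@itv_val_continuous R).
have c2 : continuous (fun v : I * I => itv_val v.2 : R).
  exact: continuous_cmp continuous_snd (@itv_val_continuous R).
have cl (f : I * I -> R) (m n : R) : continuous f ->
    closed [set v | (m <= f v <= n)%R].
  move=> cf.
  have -> : [set v | (m <= f v <= n)%R] =
      (f @^-1` [set y | m <= y]%R) `&` (f @^-1` [set y | y <= n]%R).
    by apply/seteqP; split=> v /= => [/andP[]|[-> ->]].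
  apply: closedI; move/continuous_closedP: cf; apply.
    exact: closed_ge.
  exact: closed_le.
exact: closedI (cl _ r s c1) (cl _ t u c2).
Qed.

(** Homotopy lifting: lifts over thin rectangles are glued first along the second
    coordinate, then along the first one. *)
Lemma flat_exists_square (sigma : I * I -> X) : continuous sigma ->
  exists s, flat sigma setT s.
Proof.
move=> csigma; have le01 : (0 <= 1 :> R)%R by exact: ler01.
have strip (r : R) : (0 <= r <= 1)%R -> exists2 d : R, (0 < d)%R &
    exists s, flat sigma (rectangle (r - d) (r + d) 0 1) s.
  move=> r01; pose P t u := exists2 d : R, (0 < d)%R &
    exists s, flat sigma (rectangle (r - d) (r + d) t u) s.
  apply: (@interval_induction R P) => // [s t u s0 st tu u1|t t01].
    move=> [d d0 [f fd]] [d' d'0 [f' fd']].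
    pose m := Num.min d d'; have m0 : (0 < m)%R by rewrite lt_min d0.
    have [md md'] : (m <= d /\ m <= d')%R by rewrite !ge_min !lexx orbT.
    exists m => //.
    have sub l l' (k : R) : (m <= k)%R ->
        rectangle (r - m) (r + m) l l' `<=` rectangle (r - k) (r + k) l l'.
      by move=> mk v [/andP[? ?] ?]; split=> //; lra.
    have -> : rectangle (r - m) (r + m) s u =
        rectangle (r - m) (r + m) s t `|` rectangle (r - m) (r + m) t u.
      apply/seteqP; split=> [v [vr /andP[sv vu]]|v [] [vr /andP[sv vu]]].
      - have [vt|/ltW tv] := leP (itv_val v.2) t; [left|right]; split=> //.
          by rewrite sv vt.
        by rewrite tv vu.
      - by split=> //; rewrite sv (le_trans vu tu).
      - by split=> //; rewrite vu (le_trans st sv).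
    have t01 : (0 <= t <= 1)%R by rewrite (le_trans s0 st) (le_trans tu u1).
    apply: flat_glue (flat_sub (sub _ _ _ md) fd) (flat_sub (sub _ _ _ md') fd') => //.
    + exact: closed_rectangle.
    + exact: closed_rectangle.
    + have -> : rectangle (r - m) (r + m) s t `&` rectangle (r - m) (r + m) t u =
          (fun v => (v, to_itv t)) @` [set v | (r - m <= itv_val v <= r + m)%R].
        apply/seteqP; split=> [[v w] [/= [/= vr /andP[_ vt]] [_ /andP[tv _]]]|].
          exists v => //; congr pair; rewrite -[w]itv_valK; congr to_itv.
          by apply/eqP; rewrite eq_le vt tv.
        move=> _ [v vr <-]; split; split=> //=; rewrite to_itvE// lexx.
          by rewrite st.
        by rewrite tu.
      apply: connected_continuous_connected; first exact: itv_segment_connected.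
      apply: continuous_subspaceT; apply: continuous_pair => [v|]; first exact: cvg_id.
      exact: cst_continuous.
    + exists (to_itv r, to_itv t); split; split=> /=; rewrite !to_itvE//; lra.
  have [U [f [Uf Urt]]] :=
    trivialises_exists section_x regular_x (sigma (to_itv r, to_itv t)).
  have : nbhs (to_itv r, to_itv t) (sigma @^-1` U).
    by apply: csigma; apply: open_nbhs_nbhs; split=> //; case: Uf.
  move=> [[N N'] /= [/itv_nbhs[d d0 dN] /itv_nbhs[d' d'0 dN']] NU].
  exists d' => // s u s0 su u1 ts ut; exists (d / 2)%R; first by lra.
  exists (fun=> f); apply: flat_trivialises Uf _ => v [/andP[? ?] /andP[? ?]].
  by apply: (NU v); split; [apply: dN | apply: dN']; lra.
have -> : [set: I * I] = rectangle 0 1 0 1.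
  by apply/seteqP; split=> // v _; split; exact: itv_valP.
pose P r s := exists f, flat sigma (rectangle r s 0 1) f.
apply: (@interval_induction R P) => // [r s t r0 rs st t1 [f fd] [f' fd']|r r01].
  rewrite /P; have -> : rectangle r t 0 1 = rectangle r s 0 1 `|` rectangle s t 0 1.
    apply/seteqP; split=> [v [/andP[rv vt] v01]|v [] [/andP[rv vt] v01]].
    - have [vs|/ltW sv] := leP (itv_val v.1) s; [left|right]; split=> //.
        by rewrite rv vs.
      by rewrite sv vt.
    - by split=> //; rewrite rv (le_trans vt st).
    - by split=> //; rewrite vt (le_trans rs rv).
  have s01 : (0 <= s <= 1)%R by rewrite (le_trans r0 rs) (le_trans st t1).
  apply: flat_glue fd fd' => //.
  + exact: closed_rectangle.
  + exact: closed_rectangle.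
  + have -> : rectangle r s 0 1 `&` rectangle s t 0 1 =
        (fun v => (to_itv s, v)) @` [set: I].
      apply/seteqP; split=> [[v w] [/= [/= /andP[_ vs] _] [/= /andP[sv _] _]]|].
        exists w => //; congr pair; rewrite -[v]itv_valK; congr to_itv.
        by apply/eqP; rewrite eq_le vs sv.
      move=> _ [v _ <-]; have v01 := itv_valP v.
      by split; split=> //=; rewrite to_itvE// lexx ?rs ?st.
    apply: connected_continuous_connected; first exact: itv_connected.
    apply: continuous_subspaceT; apply: continuous_pair => [|v]; last exact: cvg_id.
    exact: cst_continuous.
  + exists (to_itv s, to_itv 0); split; split=> /=; rewrite !to_itvE// ?rs ?st ?lexx//.
have [d d0 [f fd]] := strip _ r01; exists d => // s t r0 st t1 rs tr.
exists f; apply: flat_sub fd => v [/andP[? ?] ?]; split=> //; lra.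
Qed.

(** A path is a constant family of paths. *)
Lemma flat_exists (gamma : I -> X) : continuous gamma ->
  exists s, flat gamma setT s.
Proof.
move=> cg; have cgs := continuous_cmp (@continuous_snd I I) cg.
have [s ss] := flat_exists_square cgs.
exists (s \o (fun t => (zero, t))).
apply: (flat_comp (k := fun t : I => (zero : I, t)) _ _ ss) => //.
by apply: continuous_pair => [|t]; [exact: cst_continuous | exact: cvg_id].
Qed.

Definition flat_lift (gamma : I -> X) : I -> G * Q -> pi0_hat x :=
  if pselect (exists s, flat gamma setT s) is left E then projT1 (cid E)
  else fun _ _ => 1.

(** The lift of [gamma] that is [1] at [y] takes this value at [z]. *)
Definition monodromy (gamma : I -> X) (y z : G * Q) : pi0_hat x :=
  (flat_lift gamma zero y)^-1 * flat_lift gamma one z.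

Lemma monodromyE gamma s y z : continuous gamma -> flat gamma setT s ->
  phi y = gamma zero -> phi z = gamma one ->
  monodromy gamma y z = (s zero y)^-1 * s one z.
Proof.
move=> cg gs yg zg; rewrite /monodromy.
have : flat gamma setT (flat_lift gamma).
  by rewrite /flat_lift; case: pselect => [E|/(_ (flat_exists cg))//]; case: cid.
move: (flat_lift gamma) => l gl.
pose w := l zero y * (s zero y)^-1.
have := flat_unique cg (@itv_connected R) gl (flat_mul w gs) (z0 := zero) (y0 := y).
rewrite mulgVK => /(_ Logic.I yg erefl) E.
by rewrite (E zero y)// (E one z)// invgM -mulgA mulKg.
Qed.

Lemma monodromy_concat p q r (f : path_in R p q) (g : path_in R q r) y m z :
  phi y = p -> phi m = q -> phi z = r ->
  monodromy (concat f g) y z = monodromy f y m * monodromy g m z.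
Proof.
move=> yp mq zr; have cfg := @cts_fun _ _ (concat f g).
have [s ss] := flat_exists cfg.
pose k1 (t : I) : I := to_itv (itv_val t / 2)%R.
pose k2 (t : I) : I := to_itv ((itv_val t + 1) / 2)%R.
have ck1 : continuous k1.
  apply: (continuous_cmp _ (@to_itv_continuous R)).
  apply: real_continuousM; first exact: itv_val_continuous.
  exact: real_continuous_cst.
have ck2 : continuous k2.
  apply: (continuous_cmp _ (@to_itv_continuous R)).
  apply: real_continuousM; last exact: real_continuous_cst.
  by apply: real_continuousD; [exact: itv_val_continuous | exact: real_continuous_cst].
have fk : f =1 concat f g \o k1.
  move=> t; have /andP[t0 t1] := itv_valP t; rewrite /= /mk_path /= /concat_fun.
  rewrite /k1 to_itvE; last by lra.
  rewrite ifT; last by lra.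
  rewrite /itv_half1 to_itvE; last by lra.
  by rewrite -[t in LHS]itv_valK; congr (f (to_itv _)); lra.
have gk : g =1 concat f g \o k2.
  move=> t; have /andP[t0 t1] := itv_valP t; rewrite /= /mk_path /= /concat_fun.
  rewrite /k2 to_itvE; last by lra.
  case: leP => th.
    have t00 : itv_val t = 0%R by lra.
    rewrite /itv_half1 to_itvE; last by lra.
    rewrite t00 -[t]itv_valK t00 to_itv0 path_zero to_itv_ge1 ?path_one//; lra.
  rewrite /itv_half2 to_itvE; last by lra.
  by rewrite -[t in LHS]itv_valK; congr (g (to_itv _)); lra.
have fs := flat_comp (A' := setT) ck1 (fun _ _ => Logic.I) ss.
have gs := flat_comp (A' := setT) ck2 (fun _ _ => Logic.I) ss.
rewrite -(funext fk) in fs; rewrite -(funext gk) in gs.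
rewrite (monodromyE (s := s))// ?path_zero ?path_one//.
rewrite (monodromyE (s := s \o k1))// ?path_zero ?path_one//; last exact: cts_fun.
rewrite (monodromyE (s := s \o k2))// ?path_zero ?path_one//; last exact: cts_fun.
have k10 : k1 zero = zero by rewrite /k1 itv_val0 mul0r.
have k21 : k2 one = one by rewrite /k2 itv_val1 to_itv_ge1//; lra.
have k12 : k1 one = k2 zero.
  by rewrite /k1 /k2 itv_val1 itv_val0; congr to_itv; lra.
by rewrite /= k10 k21 k12 mulgA mulgK.
Qed.

(** A lift of the homotopy restricts to lifts of its two ends. *)
Lemma monodromy_homotopic p q (f g : path_in R p q) y z :
  phi y = p -> phi z = q -> path_homotopic f g ->
  monodromy f y z = monodromy g y z.
Proof.
move=> yp zq [k [ck k0 k1 kpq]]; have [s ss] := flat_exists_square ck.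
have row (r : I) : flat (fun t => k (r, t)) setT (fun t => s (r, t)).
  apply: (flat_comp (k := fun t : I => (r, t)) _ _ ss) => //.
  by apply: continuous_pair => [|t]; [exact: cst_continuous | exact: cvg_id].
(* On the two vertical sides [k] is constant, hence so is the lift. *)
have side t w : phi w = k (zero, t) -> (forall r, k (r, t) = k (zero, t)) ->
    s (zero, t) w = s (one, t) w.
  move=> wt kt.
  have cside : continuous (fun r : I => (r, t)).
    by apply: continuous_pair => [r|]; [exact: cvg_id | exact: cst_continuous].
  have col := flat_comp (A' := setT) cside (fun _ _ => Logic.I) ss.
  have [U [f' [Uf' Uw]]] :=
    trivialises_exists section_x regular_x (k (zero, t)).
  have cst_col : flat (k \o (fun r => (r, t))) setT
      (fun=> (fun v => (s (zero, t) w * (f' w)^-1) * f' v)).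
    apply: flat_trivialises (trivialises_mul _ Uf') _ => r _ /=.
    by rewrite kt.
  have E := flat_unique (continuous_cmp cside ck) (@itv_connected R) col cst_col
    (z0 := zero) (y0 := w) Logic.I wt.
  have e0 : (s \o (fun r => (r, t))) zero w = s (zero, t) w * (f' w)^-1 * f' w.
    by rewrite mulgVK.
  by rewrite -[RHS]/((s \o (fun r => (r, t))) one w) E ?mulgVK//= kt.
have rowf := row zero; have rowg := row one.
rewrite (funext k0) in rowf; rewrite (funext k1) in rowg.
rewrite (monodromyE (s := fun t => s (zero, t)))// ?path_zero ?path_one//;
  last exact: cts_fun.
rewrite (monodromyE (s := fun t => s (one, t)))// ?path_zero ?path_one//;
  last exact: cts_fun.
congr (_^-1 * _); apply: side => [|r].
- by rewrite k0 path_zero.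
- by rewrite (kpq r).1 (kpq zero).1.
- by rewrite k0 path_one.
- by rewrite (kpq r).2 (kpq zero).2.
Qed.

Lemma monodromy_act g p q (f : path_in R p q) y z : phi y = p -> phi z = q ->
  monodromy (act_path a g f) (g * y.1, y.2) (g * z.1, z.2) = monodromy f y z.
Proof.
move=> yp zq; have cf := @cts_fun _ _ f.
have [s ss] := flat_exists cf.
have gs : flat (act_path a g f) setT (fun t y => s t (g^-1 * y.1, y.2)).
  move=> t _; have [U [f' [Uf Ut Nt]]] := ss t Logic.I.
  exists (a g^-1 @^-1` U), (fun y => f' (g^-1 * y.1, y.2)).
  split; first exact: trivialises_act.
    by rewrite /= /mk_path /= -actionM mulVg action1.
  apply: filterS Nt => t' h _ w wt'; apply: (h Logic.I).
  rewrite phi_act -surjective_pairing wt' /= /mk_path /=.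
  by rewrite -actionM mulVg action1.
rewrite (monodromyE (s := fun t y => s t (g^-1 * y.1, y.2)))//.
- rewrite (monodromyE (s := s))// ?path_zero ?path_one//=.
  by rewrite !mulKg -!surjective_pairing.
- exact: cts_fun.
- by rewrite path_zero phi_act -surjective_pairing yp.
- by rewrite path_one phi_act -surjective_pairing zq.
Qed.

(** The lift of [phi \o c] can be chosen to be [1] along [c], which determines it
    at the other points of the fibres. *)
Lemma monodromy_phi y z (c : path_in R y z) y' z' :
  phi y' = phi y -> phi z' = phi z ->
  monodromy (push_path (phi_continuous section_x) c) y' z' =
  (jump x (y.1^-1 * y'.1, y'.2))^-1 * jump x (z.1^-1 * z'.1, z'.2).
Proof.
move=> yy zz; pose s t (w : G * Q) := jump x ((c t).1^-1 * w.1, w.2).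
have cc := @cts_fun _ _ c.
have ss : flat (push_path (phi_continuous section_x) c) setT s.
  move=> t _; have [U [f [Uf Ut]]] :=
    trivialises_exists section_x regular_x (phi (c t)).
  exists U, (fun w => (f (c t))^-1 * f w).
  split=> //; first exact: trivialises_mul.
  have [oU fc fH] := Uf.
  have ct : nbhs (c t) (phi @^-1` U).
    by apply: open_nbhs_nbhs; split=> //; exact/orbit_map_open.
  have [V ctV hV] := total_pcik pcik_Q ct.
  have Nt : nbhs t (c @^-1` V) by exact: cc ctV.
  apply: filterS Nt => t' /hV[d dU] _ w /esym/phi_fibre.
  move=> /(_ section_x)[/= cw Hw].
  rewrite (fc _ _ d dU).
  have Uct' : U (phi (c t')) by apply: dU; exists one; rewrite ?path_one.
  have -> : f w = f (c t') * jump x ((c t').1^-1 * w.1, w.2).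
    have ctE : c t' = ((c t').1, w.2) by rewrite -cw -surjective_pairing.
    by rewrite {1}ctE -fH ?mulVKg -?surjective_pairing -?ctE.
  by rewrite mulKg.
rewrite (monodromyE _ ss) /s ?path_zero ?path_one//.
exact: cts_fun.
Qed.

End Monodromy.

(** * Morphisms from a presented group *)

Section PresentedGroupMorphisms.
Variables (T : choiceType) (rels : set (word T)).
Local Notation P := (presented_group rels).

Lemma presented_groupP (w : P) : exists u, w = word_class rels u.
Proof.
by exists (repr w); rewrite -[LHS](@reprK _ {eq_quot (word_equiv rels)}).
Qed.

Lemma presented_liftE (K : groupType) (f : T -> K) u :
  (forall r, rels r -> word_eval f r = 1) ->
  presented_lift f (word_class rels u) = word_eval f u.
Proof.
move=> fr; apply: (word_eval_eq fr); apply/word_classP.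
exact: (@reprK _ {eq_quot (word_equiv rels)}).
Qed.

Lemma presented_group_ext (K : groupType) (f k : P -> K) :
  {morph f : u v / u * v} -> {morph k : u v / u * v} ->
  (forall c, f (word_class rels [:: (c, false)]) =
             k (word_class rels [:: (c, false)])) ->
  f =1 k.
Proof.
move=> fM kM fk w; have [u ->] := presented_groupP w.
have m1 (l : P -> K) : {morph l : u v / u * v} -> l 1 = 1.
  by move=> lM; apply: (mulgI (l 1)); rewrite -lM !mulg1.
elim: u => [|[c e] u IH]; first by rewrite word_class_nil !m1.
rewrite -cat1s word_class_cat fM kM IH; congr (_ * _); case: e => //.
have cV : word_class rels [:: (c, false)] * word_class rels [:: (c, true)] = 1.
  rewrite -word_class_cat -word_class_nil; apply/word_classP.
  exact: (word_cancel rels [::] c false [::]).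
apply: (mulgI (f (word_class rels [:: (c, false)]))).
by rewrite {2}fk -fM -kM cV !m1.
Qed.

End PresentedGroupMorphisms.

(** * From the isotropy to the Rhodes group *)

Section Comparison.
Variables (R : realType) (G : lieGroupType R) (X : topologicalType).
Variables (a : continuous_action G X) (x : orbit_space a -> X).
Local Notation Q := (orbit_space a).
Hypothesis regular_x : regular_section x.
Hypothesis lpc_X : locally_path_connected R X.
Hypothesis slsc_X : semilocally_simply_connected R X.
Hypothesis sc_Q : simply_connected R Q.
Variables (b : X) (e : forall p, path_in R b p).
Variables (gb : G) (qb : Q).
Hypothesis bE : orbit_map x (gb, qb) = b.
Local Notation I := (unit_itv R).
Local Notation H := (isotropy x).
Local Notation phi := (orbit_map x).
Local Notation "⟦ f ⟧" := (arrow e f) (format "⟦ f ⟧").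
Local Notation rhodes := (rhodes a e).
Let section_x : polar_section x := regular_x.1.
Let pcik_X : path_connected_im_kleinen R X := locally_path_connected_pcik lpc_X.
Let pcik_Q : path_connected_im_kleinen R Q := orbit_space_pcik pcik_X.

Lemma phi_slice_continuous g : continuous (fun q => phi (g, q)).
Proof.
apply: (continuous_cmp (f := fun q => (g, q)) _ (phi_continuous section_x)).
by apply: continuous_pair => [|q]; [exact: cst_continuous | exact: cvg_id].
Qed.

Definition slice_path g q r (d : path_in R q r) :
    path_in R (phi (g, q)) (phi (g, r)) :=
  push_path (@phi_slice_continuous g) d.

Definition base_path q r : path_in R q r := projT1 (cid (sc_Q.1 q r Logic.I Logic.I)).

(** As [Q] is simply connected, the class of a path in a slice [{g} * Q] depends
    on its end points only. *)
Definition slice g q r : pi1 R b := ⟦slice_path g (base_path q r)⟧.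

Lemma sliceE g q r (d : path_in R q r) : ⟦slice_path g d⟧ = slice g q r.
Proof.
have := sc_Q.2 _ (concat d (reverse (base_path q r))).
move=> /(push_path_homotopic (@phi_slice_continuous g))/(arrow_homotopic e).
rewrite (@arrow_const _ _ _ e _ _ (phi (g, q)) (push_path _ (cst q)))// => h.
apply: (mulIg (slice g q r)^-1); rewrite mulgV -h -arrow_reverse -arrow_concat.
by apply/esym/arrow_ext; exact: push_path_concat.
Qed.

Lemma slice_cat g q r s : slice g q r * slice g r s = slice g q s.
Proof.
rewrite -arrow_concat -(sliceE g (concat (base_path q r) (base_path r s))).
by apply/esym/arrow_ext; exact: push_path_concat.
Qed.

Lemma slice_refl g q : slice g q q = 1.
Proof. by apply: (mulgI (slice g q q)); rewrite slice_cat mulg1. Qed.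

Lemma act_slice g k q r (d : path_in R q r) :
  ⟦act_path a g (slice_path k d)⟧ = slice (g * k) q r.
Proof.
rewrite -(sliceE _ d); apply: arrow_ext => t.
by rewrite /= /mk_path /= /mk_path /= phi_act.
Qed.

Lemma phi_baseE k : phi (k, qb) = a (k * gb^-1) b.
Proof. by rewrite -bE -phi_act mulgVK. Qed.

(** A path [f] from [b] to [phi (k, q)] is completed by the slice through
    [(k, q)] to a path from [b] to a translate of [b]. *)
Definition completion z (f : path_in R b (phi z)) : rhodes :=
  rhodes_class e (concat f
    (recast (slice_path z.1 (base_path z.2 qb))
      (congr1 phi (esym (surjective_pairing z))) (phi_baseE z.1))).

Lemma arrow_completion z (f : path_in R b (phi z)) :
  ⟦concat f (recast (slice_path z.1 (base_path z.2 qb))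
      (congr1 phi (esym (surjective_pairing z))) (phi_baseE z.1))⟧ =
  ⟦f⟧ * slice z.1 z.2 qb.
Proof. by rewrite arrow_concat; congr (_ * _); exact: arrow_ext. Qed.

Lemma completion_eq z z' (f : path_in R b (phi z)) (f' : path_in R b (phi z')) :
  z = z' -> ⟦f⟧ = ⟦f'⟧ -> completion f = completion f'.
Proof.
move=> zz ff; subst z'; apply: rhodes_class_eq => //.
by rewrite !arrow_completion ff.
Qed.

(** The path [c] moves the group element of the completion along
    [c_t.1 * gb^-1], and the slices in which the completion ends sweep out a
    square over it. *)
Lemma completion_path z z' (c : path_in R z z') (f : path_in R b (phi z)) :
  completion (concat f (push_path (phi_continuous section_x) c)) = completion f.
Proof.
apply/esym/rhodes_classP.
have cc := @cts_fun _ _ c.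
have c1 : continuous (fun t => (c t).1) by exact: continuous_cmp cc continuous_fst.
have c2 : continuous (fun t => (c t).2) by exact: continuous_cmp cc continuous_snd.
have cu : continuous (fun t => (c t).1 * gb^-1).
  by apply: mul_continuous_fun => //; exact: cst_continuous.
have u0 : (c zero).1 * gb^-1 = z.1 * gb^-1 by rewrite path_zero.
have u1 : (c one).1 * gb^-1 = z'.1 * gb^-1 by rewrite path_one.
exists (mk_path cu u0 u1); rewrite !arrow_completion arrow_concat -!mulgA.
congr (_ * _).
have row q : continuous (fun t => phi ((c t).1, q)).
  apply: (continuous_cmp (f := fun t => ((c t).1, q)) _ (phi_continuous section_x)).
  by apply: continuous_pair => //; exact: cst_continuous.
have row0 q : phi ((c zero).1, q) = phi (z.1, q) by rewrite path_zero.
have row1 q : phi ((c one).1, q) = phi (z'.1, q) by rewrite path_one.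
pose rw q : path_in R (phi (z.1, q)) (phi (z'.1, q)) :=
  mk_path (row q) (row0 q) (row1 q).
have cq : continuous (fun t => (c t).2) := c2.
have q0 : (c zero).2 = z.2 by rewrite path_zero.
have q1 : (c one).2 = z'.2 by rewrite path_one.
pose cq' : path_in R z.2 z'.2 := mk_path cq q0 q1.
have ck (f1 : I -> G) (f2 : I -> Q) : continuous f1 -> continuous f2 ->
    continuous (fun s : I * I => phi (f1 s.1, f2 s.2)).
  move=> cf1 cf2.
  apply: (continuous_cmp (f := fun s : I * I => (f1 s.1, f2 s.2)) _
    (phi_continuous section_x)).
  by apply: continuous_pair; [exact: continuous_cmp continuous_fst cf1|
    exact: continuous_cmp continuous_snd cf2].
have -> : ⟦push_path (phi_continuous section_x) c⟧ =
    ⟦rw z.2⟧ * slice z'.1 z.2 z'.2.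
  rewrite -(sliceE _ cq').
  apply: (@arrow_diagonal _ _ _ _ (fun s => phi ((c s.1).1, (c s.2).2))) => [|t|t|t].
  - exact: (ck (fun t => (c t).1) (fun t => (c t).2)).
  - by rewrite /= path_zero.
  - by rewrite /= path_one.
  - by rewrite -surjective_pairing.
rewrite -mulgA slice_cat.
have -> : ⟦orbit_path a (mk_path cu u0 u1) b⟧ = ⟦rw qb⟧.
  by apply: arrow_ext => t; rewrite /= /mk_path /= /mk_path /= -phi_baseE.
apply/esym/(@arrow_square _ _ _ _
  (fun s => phi ((c s.1).1, base_path z.2 qb s.2))) => [|t|t|t|t].
- by apply: (ck (fun t => (c t).1) (base_path z.2 qb)) => //; exact: cts_fun.
- by rewrite /= path_zero.
- by rewrite /= path_one.
- by rewrite /= path_zero.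
- by rewrite /= path_one.
Qed.

(** The point [gb x(q)] is also the image of [(gb * h, q)]; completing there
    instead of at [(gb, q)] gives the element of [rhodes] attached to
    [(h, q)]. *)
Definition component_path h q (Hh : H (h, q)) : path_in R b (phi (gb * h, q)) :=
  recast (slice_path gb (base_path qb q)) bE (esym (phi_isotropy gb Hh)).

Definition component_class (y : G * Q) : rhodes :=
  if pselect (H (y.1, y.2)) is left Hy then completion (component_path Hy)
  else 1.

Lemma component_classE h q (Hh : H (h, q)) :
  component_class (h, q) = completion (component_path Hh).
Proof.
rewrite /component_class; case: pselect => //= Hh'.
by apply: completion_eq => //; exact: arrow_ext.
Qed.

Lemma arrow_component_path h q (Hh : H (h, q)) :
  ⟦component_path Hh⟧ = slice gb qb q.
Proof. exact: arrow_ext. Qed.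

(** Multiplying the completion at [z] by the class of [(h, q)] inserts a return
    trip in the slice through [z], which cancels. *)
Lemma completion_isotropy z z' h (f : path_in R b (phi z))
    (f' : path_in R b (phi z')) :
  H (h, z.2) -> z' = (z.1 * h, z.2) -> ⟦f⟧ = ⟦f'⟧ ->
  completion f' = completion f * component_class (h, z.2).
Proof.
move=> Hh zE ff'; subst z'; rewrite (component_classE Hh) -rhodes_classM.
apply: rhodes_class_eq.
  by rewrite /= !mulgA mulgVK.
rewrite arrow_twisted_mul !arrow_completion -ff' -mulgA; congr (_ * _).
rewrite arrow_act_concat.
have -> : ⟦act_path a (z.1 * gb^-1) (component_path Hh)⟧ = slice z.1 qb z.2.
  transitivity ⟦act_path a (z.1 * gb^-1) (slice_path gb (base_path qb z.2))⟧.
    exact: arrow_ext.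
  by rewrite act_slice mulgVK.
set s := recast _ _ _.
have -> : ⟦act_path a (z.1 * gb^-1) s⟧ = slice (z.1 * h) z.2 qb.
  transitivity ⟦act_path a (z.1 * gb^-1)
    (slice_path (gb * h) (base_path z.2 qb))⟧; first exact: arrow_ext.
  by rewrite act_slice mulgA mulgVK.
by rewrite mulgA slice_cat slice_refl mul1g.
Qed.

Lemma component_classM g h q : H (g, q) -> H (h, q) ->
  component_class (g * h, q) = component_class (g, q) * component_class (h, q).
Proof.
move=> Hg Hh; rewrite (component_classE (isotropyM Hg Hh)) (component_classE Hg).
apply: completion_isotropy => //=; first by rewrite mulgA.
by rewrite !arrow_component_path.
Qed.

Lemma component_class1 q : component_class (1, q) = 1.
Proof.
have H1 := isotropy1 x q.
by apply: (mulgI (component_class (1, q))); rewrite -component_classM// !mulg1.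
Qed.

(** The translate of [c] by [gb] carries one completion to the other
    ([completion_path]); its image under [phi] is a path of the slice [{gb} * Q]
    because [c] stays in the isotropy. *)
Lemma component_class_path y z (c : path_in R y z) : range c `<=` H ->
  component_class y = component_class z.
Proof.
case: y c => h q; case: z => k r c cH.
have Hh : H (h, q) by apply: cH; exists zero; rewrite ?path_zero.
have Hk : H (k, r) by apply: cH; exists one; rewrite ?path_one.
rewrite (component_classE Hh) (component_classE Hk).
have cgb : continuous (fun y : G * Q => (gb * y.1, y.2)).
  apply: continuous_pair continuous_snd.
  by apply: mul_continuous_fun continuous_fst; exact: cst_continuous.
rewrite -(completion_path (push_path cgb c)); apply: completion_eq => //.
rewrite arrow_concat !arrow_component_path -(slice_cat _ _ q r); congr (_ * _).
have cc2 : continuous (fun t => (c t).2).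
  exact: continuous_cmp (@cts_fun _ _ c) continuous_snd.
have c20 : (c zero).2 = q by rewrite path_zero.
have c21 : (c one).2 = r by rewrite path_one.
rewrite -(sliceE gb (mk_path cc2 c20 c21 : path_in R q r)).
apply: arrow_ext => t; rewrite /= /mk_path /= /mk_path.
apply: phi_isotropy; rewrite -surjective_pairing; apply: cH; by exists t.
Qed.

(** A short orbit path at [x q] that closes up is a contractible loop. *)
Lemma component_class_near1 q :
  nbhs (1 : G) [set g | H (g, q) -> component_class (g, q) = 1].
Proof.
have [U Uxq hU] := slsc_X (x q).
have U1 : nbhs (1 : G) [set g | U (a g (x q))].
  by apply: (@orbit_map_continuous _ _ a (x q) 1); rewrite action1.
have [V V1 hV] := @lie_pcik R G _ _ U1.
apply: filterS V1 => g /hV[u uU] Hg.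
pose l : loop R (x q) := recast (orbit_path a u (x q)) (action1 a (x q)) Hg.
have l1 : ⟦l⟧ = 1.
  rewrite -(arrow_cst e (x q)); apply: arrow_homotopic; apply: hU.
  by move=> _ [t _ <-]; apply: (uU (u t)); exists t.
have H1 := isotropy1 x q.
rewrite -(component_class1 q) (component_classE H1) (component_classE Hg).
have cgb : continuous (fun g : G => (gb * g, q)).
  apply: continuous_pair; last exact: cst_continuous.
  by apply: mul_continuous_fun => [|k]; [exact: cst_continuous | exact: cvg_id].
rewrite -(completion_path (push_path cgb u) (component_path H1)).
apply: completion_eq => //; rewrite arrow_concat !arrow_component_path.
rewrite -[LHS]mulg1; congr (_ * _).
transitivity ⟦act_path a gb l⟧.
  rewrite -(arrow_cst e (x q)) in l1; rewrite (arrow_act_eq a gb l1).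
  by rewrite (@arrow_const _ _ _ e _ _ (a gb (x q))).
by apply: arrow_ext => t; rewrite /= /mk_path /= /mk_path /= phi_act.
Qed.

(** Regularity lets an element of the isotropy slide, inside the isotropy, into
    a given fibre [H_q], where only translations by small elements remain. *)
Lemma component_class_near y : H y ->
  nbhs y [set z | H z -> component_class z = component_class y].
Proof.
case: y => h0 q0 Hy.
have [_ /(_ q0)[U [oU Uxq [h [[ch h0E h1 hfix] hH _]]]]] := regular_x.
have DP (y : set_type (phi @^-1` U)) : U (phi (set_val y)).
  by have := set_mem (valP y).
have Uy : U (phi (h0, q0)) by rewrite Hy.
pose y0 : set_type (phi @^-1` U) := exist _ (h0, q0) (mem_set Uy).
have cval : continuous (set_val : set_type (phi @^-1` U) -> G * Q).
  exact: initial_continuous.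
have cend : continuous (fun y => set_val (h (one, y))).
  apply: (continuous_cmp (f := fun y => h (one, y)) _ cval).
  apply: (continuous_cmp (f := fun y => (one, y)) _ ch).
  by apply: continuous_pair => [|t]; [exact: cst_continuous | exact: cvg_id].
have cquot : continuous (fun y => (set_val (h (one, y))).1 * h0^-1).
  apply: mul_continuous_fun; last exact: cst_continuous.
  exact: continuous_cmp cend continuous_fst.
have N1 : nbhs ((set_val (h (one, y0))).1 * h0^-1)
    [set g | H (g, q0) -> component_class (g, q0) = 1].
  by rewrite hfix //= mulgV; exact: component_class_near1.
have [B By0 hB] := set_type_nbhs (cquot y0 _ N1).
have NU : nbhs (h0, q0) (phi @^-1` U).
  by apply: open_nbhs_nbhs; split=> //; exact/orbit_map_open.
apply: filterS (filterI By0 NU) => y [By Uphi] Hz.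
pose yD : set_type (phi @^-1` U) := exist _ y (mem_set Uphi).
have := hB yD By => /= hy.
have [Hk kq] := h1 yD.
have ctrack : continuous (fun t => set_val (h (t, yD))).
  apply: (continuous_cmp (f := fun t => h (t, yD)) _ cval).
  apply: (continuous_cmp (f := fun t => (t, yD)) _ ch).
  by apply: continuous_pair => [t|]; [exact: cvg_id | exact: cst_continuous].
have track0 : set_val (h (zero, yD)) = y by rewrite h0E.
rewrite (component_class_path (c := mk_path ctrack track0 erefl)); last first.
  by move=> _ [t _ <-]; exact: hH.
rewrite [set_val (h (one, yD))]surjective_pairing kq.
rewrite [set_val (h (one, yD))]surjective_pairing kq in Hk.
have HV := isotropyV Hy; have Hkh := isotropyM Hk HV.
by rewrite -[X in (X, q0)](mulgVK h0) component_classM// hy// mul1g.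
Qed.

Lemma component_class_component y z : connected_component (H) y z ->
  component_class y = component_class z.
Proof.
move=> [C [Cy CH cC] Cz].
suff: C `<=` [set y' | component_class y = component_class y'] by apply.
apply: connected_locally_constant => //; last by exists y.
- move=> y' Cy' /= ->; apply: filterS (component_class_near (CH _ Cy')) => z' h Cz'.
  by rewrite h//; exact: CH.
- move=> y' Cy' /= ny'; apply: filterS (component_class_near (CH _ Cy')) => z' h Cz'.
  by rewrite h//; exact: CH.
Qed.

Definition rhodes_of_pi0 : pi0_hat x -> rhodes :=
  presented_lift (fun c => component_class (pi0_repr c)).

Lemma component_class_repr (c : pi0 H) y : pi0_set c y ->
  component_class (pi0_repr c) = component_class y.
Proof. by rewrite -pi0_reprE; exact: component_class_component. Qed.

Let relatorP r : pi0_relators r ->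
  word_eval (fun c : pi0 H => component_class (pi0_repr c)) r = 1.
Proof.
move=> [c1 [c2 [c3 [[g [h [q [c1g c2h c3gh]]]] ->]]]].
rewrite /word_eval !big_cons big_nil /= mulg1.
rewrite (component_class_repr c1g) (component_class_repr c2h).
rewrite (component_class_repr c3gh) component_classM ?mulgA ?mulgK ?mulgV//.
  by have [] := pi0_memP c1g.
by have [] := pi0_memP c2h.
Qed.

Lemma rhodes_of_pi0M : {morph rhodes_of_pi0 : u v / u * v}.
Proof. exact: (presented_lift_morphism relatorP).2. Qed.

Lemma rhodes_of_pi01 : rhodes_of_pi0 1 = 1.
Proof. exact: (presented_lift_morphism relatorP).1. Qed.

Lemma rhodes_of_pi0_gen c :
  rhodes_of_pi0 (word_class _ [:: (c, false)]) = component_class (pi0_repr c).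
Proof.
by rewrite /rhodes_of_pi0 presented_liftE//= /word_eval big_seq1.
Qed.

Lemma rhodes_of_pi0_jump y : H y -> rhodes_of_pi0 (jump x y) = component_class y.
Proof.
move=> Hy; rewrite (jump_class (pi0_set_class Hy)) rhodes_of_pi0_gen.
exact/component_class_repr/pi0_set_class.
Qed.

(** * Surjectivity *)

(** Quantifying over all the lifts [z] of the end point, although one is enough
    ([reached_lift]), allows the lift to be changed before a path of [G * Q] is
    appended. *)
Definition reached p (f : path_in R b p) :=
  forall z (zp : phi z = p), exists w,
    rhodes_of_pi0 w = completion (recast f erefl (esym zp)).

Lemma reached_eq p (f k : path_in R b p) : ⟦f⟧ = ⟦k⟧ -> reached f -> reached k.
Proof.
move=> fk fr z zp; have [w wE] := fr z zp; exists w; rewrite wE.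
apply: completion_eq => //; transitivity ⟦f⟧; first exact: arrow_ext.
by rewrite fk; exact: arrow_ext.
Qed.

Lemma reached_lift z (f : path_in R b (phi z)) w :
  rhodes_of_pi0 w = completion f -> reached f.
Proof.
move=> wE z' zz'; have [/= qq Hz] := phi_fibre section_x (esym zz').
rewrite -qq in Hz; exists (w * jump x (z.1^-1 * z'.1, z.2)).
rewrite rhodes_of_pi0M rhodes_of_pi0_jump// wE.
apply/esym/completion_isotropy => //; last exact: arrow_ext.
by rewrite mulVKg qq -surjective_pairing.
Qed.

Lemma reached_path p z z' (f : path_in R b p) (k : path_in R p (phi z))
    (c : path_in R z z') : reached (concat f k) ->
  reached (concat f (concat k (push_path (phi_continuous section_x) c))).
Proof.
move=> /(_ z erefl)[w wE]; apply: (reached_lift (w := w)); rewrite wE.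
rewrite -(completion_path c); apply: completion_eq => //.
by rewrite !arrow_concat mulgA.
Qed.

(** In a small open set [V] all paths with the same end points are homotopic, so
    being reached only depends on the end point.  The end points that are reached
    form an open set because [phi] is a quotient map and the paths of
    [phi @^-1` V] can be appended. *)
Lemma reached_local (p : X) : exists2 V, nbhs p V &
  forall (q r : X) (f : path_in R b q) (k : path_in R q r), range k `<=` V ->
    reached f -> reached (concat f k).
Proof.
have [U pU hU] := slsc_X p; have [V [oV Vp VU pV]] := lpc_X pU.
exists V; first exact: open_nbhs_nbhs.
have small q r (k k' : path_in R q r) : range k `<=` V -> range k' `<=` V ->
    ⟦k⟧ = ⟦k'⟧.
  move=> kV k'V; have Vq : V q by apply: kV; exists zero; rewrite ?path_zero.
  have [j jV] := pV _ _ Vp Vq.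
  have jk1 : ⟦concat (concat j (concat k (reverse k'))) (reverse j)⟧ = 1.
    rewrite -(arrow_cst e p); apply/arrow_homotopic/hU.
    apply: subset_trans VU.
    move=> s /path_range_concat[/path_range_concat[|/path_range_concat[]]|].
    - exact: jV.
    - exact: kV.
    - by move=> /path_range_reverse; exact: k'V.
    - by move=> /path_range_reverse; exact: jV.
  move: jk1; rewrite !arrow_concat !arrow_reverse => jk1.
  have : ⟦k⟧ * ⟦k'⟧^-1 = 1.
    by apply: (mulgI ⟦j⟧); apply: (mulIg ⟦j⟧^-1); rewrite jk1 mulg1 mulgV.
  by move=> kk1; apply: (mulIg ⟦k'⟧^-1); rewrite kk1 mulgV.
move=> q r f k kV fr.
have Vq : V q by apply: kV; exists zero; rewrite ?path_zero.
pose B := [set s | V s /\ exists k' : path_in R q s,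
  range k' `<=` V /\ reached (concat f k')].
have ophiV : open (phi @^-1` V) by exact/orbit_map_open.
have step y y' (c : path_in R y y') : range c `<=` phi @^-1` V ->
    B (phi y) -> B (phi y').
  move=> cV [_ [k' [k'V k'r]]].
  split; first by apply: cV; exists one; rewrite ?path_one.
  exists (concat k' (push_path (phi_continuous section_x) c)); split.
    move=> s /path_range_concat[/k'V //|[t _ <-]].
    by apply: cV; exists t.
  exact: reached_path.
have oB : open B.
  apply/(orbit_map_open section_x).
  apply: (pcik_open (total_pcik pcik_Q) ophiV) step => y [] //.
have oVB : open (V `\` B).
  apply/(orbit_map_open section_x).
  apply: (pcik_open (total_pcik pcik_Q) ophiV) => [y []//|y y' c cV [_ nBy]].
  split; first by apply: cV; exists one; rewrite ?path_one.
  move=> By'; apply: nBy; apply: (step _ _ (reverse c)) By'.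
  exact: subset_trans (@path_range_reverse _ _ _ _ _) cV.
have [k' [k'V k'r]] : exists k' : path_in R q r,
    range k' `<=` V /\ reached (concat f k').
  suff: range k `<=` B.
    by move/(_ r); case; first by exists one; rewrite ?path_one.
  apply: connected_locally_constant.
  - apply: connected_continuous_connected; first exact: itv_connected.
    exact/continuous_subspaceT/cts_fun.
  - move=> s _ Bs; have := open_nbhs_nbhs (conj oB Bs).
    by apply: filterS => s' Bs' _.
  - move=> s /kV Vs nBs; have := open_nbhs_nbhs (conj oVB (conj Vs nBs)).
    by apply: filterS => s' [_ nB] _.
  - exists q; split; first by exists zero; rewrite ?path_zero.
    split=> //; exists (cst q); split; first by move=> _ [t _ <-].
    apply: reached_eq fr; rewrite arrow_concat.
    by rewrite (@arrow_const _ _ _ e _ _ q (cst q))// mulg1.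
by apply: reached_eq k'r; rewrite !arrow_concat (small _ _ k k').
Qed.

Lemma completion_base : completion (recast (cst b : loop R b) erefl (esym bE)) = 1.
Proof.
rewrite -rhodes_class1; apply: rhodes_class_eq; first by rewrite mulgV.
rewrite arrow_completion slice_refl mulg1.
by rewrite !(@arrow_const _ _ _ e _ _ b).
Qed.

(** The property propagates along [f] by small steps, starting at [b]. *)
Lemma reached_all p (f : path_in R b p) : reached f.
Proof.
pose P s t := forall k : path_in R b (f (to_itv s)),
  reached k -> reached (concat k (subpath f s t)).
have : P 0%R 1%R.
  apply: (@interval_induction R P) => // [s t u _ _ _ _ Pst Ptu k kr|t t01].
    apply: reached_eq (Ptu _ (Pst _ kr)).
    rewrite !arrow_concat -mulgA -(arrow_concat e (subpath f s t)).
    by rewrite (arrow_homotopic e (subpath_concat f s t u)).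
  have [V fV hV] := reached_local (f (to_itv t)).
  have fN : nbhs (to_itv t) (f @^-1` V) by exact: (@cts_fun _ _ f) fV.
  have [d d0 hd] := itv_nbhs fN; exists d => // s u s0 su u1 ts ut k.
  apply: hV => _ [r _ <-].
  have /andP[r0 r1] := itv_valP r.
  rewrite /= /mk_path; apply: hd; rewrite to_itvE; nra.
have f0 : b = f (to_itv 0) by rewrite to_itv0 path_zero.
move=> /(_ (recast (cst b : loop R b) erefl f0)) P01.
have cr : reached (recast (cst b : loop R b) erefl f0).
  have base : reached (recast (cst b : loop R b) erefl (esym bE)).
    by apply: (reached_lift (w := 1)); rewrite rhodes_of_pi01 completion_base.
  move=> z zf; have [w wE] := base z (etrans (etrans zf (esym f0)) (esym bE)).
  by exists w; rewrite wE; apply: completion_eq => //; exact: arrow_ext.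
have f1 : f (to_itv 1) = p by rewrite to_itv1 path_one.
move=> z zp; have [w wE] := P01 cr z (etrans zp (esym f1)); exists w; rewrite wE.
apply: completion_eq => //.
transitivity ⟦concat (recast (cst b : loop R b) erefl f0) (subpath f 0 1)⟧.
  exact: arrow_ext.
rewrite arrow_concat (@arrow_const _ _ _ e _ _ b)// mul1g.
apply: arrow_ext => t; rewrite /= /mk_path /= subr0 mulr1 add0r.
by rewrite itv_valK.
Qed.

Lemma rhodes_of_pi0_surj r : exists w, rhodes_of_pi0 w = r.
Proof.
have [g [f ->]] := rhodesP r.
have zE : phi (g * gb, qb) = a g b by rewrite phi_act bE.
have [w wE] := reached_all f zE; exists w; rewrite wE.
apply: rhodes_class_eq; first by rewrite /= mulgK.
rewrite arrow_completion slice_refl mulg1; exact: arrow_ext.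
Qed.

(** * The inverse given by monodromy *)

Definition pi0_of_rhodes (r : rhodes) : pi0_hat x :=
  monodromy x (projT2 (repr r)) (gb, qb) (projT1 (repr r) * gb, qb).

Lemma pi0_of_rhodesE g (f : path_in R b (a g b)) :
  pi0_of_rhodes (rhodes_class e f) = monodromy x f (gb, qb) (g * gb, qb).
Proof.
rewrite /pi0_of_rhodes; have [u uf] := repr_rhodes e f.
move: (projT2 (repr (rhodes_class e f))) u uf.
move: (projT1 (repr (rhodes_class e f))) => g' f' u uf.
have gE h : phi (h * gb, qb) = a h b by rewrite phi_act bE.
have cu : continuous (fun t => (u t * gb, qb)).
  apply: continuous_pair; last exact: cst_continuous.
  by apply: mul_continuous_fun; [exact: cts_fun | exact: cst_continuous].
have u0 : (u zero * gb, qb) = (g' * gb, qb) by rewrite path_zero.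
have u1 : (u one * gb, qb) = (g * gb, qb) by rewrite path_one.
have hom : path_homotopic (concat f' (orbit_path a u b)) f.
  by apply: (@arrow_inj _ _ _ e); rewrite arrow_concat.
rewrite -(monodromy_homotopic regular_x pcik_Q bE (gE g) hom).
rewrite (monodromy_concat regular_x pcik_Q _ _ bE (gE g') (gE g)).
suff -> : monodromy x (orbit_path a u b) (g' * gb, qb) (g * gb, qb) = 1.
  by rewrite mulg1.
have -> : (orbit_path a u b : I -> X) =
    push_path (phi_continuous section_x) (mk_path cu u0 u1).
  by apply/funext => t; rewrite /= /mk_path /= gE.
by rewrite monodromy_phi//= !mulVg.
Qed.

Lemma pi0_of_rhodesM : {morph pi0_of_rhodes : r s / r * s}.
Proof.
move=> r s; have [g [f ->]] := rhodesP r; have [h [k ->]] := rhodesP s.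
have gE l : phi (l * gb, qb) = a l b by rewrite phi_act bE.
have ghE : phi (g * (h * gb), qb) = a (g * h) b by rewrite mulgA gE.
rewrite -rhodes_classM !pi0_of_rhodesE.
rewrite (monodromy_concat regular_x pcik_Q _ _ bE (gE g) (gE (g * h))).
congr (_ * _); rewrite -(monodromy_act regular_x pcik_Q g k bE (gE h)) /=.
by rewrite mulgA.
Qed.

Lemma pi0_of_component_class y : H y -> pi0_of_rhodes (component_class y) = jump x y.
Proof.
case: y => h q Hh; rewrite (component_classE Hh) pi0_of_rhodesE.
have hE : phi (gb * h, q) = phi (gb, q) by exact: phi_isotropy.
rewrite /= mulgVK.
rewrite (monodromy_concat regular_x pcik_Q _ _ bE (erefl _) (phi_baseE _)).
have slc g q1 q2 (d : path_in R q1 q2) : exists c : path_in R (g, q1) (g, q2),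
    push_path (phi_continuous section_x) c =1 slice_path g d.
  have cd : continuous (fun t => (g, d t)).
    by apply: continuous_pair; [exact: cst_continuous | exact: cts_fun].
  have d0 : (g, d zero) = (g, q1) by rewrite path_zero.
  have d1 : (g, d one) = (g, q2) by rewrite path_one.
  by exists (mk_path cd d0 d1).
have [c1 c1E] := slc gb _ _ (base_path qb q).
have [c2 c2E] := slc (gb * h) _ _ (base_path q qb).
have -> : (component_path Hh : I -> X) = push_path (phi_continuous section_x) c1.
  by apply/funext => t; rewrite c1E.
set s := recast (slice_path _ _) _ _.
have -> : (s : I -> X) = push_path (phi_continuous section_x) c2.
  by apply/funext => t; rewrite c2E.
rewrite !monodromy_phi//= !mulVg !jump1// invg1 mulg1 mul1g mulKg.
by rewrite mulg1.
Qed.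

Lemma rhodes_of_pi0K : cancel rhodes_of_pi0 pi0_of_rhodes.
Proof.
apply: presented_group_ext => //.
  by move=> u v; rewrite rhodes_of_pi0M pi0_of_rhodesM.
move=> c; rewrite rhodes_of_pi0_gen pi0_of_component_class; last exact: pi0_reprP.
exact/jump_class/pi0_repr_mem.
Qed.

Lemma pi0_of_rhodesK : cancel pi0_of_rhodes rhodes_of_pi0.
Proof.
by move=> r; have [w <-] := rhodes_of_pi0_surj r; rewrite rhodes_of_pi0K.
Qed.

(** The base point lies over [qb] but is translated by [gb], whence the
    conjugation. *)
Lemma pi0_hat_projE w : pi0_hat_proj x w =
  pi0G_class gb^-1 * rhodes_proj (rhodes_of_pi0 w) * pi0G_class gb.
Proof.
have gbV : pi0G_class gb * pi0G_class gb^-1 = 1.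
  by rewrite -pi0G_classM mulgV.
move: w; apply: presented_group_ext => [u v|u v|c].
- exact: gmulfM.
- rewrite rhodes_of_pi0M rhodes_projM !mulgA.
  by rewrite -(mulgA _ (pi0G_class gb)) gbV mulg1.
- have liftE : pi0_hat_proj x (word_class _ [:: (c, false)]) = pi0_proj c.
    rewrite /pi0_hat_proj presented_liftE ?/word_eval ?big_seq1//.
    move=> _ [c1 [c2 [c3 [[g [h [q [c1g c2h c3gh]]]] ->]]]].
    rewrite /word_eval !big_cons big_nil /= mulg1.
    rewrite (pi0_projE c1g) (pi0_projE c2h) (pi0_projE c3gh) pi0G_classM.
    by rewrite mulgA mulgV.
  rewrite liftE rhodes_of_pi0_gen /pi0_proj.
  have := pi0_reprP c; case: (pi0_repr c) => h q Hh.
  rewrite (component_classE Hh) rhodes_projE -!pi0G_classM /=.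
  by rewrite !mulgA mulVg mul1g mulgVK.
Qed.

End Comparison.

(** * Factorisation through a quotient group *)

Section QuotientMorphism.
Variables (A K : groupType) (N : normalClosed A) (f : A -> K).
Hypothesis fM : {morph f : u v / u * v}.
Hypothesis fN : forall u, (u \in N) = (f u == 1).

Definition quotient_lift (c : quotient_group N) : K := f (repr c).

Lemma quotient_projP (c : quotient_group N) : exists u, c = quotient_proj N u.
Proof.
exists (repr c); rewrite -[LHS](@reprK _ {eq_quot (coset_equiv N)}).
by [].
Qed.

Lemma morph1 : f 1 = 1.
Proof. by apply: (mulgI (f 1)); rewrite -fM !mulg1. Qed.

Lemma morphV u : f u^-1 = (f u)^-1.
Proof. by apply: (mulgI (f u)); rewrite -fM !mulgV morph1. Qed.

Lemma quotient_liftE u : quotient_lift (quotient_proj N u) = f u.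
Proof.
have : coset_rel N (repr (quotient_proj N u)) u.
  apply/(@eqmodP _ (coset_equiv N)); exact: (@reprK _ {eq_quot (coset_equiv N)}).
rewrite /coset_rel fN fM morphV => /eqP h.
by apply: (mulgI (f (repr (quotient_proj N u)))^-1); rewrite mulVg h.
Qed.

Lemma quotient_lift_morphism : monoid.monoid_morphism quotient_lift.
Proof.
have proj1 : quotient_proj N 1 = 1 by exact: gmulf1.
split=> [|c d]; first by rewrite -proj1 quotient_liftE morph1.
have [[u ->] [v ->]] := (quotient_projP c, quotient_projP d).
have projM : quotient_proj N (u * v) = quotient_proj N u * quotient_proj N v.
  exact: gmulfM.
by rewrite -projM !quotient_liftE fM.
Qed.

Lemma quotient_lift_inj : injective quotient_lift.
Proof.
move=> c d; have [[u ->] [v ->]] := (quotient_projP c, quotient_projP d).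
rewrite !quotient_liftE => uv; apply/(@eqmodP _ (coset_equiv N)).
by rewrite /= /coset_rel fN fM morphV uv mulVg.
Qed.

End QuotientMorphism.

(** * The exact sequence *)

Section OrbitKernel.
Variables (R : realType) (G : topologicalGroupType) (X : topologicalType).
Variables (a : continuous_action G X) (b : X) (e : forall p, path_in R b p).

Definition orbit_kernel_pred : {pred pi1 R (1 : G)} :=
  [pred u | orbit_pi1 a b u == 1].

Let orbit_kernel_group : group_closed orbit_kernel_pred.
Proof.
have oM := orbit_pi1M a e; split=> [|u v]; first by apply/eqP; exact: morph1.
move=> u1 v1; apply/eqP; rewrite oM (morphV oM).
by rewrite (eqP (u1 : _ == 1)) (eqP (v1 : _ == 1)) mulgV.
Qed.

Let orbit_kernel_stable g u :
  u \in orbit_kernel_pred -> conj_pi1 g u \in orbit_kernel_pred.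
Proof. by move=> u1; apply/eqP/(orbit_pi1_conj e)/eqP. Qed.

Definition orbit_kernel : pi0_submodule R G :=
  Pi0Submodule orbit_kernel_group orbit_kernel_stable.

End OrbitKernel.

Theorem corollary3p30 (R : realType) (G : lieGroupType R) (X : topologicalType)
    (a : continuous_action G X) (x : orbit_space a -> X) (b : X)
    (polarX : polar_space a) (regular_x : regular_section x) :
  exists (theta : pi0_submodule R G)
         (i : UMagmaMorphism.type (quotient_group theta) (pi1 R b))
         (p : UMagmaMorphism.type (pi1 R b) (ker_group (pi0_hat_proj x))),
    central_extension i p /\
    let incl : subgroup theta -> pi1 R (1 : G) := val in
    let alpha : pi1 R (1 : G) -> pi1 R b := fun u => i (quotient_proj theta u) in
    let beta : pi1 R b -> pi0_hat x := fun v => val (p v) in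
    [/\ injective incl, exact_at incl alpha, exact_at alpha beta,
        exact_at beta (pi0_hat_proj x) & surjective (pi0_hat_proj x)].
Proof.
have [_ conX lpcX slscX _ scQ _] := polarX.
have joined p : exists f : path_in R b p, True.
  exact: connected_joined (locally_path_connected_pcik lpcX) conX I I.
pose e p : path_in R b p := projT1 (cid (joined p)).
have [[gb qb] bE] := orbit_map_lift regular_x.1 b.
pose Psi := rhodes_of_pi0 regular_x scQ e bE.
pose Omega := @pi0_of_rhodes _ _ _ _ x _ e gb qb.
have PsiK : cancel Psi Omega.
  exact: rhodes_of_pi0K regular_x lpcX slscX scQ _ e _ _ bE.
have OmegaK : cancel Omega Psi.
  exact: pi0_of_rhodesK regular_x lpcX slscX scQ _ e _ _ bE.
have OmegaM : {morph Omega : r s / r * s}.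
  exact: pi0_of_rhodesM regular_x lpcX _ e _ _ bE.
have projE := pi0_hat_projE regular_x slscX scQ e bE.
have oM := orbit_pi1M a e.
have gbV : pi0G_class gb * pi0G_class gb^-1 = 1 by rewrite -pi0G_classM mulgV.
have proj_eq1 w : pi0_hat_proj x w = 1 <-> rhodes_proj (Psi w) = 1.
  rewrite projE; split=> [h|->]; last by rewrite mulg1 -pi0G_classM mulVg.
  apply: (mulgI (pi0G_class gb^-1)); apply: (mulIg (pi0G_class gb)).
  by rewrite h mulg1 -pi0G_classM mulVg.
pose theta := orbit_kernel a e.
have thetaE u : (u \in theta) = (orbit_pi1 a b u == 1) by [].
pose i0 : quotient_group theta -> pi1 R b := quotient_lift (orbit_pi1 a b).
have iE u : i0 (quotient_proj theta u) = orbit_pi1 a b u by exact: quotient_liftE.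
pose i : UMagmaMorphism.type (quotient_group theta) (pi1 R b) :=
  HB.pack i0 (isUMagmaMorphism.Build _ _ i0 (quotient_lift_morphism oM thetaE)).
pose w0 (v : pi1 R b) : pi0_hat x := Omega (rhodes_loop a e (repr v)).
have w0E f : w0 (loop_class f) = Omega (rhodes_loop a e f).
  by congr Omega; apply: rhodes_loop_homotopic; exact: repr_loop_class.
have w0ker v : w0 v \in ker_pred (pi0_hat_proj x).
  apply/eqP/proj_eq1; rewrite /w0 OmegaK.
  exact: rhodes_projE.
pose p0 v : ker_group (pi0_hat_proj x) := Sub (w0 v) (w0ker v).
have w0M : {morph w0 : u v / u * v}.
  move=> u v; have [[f ->] [k ->]] := (pi1P u, pi1P v).
  by rewrite -loop_class_concat !w0E rhodes_loop_concat OmegaM.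
have p0_val v : val (p0 v) = w0 v by exact: SubK.
have p0M : monoid.monoid_morphism p0.
  split=> [|u v]; apply: val_inj.
    by rewrite p0_val gmulf1 (morph1 w0M).
  by rewrite gmulfM !p0_val w0M.
pose p : UMagmaMorphism.type (pi1 R b) (ker_group (pi0_hat_proj x)) :=
  HB.pack p0 (isUMagmaMorphism.Build _ _ p0 p0M).
have w0_eq1 v : w0 v = 1 <-> exists u, orbit_pi1 a b u = v.
  have [f ->] := pi1P v; rewrite w0E -rhodes_loop_eq1; split=> [h|->].
    by apply: (can_inj OmegaK); rewrite h (morph1 OmegaM).
  exact: morph1 OmegaM.
have w0_surj w : pi0_hat_proj x w = 1 -> exists v, w0 v = w.
  move=> /proj_eq1; have [g [f fE]] := rhodesP (Psi w).
  rewrite fE rhodes_projE -pi0G_class1 => /pi0G_classP[C [Cg _ cC] C1].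
  have [u _] := connected_joined (@lie_pcik R G) cC C1 Cg.
  have [k kE] := rhodes_class_loop e u f.
  by exists (loop_class k); rewrite w0E kE -fE PsiK.
have p_val v : val (p v) = w0 v by exact: p0_val.
exists theta, i, p; split.
  split.
  - exact: quotient_lift_inj.
  - move=> v; split=> [/(congr1 val)|[c <-]].
      rewrite p_val gmulf1 => /w0_eq1[u <-].
      by exists (quotient_proj theta u); exact: iE.
    apply: val_inj; rewrite p_val gmulf1.
    by have [u ->] := quotient_projP c; apply/w0_eq1; exists u; rewrite -iE.
  - move=> [w wker]; have [v vw] : exists v, w0 v = w.
      exact: w0_surj (eqP (wker : _ == 1)).
    by exists v; apply: val_inj; rewrite p_val.
  - move=> c v; have [u ->] := quotient_projP c.
    by rewrite /= iE; exact: orbit_pi1_central.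
move=> incl alpha beta.
have alphaE u : alpha u = orbit_pi1 a b u by exact: iE.
have betaE v : beta v = w0 v by exact: p_val.
split.
- exact: val_inj.
- move=> u; rewrite alphaE; split=> [u1|[v <-]].
    have uth : u \in theta by rewrite thetaE u1.
    by exists (Sub u uth); exact: SubK.
  by apply/eqP; rewrite -thetaE; exact: (valP v).
- move=> v; rewrite betaE w0_eq1.
  by split=> -[u uv]; exists u; rewrite -uv ?alphaE.
- move=> w; split=> [/w0_surj[v <-]|[v <-]]; first by exists v.
  by rewrite betaE; exact: (eqP (w0ker v : _ == 1)).
- move=> c; set g := gb * pi0_repr c * gb^-1.
  exists (Omega (rhodes_class e (e (a g b)))).
  rewrite projE -/Psi OmegaK rhodes_projE -!pi0G_classM /g.
  by rewrite !mulgA mulVg mul1g mulgVK pi0G_reprK.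
Qed.
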